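(* Assume that $\mathfrak M_{\mathrm{erg}}(\Omega,\sigma)=\{m_1,\dots,m_n\}$ with $n\ge2$. Let $a_1\in C(\Omega)$ have Sacker and Sell spectrum $\mathrm{sp}(a_1)=[-\lambda_+,-\lambda_-]$ with $\lambda_-<\lambda_+$. Then there exist strictly positive functions $a_2,a_3\in C(\Omega)$ such that the $\lambda$-parametric family $$x'=-a_3(\omega\cdot t)x^3+a_2(\omega\cdot t)x^2+(a_1(\omega\cdot t)+\lambda)x,\qquad\omega\in\Omega,$$ exhibits the generalized pitchfork bifurcation of minimal sets (that is, diagram $(\mathrm{GP}_\alpha)$ or $(\mathrm{GP}_\beta)$).
   Context: $\Omega$ is a compact metric space with a continuous flow $\sigma:\mathbb R\times\Omega\to\Omega$, $(t,\omega)\mapsto\omega\cdot t$, which is minimal (every orbit is dense). $\mathfrak M_{\mathrm{erg}}(\Omega,\sigma)$ is the set of $\sigma$-ergodic Borel probability measures (the $m_i$ are distinct). $C(\Omega)$ is the space of continuous real functions on $\Omega$. For $b\in C(\Omega)$, the family $x'=b(\omega\cdot t)x$ has exponential dichotomy over $\Omega$ if there are $k\ge1$, $\delta>0$ such that either $\exp\int_0^t b(\omega\cdot s)\,ds\le ke^{-\delta t}$ for all $\omega$, $t\ge0$, or $\exp\int_0^t b(\omega\cdot s)\,ds\le ke^{\delta t}$ for all $\omega$, $t\le0$. The Sacker and Sell spectrum of $a\in C(\Omega)$ is the set $\mathrm{sp}(a)$ of $\lambda\in\mathbb R$ such that $x'=(a(\omega\cdot t)-\lambda)x$ does not have exponential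 dichotomy over $\Omega$; it is a compact interval or a point. The family with parameter $\lambda$ induces the local skewproduct flow $\tau_\lambda(t,\omega,x_0)=(\omega\cdot t,u_\lambda(t,\omega,x_0))$ on $\Omega\times\mathbb R$, where $u_\lambda(\cdot,\omega,x_0)$ is the maximal solution with value $x_0$ at $t=0$. An equilibrium is a map $\beta:\Omega\to\mathbb R$ with $\beta(\omega\cdot t)=u_\lambda(t,\omega,\beta(\omega))$ for all $\omega,t$. A minimal set is a nonempty compact $\tau_\lambda$-invariant set containing properly no other such set; $\mathcal M_0=\Omega\times\{0\}$ is minimal for all $\lambda$. $\mathcal K_1<\mathcal K_2$ means $x_1<x_2$ whenever $(\omega,x_1)\in\mathcal K_1$, $(\omega,x_2)\in\mathcal K_2$. A minimal set $\mathcal M$ is hyperbolic attractive if there are $\rho>0,k\ge1,\gamma>0$ such that if $(\omega,x_0)\in\mathcal M$ and $|x-x_0|<\rho$ then $u_\lambda(t,\omega,x)$ is defined and $|u_\lambda(t,\omega,x)-u_\lambda(t,\omega,x_0)|\le ke^{-\gamma t}|x-x_0|$ for all $t\ge0$; hyperbolic repulsive is the analogue as $t\to-\infty$; otherwise it is nonhyperbolic. $\tau_\lambda$ has a global attractor $\mathcal A_\lambda=\bigcup_{\omega}(\{\omega\}\times[\alpha_\lambda(\omega),\beta_\lambda(\omega)])$ (compact, invariant, attracting every bounded set as $t\to\infty$), with $\alpha_\lambda\le0\le\beta_\lambda$ semicontinuous equilibria. Families $\kappa^1_\lambda,\kappa^2_\lambda$ of equilibria collide as $\lambda\downarrow\lambda_*$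 if $\lim(\kappa^1_\lambda(\omega)-\kappa^2_\lambda(\omega))=0$ for all $\omega$ in a residual $\sigma$-invariant set. Generalized pitchfork diagram. $\mathcal M_0$ is hyperbolic attractive for $\lambda<\lambda_-$, nonhyperbolic for $\lambda\in[\lambda_-,\lambda_+]$, hyperbolic repulsive for $\lambda>\lambda_+$; for $\lambda>\lambda_+$ there are three minimal sets $\mathcal M^l_\lambda<\mathcal M_0<\mathcal M^u_\lambda$, with $\mathcal M^l_\lambda,\mathcal M^u_\lambda$ hyperbolic attractive and equal to the graphs of $\alpha_\lambda,\beta_\lambda$; and, in addition: $(\mathrm{GP}_\beta)$: $\lambda_-<\lambda_+$, $\beta_\lambda$ collides with $0$ as $\lambda\downarrow\lambda_+$, and there is $\lambda_0\in[\lambda_-,\lambda_+)$ such that $\mathcal M_0$ is the unique $\tau_\lambda$-minimal set for $\lambda<\lambda_0$, $\mathcal A_\lambda=\mathcal M_0$ for $\lambda<\lambda_-$, and for $\lambda\in(\lambda_0,\lambda_+]$ there are two minimal sets $\mathcal M^l_\lambda<\mathcal M_0$, with $\mathcal M^l_\lambda$ hyperbolic attractive and equal to the graph of $\alpha_\lambda$. $(\mathrm{GP}_\alpha)$: the same with $\alpha_\lambda$ and $\beta_\lambda$ exchanged and $\mathcal M^l_\lambda<\mathcal M_0$ replaced by $\mathcal M_0<\mathcal M^u_\lambda$ (with $\mathcal M^u_\lambda$ hyperbolic attractive and equal to the graph of $\beta_\lambda$). *)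

(* Defs.v *)
From HB Require Import structures.
From mathcomp Require Import all_boot all_order all_algebra.
From mathcomp Require Import all_classical all_reals all_analysis.
From mathcomp Require Import borel_hierarchy.

Set Implicit Arguments.
Unset Strict Implicit.
Unset Printing Implicit Defensive.

Import Order.TTheory GRing.Theory Num.Theory.
Import numFieldNormedType.Exports.

Local Open Scope classical_set_scope.
Local Open Scope ring_scope.

(* MathComp-Analysis only puts sigma-algebras on pointed types; the base point
   just witnesses that the space is nonempty. *)
#[short(type="pmetricType")]
HB.structure Definition PointedMetric (K : numDomainType) :=
  {M of Metric K M & Pointed M}.

Definition borel (T : ptopologicalType) := g_sigma_algebraType (@open T).

Section base_flow.
Context {R : realType} {Omega : pmetricType R}.
Implicit Types (sigma : R -> Omega -> Omega) (b a : Omega -> R).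

Definition continuous_flow sigma :=
  [/\ forall w, sigma 0 w = w,
      forall s t w, sigma (s + t) w = sigma t (sigma s w) &
      continuous (fun p : R * Omega => sigma p.1 p.2)].

Definition minimal_flow sigma :=
  forall w, dense (range (fun t => sigma t w)).

Definition flow_invariant sigma (A : set Omega) :=
  forall t, sigma t @` A = A.

Definition ergodic sigma (P : probability (borel Omega) R) :=
  (forall t (A : set (borel Omega)), measurable A ->
     P (sigma t @^-1` A) = P A) /\
  (forall A : set (borel Omega), measurable A -> flow_invariant sigma A ->
     P A = 0%E \/ P A = 1%E).

(* The ergodic measures are m_0, ..., m_(n-1), pairwise distinct.  A library
   measure also takes (unconstrained) values on non-measurable sets, so measures
   are compared on Borel sets only. *)
Definition ergodic_measures_are sigma n
    (m : 'I_n -> probability (borel Omega) R) :=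
  [/\ forall i, ergodic sigma (m i),
      forall i j, (forall A, measurable A -> m i A = m j A) -> i = j &
      forall P, ergodic sigma P ->
        exists i, forall A, measurable A -> P A = m i A].

(* The oriented integral of g from 0 to t. *)
Definition int0 (g : R -> R) (t : R) : R :=
  if 0 <= t then \int[lebesgue_measure]_(s in `[0, t]) g s
  else - \int[lebesgue_measure]_(s in `[t, 0]) g s.

Definition exp_dichotomy sigma b :=
  exists k delta : R, [/\ 1 <= k, 0 < delta &
    (forall w (t : R), 0 <= t ->
       expR (int0 (fun s => b (sigma s w)) t) <= k * expR (- delta * t)) \/
    (forall w (t : R), t <= 0 ->
       expR (int0 (fun s => b (sigma s w)) t) <= k * expR (delta * t))].

Definition sacker_sell_spectrum sigma a : set R :=
  [set l | ~ exp_dichotomy sigma (fun w => a w - l)].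

Definition residual (S : set Omega) := exists2 G, Gdelta_dense G & G `<=` S.

End base_flow.

Section skewproduct.
Context {R : realType} {Omega : pmetricType R}.
Variables (sigma : R -> Omega -> Omega) (f : Omega -> R -> R).
Implicit Types (w : Omega) (x y t : R) (K M A : set (Omega * R)).
Implicit Types kappa : Omega -> R.

Definition ivp_solution w x (J : set R) (v : R -> R) :=
  [/\ open J, is_interval J, J 0, v 0 = x &
      forall t, J t -> is_derive t 1 v (f (sigma t w) (v t))].

Definition maximal_solution w x (J : set R) (v : R -> R) :=
  ivp_solution w x J v /\
  (forall J' v', ivp_solution w x J' v' -> J' `<=` J).

(* u(t, w, x) is defined and equal to y, u(., w, x) being the maximal solution
   of x' = f (w.t) x with value x at time 0. *)
Definition sol_at t w x y :=
  exists J v, [/\ maximal_solution w x J v, J t & v t = y].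

(* tau(t, p) is defined and equal to q. *)
Definition tau t (p q : Omega * R) :=
  q.1 = sigma t p.1 /\ sol_at t p.1 p.2 q.2.

Definition tau_invariant K :=
  (forall t p, K p -> exists q, tau t p q) /\
  (forall t, [set q | exists2 p, K p & tau t p q] = K).

Definition equilibrium kappa :=
  forall w t, sol_at t w (kappa w) (kappa (sigma t w)).

Definition minimal_set M :=
  [/\ M !=set0, compact M, tau_invariant M &
      forall K, K !=set0 -> compact K -> tau_invariant K ->
        K `<=` M -> K = M].

Definition hyperbolic_attractive M :=
  exists rho k gamma : R, [/\ 0 < rho, 1 <= k, 0 < gamma &
    forall w x0 x, M (w, x0) -> `|x - x0| < rho ->
      forall t, 0 <= t -> exists y y0,
        [/\ sol_at t w x y, sol_at t w x0 y0 &
            `|y - y0| <= k * expR (- gamma * t) * `|x - x0|]].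

Definition hyperbolic_repulsive M :=
  exists rho k gamma : R, [/\ 0 < rho, 1 <= k, 0 < gamma &
    forall w x0 x, M (w, x0) -> `|x - x0| < rho ->
      forall t, t <= 0 -> exists y y0,
        [/\ sol_at t w x y, sol_at t w x0 y0 &
            `|y - y0| <= k * expR (gamma * t) * `|x - x0|]].

Definition nonhyperbolic M :=
  ~ hyperbolic_attractive M /\ ~ hyperbolic_repulsive M.

(* As Omega is compact, B is bounded iff its second projection is. *)
Definition attracts A (B : set (Omega * R)) :=
  forall e : R, 0 < e -> \forall t \near +oo, forall p, B p ->
    exists2 q, tau t p q & exists2 z, A z & ball z e q.

Definition global_attractor A :=
  [/\ compact A, tau_invariant A &
      forall B : set (Omega * R),
        (exists r : R, forall p, B p -> `|p.2| <= r) -> attracts A B].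

Definition graph_of kappa : set (Omega * R) := [set p | p.2 = kappa p.1].

Definition zero_section : set (Omega * R) := graph_of (fun=> 0).

Definition band (alpha beta : Omega -> R) : set (Omega * R) :=
  [set p | alpha p.1 <= p.2 <= beta p.1].

Definition below K M :=
  forall w x y, K (w, x) -> M (w, y) -> x < y.

Definition attractor_bounds (alpha beta : Omega -> R) :=
  [/\ global_attractor (band alpha beta),
      equilibrium alpha, equilibrium beta,
      lower_semicontinuous (fun w => (alpha w)%:E) /\
      lower_semicontinuous (fun w => (- beta w)%:E) &
      forall w, alpha w <= 0 <= beta w].

(* "There are k minimal sets" is read as exactly k.  In the next definitions
   alpha and beta are meant to be the bounds of the global attractor, whose
   graphs are the lower and upper minimal sets. *)
Definition only_zero_minimal :=
  forall M, minimal_set M <-> M = zero_section.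

Definition two_minimal_lower (alpha : Omega -> R) :=
  [/\ forall M, minimal_set M <-> M = graph_of alpha \/ M = zero_section,
      below (graph_of alpha) zero_section &
      hyperbolic_attractive (graph_of alpha)].

Definition two_minimal_upper (beta : Omega -> R) :=
  [/\ forall M, minimal_set M <-> M = zero_section \/ M = graph_of beta,
      below zero_section (graph_of beta) &
      hyperbolic_attractive (graph_of beta)].

Definition three_minimal (alpha beta : Omega -> R) :=
  [/\ forall M, minimal_set M <->
        [\/ M = graph_of alpha, M = zero_section | M = graph_of beta],
      below (graph_of alpha) zero_section,
      below zero_section (graph_of beta),
      hyperbolic_attractive (graph_of alpha) &
      hyperbolic_attractive (graph_of beta)].

End skewproduct.

Section pitchfork.
Context {R : realType} {Omega : pmetricType R}.
Variables (sigma : R -> Omega -> Omega) (F : R -> Omega -> R -> R).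
Variables (lm lp : R) (alpha beta : R -> Omega -> R).

Definition collide_right (k1 k2 : R -> Omega -> R) (l : R) :=
  exists S : set Omega, [/\ residual S, flow_invariant sigma S &
    forall w, S w -> k1 l' w - k2 l' w @[l' --> l^'+] --> (0 : R)].

Definition pitchfork_common :=
  [/\ forall l, l < lm -> hyperbolic_attractive sigma (F l) zero_section,
      forall l, lm <= l <= lp -> nonhyperbolic sigma (F l) zero_section,
      forall l, lp < l -> hyperbolic_repulsive sigma (F l) zero_section &
      forall l, lp < l -> three_minimal sigma (F l) (alpha l) (beta l)].

Definition GP_beta :=
  [/\ pitchfork_common, lm < lp, collide_right beta (fun _ _ => 0) lp &
      exists2 l0, lm <= l0 < lp &
      [/\ forall l, l < l0 -> only_zero_minimal sigma (F l),
          forall l, l < lm -> band (alpha l) (beta l) = zero_section &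
          forall l, l0 < l <= lp -> two_minimal_lower sigma (F l) (alpha l)]].

Definition GP_alpha :=
  [/\ pitchfork_common, lm < lp, collide_right alpha (fun _ _ => 0) lp &
      exists2 l0, lm <= l0 < lp &
      [/\ forall l, l < l0 -> only_zero_minimal sigma (F l),
          forall l, l < lm -> band (alpha l) (beta l) = zero_section &
          forall l, l0 < l <= lp -> two_minimal_upper sigma (F l) (beta l)]].

(* alpha l and beta l are determined by the (unique) global attractor, so they
   may be introduced existentially. *)
Definition generalized_pitchfork_diagram :=
  (forall l, attractor_bounds sigma (F l) (alpha l) (beta l)) /\
  (GP_alpha \/ GP_beta).

End pitchfork.

Definition generalized_pitchfork (R : realType) (Omega : pmetricType R)
    (sigma : R -> Omega -> Omega) (F : R -> Omega -> R -> R) (lm lp : R) :=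
  exists alpha beta, generalized_pitchfork_diagram sigma F lm lp alpha beta.

Definition cubic_family (R : realType) (Omega : pmetricType R)
    (a1 a2 a3 : Omega -> R) : R -> Omega -> R -> R :=
  fun l w x => - a3 w * x ^+ 3 + a2 w * x ^+ 2 + (a1 w + l) * x.

(* Main.v *)
(* With [c = lq - lm], where [sp a1 = [-lq, -lm]], averaging [a1] along orbits yields a continuous [g],
   differentiable along the flow, whose derivative is below [a1 + lq + c / 2].  For
   [a2 = 2 c exp(-g)] and [a3 = c exp(-2 g)] the function [exp g] is then a strict subsolution at
   [l = lq - c / 2], while [a2 x - a3 x^2 <= c] forbids bounded solutions that are positive and bounded away
   from [0] when [l < lm].  The threshold [l0] is the infimum of the parameters at which
   the upper bounded equilibrium stays away from zero; on the negative half line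
   [a2 x - a3 x^2 <= - k |x|], so the lower equilibrium leaves zero only at [lq].
   Above a threshold, two positive bounded solutions coincide because the logarithmic derivatives of
   the solutions and of their difference compare by concavity of [a2 x - a3 x^2]; this gives
   uniqueness and attraction of the positive minimal set.  The spectrum is used only through uniform
   lower bounds of the integrals of [a1] along orbits, and no ergodic measure enters. *)

Require Import Defs.
From mathcomp Require Import all_boot all_order all_algebra.
From mathcomp Require Import all_classical all_reals all_analysis.
From mathcomp Require Import borel_hierarchy ring lra.
Import Order.TTheory GRing.Theory Num.Theory.
Import numFieldNormedType.Exports.
Local Open Scope classical_set_scope.
Local Open Scope ring_scope.

Set Implicit Arguments.
Unset Strict Implicit.
Unset Printing Implicit Defensive.

(** * Scalar derivatives and differential inequalities *)

(** Solutions may blow up in backward time, so the flow is only local. The dynamics is therefore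
    built on the globally Lipschitz equation in which [x] is replaced by [clamp r x]: its solutions
    exist on the whole line and solve the cubic equation wherever they stay within the cut-off.

    The negative half line has no theory of its own. The reflection [x -> - x] replaces [a2] by
    [- a2], so the upper equilibrium is studied for an arbitrary continuous [a2] and the results are
    applied to both families.

    A priori this equilibrium is only upper semicontinuous. Its superlevel sets are closed, so a
    lower bound along one backward half-orbit spreads over [Omega] by minimality. Hence the
    contradictions are sought in the remote past of a single orbit.

    The constant [c] does two things. As the maximum of [a2 x - a3 x^2] it gives [lm <= l0], and
    since averaging loses only [c / 2] of the gain [c], a persistent parameter exists strictly below
    [lq], so [l0 < lq]. *)

Section calculus.
Context {R : realType}.
Implicit Types (f g h d v df dd : R -> R) (x y a b c s t L C T eps : R).

Lemma drv_eq f x a b : is_derive x 1 f a -> a = b -> is_derive x 1 f b.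
Proof. by move=> fa <-. Qed.

Lemma drvc c x : is_derive x 1 (fun=> c : R) 0.
Proof. exact: is_derive_cst. Qed.

Lemma drvid x : is_derive x 1 (fun y => y : R) 1.
Proof. exact: is_derive_id. Qed.

Lemma drvD f g x a b : is_derive x 1 f a -> is_derive x 1 g b ->
  is_derive x 1 (fun y => f y + g y) (a + b).
Proof. by move=> fa gb; exact: is_deriveD. Qed.

Lemma drvN f x a : is_derive x 1 f a -> is_derive x 1 (fun y => - f y) (- a).
Proof. by move=> fa; exact: is_deriveN. Qed.

Lemma drvB f g x a b : is_derive x 1 f a -> is_derive x 1 g b ->
  is_derive x 1 (fun y => f y - g y) (a - b).
Proof. by move=> fa gb; exact: is_deriveB. Qed.

Lemma drvM f g x a b : is_derive x 1 f a -> is_derive x 1 g b ->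
  is_derive x 1 (fun y => f y * g y) (a * g x + f x * b).
Proof.
move=> fa gb; suff -> : a * g x + f x * b = f x *: b + g x *: a by exact: is_deriveM.
by rewrite /GRing.scale/=; ring.
Qed.

Lemma drv_comp f g x a b : is_derive (g x) 1 f a -> is_derive x 1 g b ->
  is_derive x 1 (fun y => f (g y)) (a * b).
Proof. by move=> fa gb; exact: is_derive1_comp. Qed.

Lemma drv_expR f x a : is_derive x 1 f a ->
  is_derive x 1 (fun y => expR (f y)) (expR (f x) * a).
Proof. by move=> fa; apply: drv_comp fa. Qed.

Lemma drv_ln f x a : 0 < f x -> is_derive x 1 f a ->
  is_derive x 1 (fun y => ln (f y)) (a / f x).
Proof.
by move=> f0 fa; rewrite mulrC; apply: drv_comp fa; exact: is_derive1_ln.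
Qed.

Lemma drv_shift f c x a : is_derive (c + x) 1 f a ->
  is_derive x 1 (fun y => f (c + y)) a.
Proof.
move=> fa; apply: (drv_eq (@drv_comp f (fun y => c + y) x _ _ fa
  (drvD (drvc c x) (drvid x)))).
by rewrite add0r mulr1.
Qed.

Lemma drv_opp f x a : is_derive (- x) 1 f a ->
  is_derive x 1 (fun y => f (- y)) (- a).
Proof.
move=> fa; apply: (drv_eq (@drv_comp f (fun y => - y) x _ _ fa (drvN (drvid x)))).
by rewrite mulrN1.
Qed.

Lemma drv_continuous f x a : is_derive x 1 f a -> {for x, continuous f}.
Proof.
by move=> [fa _]; exact/differentiable_continuous/derivable1_diffP.
Qed.

Lemma drv_le f df a b : a <= b ->
  (forall x, a < x < b -> is_derive x 1 f (df x) /\ 0 <= df x) ->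
  (forall x, a <= x <= b -> {for x, continuous f}) -> f a <= f b.
Proof.
move=> ab fd fc; rewrite -subr_ge0; move: ab; rewrite le_eqVlt.
case/predU1P => [->|ab]; first by rewrite subrr.
have [x xab|x|c cab ->] := MVT (f := f) (df := df) ab.
- by apply: (fd x _).1; move: xab; rewrite in_itv.
- by apply: continuous_in_subspaceT => y; rewrite inE/= in_itv/=; exact: fc.
- rewrite mulr_ge0//; last by rewrite subr_ge0 ltW.
  by move: cab; rewrite in_itv/= => /fd[].
Qed.

Lemma drv_nondecreasing f df a b : a <= b ->
  (forall x, a <= x <= b -> is_derive x 1 f (df x)) ->
  (forall x, a <= x <= b -> 0 <= df x) -> f a <= f b.
Proof.
move=> ab fd d0; apply: (drv_le (df := df)) => // x /andP[ax xb].
  by split; [apply: fd|apply: d0]; rewrite !ltW.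
by apply: drv_continuous; apply: fd; rewrite ax.
Qed.

(** The tool for the integral identities below: differentiate both sides and compare them at [0]. *)
Lemma primitive_unique f g h : (forall x, is_derive x 1 f (h x)) ->
  (forall x, is_derive x 1 g (h x)) -> f 0 = g 0 -> f =1 g.
Proof.
move=> fh gh fg0 x; apply/eqP; rewrite -subr_eq0; apply/eqP.
suff /(@is_derive_0_is_cst _ _ x 0) -> : forall y, is_derive y 1 (fun y => f y - g y) 0.
  by rewrite fg0 subrr.
by move=> y; apply: (drv_eq (drvB (fh y) (gh y))); rewrite subrr.
Qed.

Lemma int0_at0 g : int0 g 0 = 0.
Proof. by rewrite /int0 lexx set_itv1 Rintegral_set1. Qed.

Lemma drv_int0 g x : continuous g -> is_derive x 1 (int0 g) (g x).
Proof.
move=> cg.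
pose mu := @lebesgue_measure R.
have ig a b : mu.-integrable `[a, b] (EFin \o g).
  apply: continuous_compact_integrable; first exact: segment_compact.
  exact: continuous_subspaceT.
(* A base point to the left of both [x] and [0]: near [x] the oriented integral is [F y - F 0]
   whatever the sign of [y]. *)
pose a : R := Num.min x 0 - 1.
have ax : a < x by rewrite /a; case: (ltP x 0); lra.
have a0 : a < 0 by rewrite /a; case: (ltP x 0); lra.
pose F y : R := \int[mu]_(s in `[a, y]) g s.
have Fx : is_derive x 1 F (g x).
  have [|dF gF] := @continuous_FTC1_closed R g a x (x + 1) _ (ig _ _) ax (cg x).
    lra.
  by apply: DeriveDef; [exact: dF|rewrite -derive1E gF].
suff E y : a < y -> int0 g y = F y - F 0.
  apply: (@near_eq_is_derive _ _ _ (fun y => F y - F 0)).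
    near do rewrite E//; exact: lt_nbhsr.
  by rewrite -[X in is_derive _ _ _ X]subr0; apply: drvB => //; exact: drvc.
move=> ay; rewrite /int0; case: leP => y0.
  rewrite /F Rintegral_itvB ?bnd_simp//= ?ltW//.
  rewrite Rintegral_itv_obnd_cbnd//.
  by apply: integrableS (ig 0 y) => //; exact: subset_itv_oc_cc.
rewrite -[RHS]opprB /F Rintegral_itvB ?bnd_simp//= ?ltW//; congr (- _).
rewrite Rintegral_itv_obnd_cbnd//.
by apply: integrableS (ig y 0) => //; exact: subset_itv_oc_cc.
Unshelve. all: by end_near. Qed.

(* A first-exit argument. *)
Lemma bootstrap v : (forall t, 0 <= t -> {for t, continuous v}) ->
  (forall t, 0 <= t -> (forall s, 0 <= s < t -> 0 < v s) -> 0 < v t) ->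
  forall t, 0 <= t -> 0 < v t.
Proof.
move=> cv H t t0; rewrite ltNge; apply/negP => vt.
pose S := [set s | 0 <= s /\ v s <= 0].
have hS : has_inf S by split; [exists t|exists 0 => s []].
have i0 : 0 <= inf S by apply: lb_le_inf; [exists t|move=> s []].
have vs s : 0 <= s < inf S -> 0 < v s.
  move=> /andP[s0 si]; rewrite ltNge; apply/negP => vs.
  by move: si; rewrite ltNge => /negP; apply; apply: ge_inf => //; exact: hS.2.
have := H _ i0 vs => vi.
have [e /= e0 He] : \forall s \near inf S, 0 < v s.
  exact: (cv _ i0 _ (lt_nbhsr vi)).
have [s [s0 vs0] sie] := inf_adherent e0 hS.
have : inf S <= s by apply: ge_inf => //; exact: hS.2.
move=> is_; suff : 0 < v s by rewrite ltNge vs0.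
by apply: He; rewrite /ball/= ler0_norm; lra.
Qed.

Lemma weight_drv d L x a : is_derive x 1 d a ->
  is_derive x 1 (fun t => d t * expR (L * t)) ((a + L * d x) * expR (L * x)).
Proof.
move=> da; have := drvM da (drv_expR (drvM (drvc L x) (drvid x))).
by move/drv_eq; apply; ring.
Qed.

(** The inequality [d' >= - L |d|] cannot push [d] through zero. Adding [e expR (2 L t)] makes the
    start strictly positive, and growth at rate [2 L] outweighs the loss. If [d t < 0], the [e] for
    which the sum vanishes at [t] gives the contradiction. *)
Lemma linear_ineq_ge0 d dd L : (forall t, 0 <= t -> is_derive t 1 d (dd t)) ->
  (forall t, 0 <= t -> - (L * `|d t|) <= dd t) -> 0 <= L -> 0 <= d 0 ->
  forall t, 0 <= t -> 0 <= d t.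
Proof.
move=> dd1 dd2 L0 d0 t t0; rewrite leNgt; apply/negP => e0.
have {}e0 : 0 < - d t by lra.
suff : forall e t, 0 < e -> 0 <= t -> 0 < d t + e * expR (2 * L * t).
  move=> /(_ (- d t / expR (2 * L * t)) t).
  rewrite divr_gt0 ?expR_gt0// => /(_ isT t0).
  by rewrite divfK ?gt_eqF ?expR_gt0//; lra.
move=> {e0 t t0}e t e0.
move: t; apply: bootstrap => [t t0|t t0 Hs].
  have := drvD (dd1 _ t0) (drvM (drvc e t) (drv_expR (drvM (drvc (2 * L) t) (drvid t)))).
  exact: drv_continuous.
pose E s := expR (2 * L * s).
have Ed s : is_derive s 1 E (2 * L * E s).
  have := drv_expR (drvM (drvc (2 * L) s) (drvid s)).
  by move/drv_eq; apply; rewrite /E; ring.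
(* This product is nondecreasing as long as the perturbed function is positive. *)
pose u s := (d s + e * E s) * expR (L * s).
have ud s : 0 <= s ->
    is_derive s 1 u ((dd s + e * (2 * L * E s) + L * (d s + e * E s)) * expR (L * s)).
  move=> s0; apply: weight_drv.
  have := drvD (dd1 _ s0) (drvM (drvc e s) (Ed s)).
  by move/drv_eq; apply; ring.
have : u 0 <= u t.
  apply: (@drv_le u (fun s => (dd s + e * (2 * L * E s) + L * (d s + e * E s)) * expR (L * s))) => //.
    move=> s /andP[s0 st]; split; first by apply: ud; exact: ltW.
    apply: mulr_ge0; last exact: expR_ge0.
    have p : 0 < d s + e * E s by apply: Hs; rewrite ltW.
    have := dd2 s (ltW s0).
    have E0 : 0 < e * E s by rewrite mulr_gt0// expR_gt0.
    have : `|d s| <= d s + 2 * (e * E s) by rewrite ler_norml; apply/andP; split; lra.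
    move=> /(ler_wpM2l L0); nra.
  by move=> s /andP[s0 st]; exact: drv_continuous (ud s s0).
rewrite /u /E !mulr0 expR0 !mulr1 => ut.
have := expR_gt0 (L * t) => p.
by rewrite -(pmulr_lgt0 _ p) (lt_le_trans _ ut)//; lra.
Qed.

(** Squares are used because [|d|] need not be differentiable: [2 d d' <= (2 L + 1) d^2 + eps^2] by
    Young's inequality. *)
Lemma gronwall_sq d dd L eps T : 0 <= L -> 0 <= eps ->
  (forall t, 0 <= t <= T -> is_derive t 1 d (dd t)) ->
  (forall t, 0 <= t <= T -> `|dd t| <= L * `|d t| + eps) ->
  forall t, 0 <= t <= T ->
  d t ^+ 2 <= (d 0 ^+ 2 + eps ^+ 2 * t) * expR ((2 * L + 1) * t).
Proof.
move=> L0 e0 dd1 dd2 t /andP[t0 tT].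
pose K := 2 * L + 1.
pose u s := eps ^+ 2 * s - (d s * d s) * expR (- K * s).
pose du s := eps ^+ 2 - (2 * d s * dd s - K * (d s * d s)) * expR (- K * s).
have : u 0 <= u t.
  apply: (@drv_nondecreasing u du) => [//|s /andP[s0 st]|s /andP[s0 st]].
    have sd := dd1 s; rewrite s0 (le_trans st tT) in sd.
    have := drvB (drvM (drvc (eps ^+ 2) s) (drvid s)) (@weight_drv (fun s => d s * d s) (- K) _ _ (drvM (sd isT) (sd isT))).
    move/drv_eq; apply; rewrite /du; ring.
  rewrite /du.
  have := dd2 s; rewrite s0 (le_trans st tT) => /(_ isT) H.
  have H2 : 2 * d s * dd s - K * (d s * d s) <= eps ^+ 2.
    have : d s * dd s <= `|d s| * `|dd s| by rewrite -normrM ler_norm.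
    have -> : d s * d s = `|d s| * `|d s| by rewrite -normrM ger0_norm// -expr2 sqr_ge0.
    have n0 : 0 <= `|d s| by [].
    move: (`|d s|) (`|dd s|) n0 H => p q n0 H; rewrite /K.
    have : p * q <= p * (L * p + eps) by rewrite ler_wpM2l.
    have := sqr_ge0 (p - eps); rewrite expr2; nra.
  have E0 := expR_gt0 (- K * s).
  have E1 : expR (- K * s) <= 1 by rewrite -expR0 ler_expR /K; nra.
  have : (2 * d s * dd s - K * (d s * d s)) * expR (- K * s) <= eps ^+ 2 * expR (- K * s).
    by rewrite ler_pM2r.
  have : eps ^+ 2 * expR (- K * s) <= eps ^+ 2 * 1 by rewrite ler_wpM2l// sqr_ge0.
  lra.
rewrite /u !mulr0 expR0 mulr1 mulNr expRN -/K => ut.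
have E0 := expR_gt0 (K * t).
rewrite -ler_pdivrMr// expr2 [d 0 ^+ 2]expr2; lra.
Qed.

(** The halving step of Picard iteration: in the norm weighted by [expR (- 2 L |t|)], an
    [L]-Lipschitz field followed by integration contracts by the factor 1/2, on the whole line at
    once. *)
Lemma weighted_primitive_bound g h L C : 0 < L ->
  (forall t, is_derive t 1 g (h t)) -> g 0 = 0 ->
  (forall t, `|h t| <= 2 * L * C * expR (2 * L * `|t|)) ->
  forall t, `|g t| <= C * expR (2 * L * `|t|).
Proof.
move=> L0 + + hb.
have main (g' h' : R -> R) : (forall t, is_derive t 1 g' (h' t)) -> g' 0 = 0 ->
    (forall t, 0 <= t -> h' t <= 2 * L * C * expR (2 * L * t)) ->
    forall t, 0 <= t -> g' t <= C * expR (2 * L * t).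
  move=> gh g0 hb' t t0.
  have C0 : 0 <= C.
    have := le_trans (normr_ge0 _) (hb 0).
    by rewrite normr0 mulr0 expR0 mulr1 pmulr_rge0//; lra.
  pose u s := C * expR (2 * L * s) - g' s.
  have : u 0 <= u t.
    apply: (@drv_nondecreasing u (fun s => 2 * L * C * expR (2 * L * s) - h' s)) => // s /andP[s0 st].
      have := drvB (drvM (drvc C s) (drv_expR (drvM (drvc (2 * L) s) (drvid s)))) (gh s).
      by move/drv_eq; apply; ring.
    by rewrite subr_ge0 hb'.
  by rewrite /u g0 mulr0 expR0; lra.
move=> gh g0 t; case: (leP 0 t) => t0.
  rewrite (ger0_norm t0) ler_norml lerNl; apply/andP; split.
    apply: (main (fun s => - g s) (fun s => - h s)) => //.
    - by rewrite g0 oppr0.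
    - by move=> s s0; have := hb s; rewrite ler_norml (ger0_norm s0) => /andP[+ _]; lra.
  by apply: (main g h) => // s s0; have := hb s; rewrite ler_norml (ger0_norm s0) => /andP[_].
have t0' : 0 <= - t by lra.
rewrite (ler0_norm (ltW t0)) ler_norml lerNl; apply/andP; split.
  have := main (fun s => - g (- s)) (fun s => h (- s)) _ _ _ (- t) t0'; rewrite opprK; apply.
  - by move=> s; apply: (drv_eq (drvN (drv_opp (gh (- s))))); rewrite opprK.
  - by rewrite oppr0 g0 oppr0.
  - by move=> s s0; have := hb (- s); rewrite ler_norml normrN (ger0_norm s0) => /andP[_].
have := main (fun s => g (- s)) (fun s => - h (- s)) _ _ _ (- t) t0'; rewrite opprK; apply.
- by move=> s; exact: drv_opp.
- by rewrite oppr0 g0.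
- by move=> s s0; have := hb (- s); rewrite ler_norml normrN (ger0_norm s0) => /andP[+ _]; lra.
Qed.

End calculus.

(** * Picard iteration *)

Section picard.
Context {R : realType}.

Lemma half_pow_small (K e : R) : 0 < e -> exists n, K * 2^-1 ^+ n < e.
Proof.
move=> e0; have [n Kn] : exists n : nat, K / e < n%:R.
  exists (Num.bound `|K / e|); apply: le_lt_trans (ler_norm _) _.
  exact: archi_boundP.
exists n; rewrite exprVn ltr_pdivrMr ?exprn_gt0//.
rewrite -ltr_pdivrMl// mulrC (lt_le_trans Kn)//.
by rewrite -natrX ler_nat ltnW// ltn_expl.
Qed.

(* The two shifted sequences a n and b n are monotone, so the limit exists as a supremum. *)
Lemma geometric_limit (u : nat -> R) (K : R) :
  (forall n, `|u n.+1 - u n| <= K * 2^-1 ^+ n) ->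
  exists l, forall n, `|l - u n| <= 2 * K * 2^-1 ^+ n.
Proof.
move=> hu.
have h n : - (K * 2^-1 ^+ n) <= u n.+1 - u n <= K * 2^-1 ^+ n.
  by rewrite -ler_norml.
have K0 : 0 <= K by have := le_trans (normr_ge0 _) (hu 0); rewrite expr0 mulr1.
pose a n := u n - 2 * K * 2^-1 ^+ n; pose b n := u n + 2 * K * 2^-1 ^+ n.
have amono : {homo a : m n / (m <= n)%N >-> m <= n}.
  apply: homo_leq => [//|x y z /le_trans|n]; first exact.
  by rewrite /a exprS; have := h n; move: (2^-1 ^+ n) => p; lra.
have bmono : {homo b : m n / (m <= n)%N >-> n <= m}.
  apply: (@homo_leq _ b (fun x y => y <= x)) => [//|x y z xy yz|n].
    exact: le_trans yz xy.
  by rewrite /b exprS; have := h n; move: (2^-1 ^+ n) => p; lra.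
have ab m n : a m <= b n.
  apply: le_trans (amono _ _ (leq_maxl m n)) _.
  apply: le_trans (bmono _ _ (leq_maxr m n)).
  rewrite /a /b; suff : 0 <= 2 * K * 2^-1 ^+ maxn m n by lra.
  by rewrite !mulr_ge0// exprn_ge0// invr_ge0.
exists (sup (range a)) => n.
have ua : has_ubound (range a) by exists (b 0) => _ [m _ <-].
have : a n <= sup (range a) by apply: ub_le_sup => //; exists n.
have : sup (range a) <= b n.
  by apply: ge_sup => [|_ [m _ <-]//]; exists (a 0), 0.
by rewrite ler_norml /a /b; lra.
Qed.

Variables (F : R -> R -> R) (L M x0 : R).
Hypothesis Fcont : forall v : R -> R, continuous v ->
  continuous (fun t => F t (v t)).
Hypothesis L0 : 0 < L.
Hypothesis Flip : forall t x y, `|F t x - F t y| <= L * `|x - y|.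
Hypothesis FM : forall t, `|F t x0| <= M.

Fixpoint picard_iter n : R -> R :=
  if n is n'.+1 then fun t => x0 + int0 (fun s => F s (picard_iter n' s)) t
  else fun=> x0.

Lemma drv_int0_field (v : R -> R) : continuous v -> forall t : R,
  is_derive t 1 (fun t => x0 + int0 (fun s => F s (v s)) t) (F t (v t)).
Proof.
move=> cv t; rewrite -[X in is_derive _ _ _ X]add0r.
exact: drvD (drvc x0 t) (drv_int0 t (Fcont cv)).
Qed.

Lemma drv_picard_iter0 (t : R) : is_derive t 1 (picard_iter 0) 0.
Proof. exact: drvc. Qed.

Lemma picard_iter_continuous n : continuous (picard_iter n).
Proof.
elim: n => [|n IH] t; first exact: cvg_cst.
exact: drv_continuous (drv_int0_field IH t).
Qed.

Lemma drv_picard_iter n (t : R) :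
  is_derive t 1 (picard_iter n.+1) (F t (picard_iter n t)).
Proof. exact: drv_int0_field (@picard_iter_continuous n) t. Qed.

Lemma picard_existence : exists v : R -> R,
  v 0 = x0 /\ forall t : R, is_derive t 1 v (F t (v t)).
Proof.
(* Chosen so that [2 L C = M], the bound on the derivative of the first increment. *)
pose C := M / (2 * L).
have L2 : 2 * L != 0 by rewrite mulf_neq0// gt_eqF.
have M0 : 0 <= M by exact: le_trans (normr_ge0 _) (FM 0).
have C0 : 0 <= C by rewrite divr_ge0// mulr_ge0// ltW.
pose E (t : R) := expR (2 * L * `|t|).
have E1 t : 1 <= E t by rewrite -expR0 ler_expR !mulr_ge0// ltW.
have hu n t : `|picard_iter n.+1 t - picard_iter n t| <= C * E t * 2^-1 ^+ n.
  rewrite mulrAC; move: t; elim: n => [|n IH].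
    apply: (weighted_primitive_bound (h := fun s => F s x0)) => // [t||t].
    - have := drvB (drv_picard_iter 0 t) (drv_picard_iter0 t).
      by rewrite subr0; apply.
    - by rewrite /= int0_at0 addr0 subrr.
    - have -> : 2 * L * (C * 2^-1 ^+ 0) = M by rewrite expr0 mulr1 /C mulrCA divff// mulr1.
      by apply: le_trans (FM t) _; rewrite ler_peMr// E1.
  apply: (weighted_primitive_bound (h := fun s =>
     F s (picard_iter n.+1 s) - F s (picard_iter n s))) => // [t||t].
  - exact: (drvB (drv_picard_iter n.+1 t) (drv_picard_iter n t)).
  - by rewrite /= !int0_at0 subrr.
  - apply: le_trans (Flip _ _ _) _.
    have := IH t; rewrite -/(E t) => /(ler_wpM2l (ltW L0)) /le_trans; apply.
    by rewrite exprS; lra.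
have /(_ _)/cid hv t := geometric_limit (hu ^~ t).
pose v t := sval (hv t).
have vu n t : `|v t - picard_iter n t| <= 2 * (C * E t) * 2^-1 ^+ n.
  exact: svalP (hv t) n.
have cv : continuous v.
  move=> t; apply/cvgrPdist_lt => e e0.
  have [n hn] := half_pow_small (2 * (C * expR (2 * L * (`|t| + 1)))) (e := e / 3) ltac:(lra).
  have b s : `|s - t| < 1 -> `|v s - picard_iter n s| < e / 3.
    move=> st; apply: le_lt_trans (vu n s) (le_lt_trans _ hn).
    rewrite ler_wpM2r ?exprn_ge0 ?invr_ge0// ler_wpM2l// ler_wpM2l//.
    rewrite ler_expR ler_wpM2l ?mulr_ge0 ?(ltW L0)//.
    by have := ler_normD t (s - t); rewrite addrC subrK; lra.
  near=> s.
  have st : `|s - t| < 1.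
    by rewrite distrC; near: s; exact: (@nbhsx_ballx R R t 1).
  have h1 := b s st.
  have h2 : `|v t - picard_iter n t| < e / 3 by apply: b; rewrite subrr normr0.
  have h3 : `|picard_iter n t - picard_iter n s| < e / 3.
    near: s; move/cvgrPdist_lt: (@picard_iter_continuous n t); apply; lra.
  move: h1 h2 h3; rewrite !ltr_norml; lra.
(* For every [n], both sides are within [C E(t) 2^-n] of the iterate of index [n + 1]. *)
have ev t : v t = x0 + int0 (fun s => F s (v s)) t.
  apply/eqP; rewrite -subr_eq0 -normr_le0; apply/ler_addgt0Pr => e e0.
  rewrite add0r.
  have [n hn] := half_pow_small (2 * (C * E t)) e0.
  apply: le_trans (ltW hn).
  have h1 := vu n.+1 t.
  have h2 : `|picard_iter n.+1 t - (x0 + int0 (fun s => F s (v s)) t)| <=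
      C * 2^-1 ^+ n * E t.
    move: t {hn h1}; apply: (weighted_primitive_bound (h := fun s =>
      F s (picard_iter n s) - F s (v s))) => // [t||t].
    - exact: (drvB (drv_picard_iter n t) (drv_int0_field cv t)).
    - by rewrite /= !int0_at0 subrr.
    - apply: le_trans (Flip _ _ _) _.
      have := vu n t; rewrite distrC => /(ler_wpM2l (ltW L0)) /le_trans; apply.
      by rewrite /E; lra.
  have := ler_normD (v t - picard_iter n.+1 t) (picard_iter n.+1 t - (x0 + int0 (fun s => F s (v s)) t)).
  rewrite subrKA => /le_trans; apply.
  by move: h1 h2; rewrite exprS; lra.
exists v; split; first by rewrite ev int0_at0 addr0.
move=> t; have E' : v = (fun t => x0 + int0 (fun s => F s (v s)) t) by exact/funext.
by rewrite [X in is_derive _ _ X _]E'; exact: drv_int0_field.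
Unshelve. all: by end_near. Qed.

End picard.

(** * Comparison principles and flows on compact spaces *)

Section comparison.
Context {R : realType}.
Implicit Types (x y dx dy : R -> R) (G : R -> R -> R).

(** The Lipschitz bound is asked only along the two curves, so the lemma applies to the cubic field
    itself whenever both curves are bounded. *)
Lemma comparison G x y dx dy (L : R) : 0 <= L ->
  (forall t : R, 0 <= t -> is_derive t 1 x (dx t)) ->
  (forall t : R, 0 <= t -> is_derive t 1 y (dy t)) ->
  (forall t, 0 <= t -> G t (x t) <= dx t) ->
  (forall t, 0 <= t -> dy t <= G t (y t)) ->
  (forall t, 0 <= t -> `|G t (x t) - G t (y t)| <= L * `|x t - y t|) ->
  y 0 <= x 0 -> forall t, 0 <= t -> y t <= x t.
Proof.
move=> L0 xd yd Gx Gy GL xy0 t t0; rewrite -subr_ge0.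
apply: (@linear_ineq_ge0 _ (fun t => x t - y t) (fun t => dx t - dy t) L) => //.
- by move=> s s0; exact: drvB (xd s s0) (yd s s0).
- move=> s s0; have := Gx s s0; have := Gy s s0.
  by have := GL s s0; rewrite ler_norml; lra.
- by rewrite subr_ge0.
Qed.

Lemma comparison_backward G x y (L : R) : 0 <= L ->
  (forall t : R, t <= 0 -> is_derive t 1 x (G t (x t))) ->
  (forall t : R, t <= 0 -> is_derive t 1 y (G t (y t))) ->
  (forall t, t <= 0 -> `|G t (x t) - G t (y t)| <= L * `|x t - y t|) ->
  y 0 <= x 0 -> forall t, t <= 0 -> y t <= x t.
Proof.
move=> L0 xd yd GL xy0 t t0.
pose G' s z := - G (- s) z.
have tn (s : R) : 0 <= s -> - s <= 0 by rewrite oppr_le0.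
have := @comparison G' (fun s => x (- s)) (fun s => y (- s))
  (fun s => G' s (x (- s))) (fun s => G' s (y (- s))) L L0.
move=> /(_ _ _ _ _ _ _ (- t)); rewrite opprK oppr0 oppr_ge0; apply => //.
- by move=> s s0; apply: drv_opp; apply: xd; exact: tn.
- by move=> s s0; apply: drv_opp; apply: yd; exact: tn.
- move=> s s0; rewrite /G' -opprD normrN.
  by apply: GL; exact: tn.
Qed.

End comparison.

Section base.
Context {R : realType} {Omega : pmetricType R}.
Variable sigma : R -> Omega -> Omega.
Hypothesis cptOmega : compact [set: Omega].
Hypothesis flow_sigma : continuous_flow sigma.

Lemma flow0 w : sigma 0 w = w.
Proof. by case: flow_sigma. Qed.

Lemma flowD s t w : sigma (s + t) w = sigma t (sigma s w).
Proof. by case: flow_sigma. Qed.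

Lemma flowK t w : sigma (- t) (sigma t w) = w.
Proof. by rewrite -flowD subrr flow0. Qed.

Lemma flowNK t w : sigma t (sigma (- t) w) = w.
Proof. by rewrite -flowD addNr flow0. Qed.

Lemma flow_along (b : Omega -> R) : continuous b ->
  continuous (fun p : R * Omega => b (sigma p.1 p.2)).
Proof.
move=> cb p; apply: (@continuous_comp _ _ _ (fun p : R * Omega => sigma p.1 p.2) b).
  by case: flow_sigma => _ _; exact.
exact: cb.
Qed.

Lemma flow_continuous t : continuous (sigma t).
Proof.
move=> w; apply: (@continuous_comp _ _ _ (fun w => (t, w) : R * Omega) (fun p => sigma p.1 p.2)).
  exact: (cvg_pair (cvg_cst t) cvg_id).
by case: flow_sigma => _ _; exact.
Qed.

Lemma orbit_continuous (b : Omega -> R) w : continuous b ->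
  continuous (fun t => b (sigma t w)).
Proof.
move=> cb t; apply: (@continuous_comp _ _ _ (fun t => (t, w) : R * Omega) (fun p => b (sigma p.1 p.2))).
  exact: (cvg_pair cvg_id (cvg_cst w)).
exact: flow_along.
Qed.

(** A tube argument: compactness of [[-T, T]] makes continuity at the points [(s, w)] uniform in
    [s]. *)
Lemma uniform_near (c : R * Omega -> R) w (T e : R) : continuous c -> 0 < e ->
  \forall w' \near w, forall s : R, `|s| <= T -> `|c (s, w') - c (s, w)| < e.
Proof.
move=> cc e0.
have e2 : 0 < e / 2 by lra.
have := @segment_compact R (- T) T.
move/compact_near_coveringP/(_ _ (nbhs w) (fun w' s => `|c (s, w') - c (s, w)| < e) _) => H.
apply: filterS (H _) => [w' Hw' s sT|s _].
  by apply: Hw'; rewrite /= in_itv/= -ler_norml.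
have /cvgrPdist_lt/(_ _ e2)[[U V]/= [Us Vw] UV] := cc (s, w).
exists (U, V) => //= -[s' w'] [/= Us' Vw'].
have h1 := UV (s', w') (conj Us' Vw').
have h2 := UV (s', w) (conj Us' (nbhs_singleton Vw)).
by move: h1 h2; rewrite /= !ltr_norml; lra.
Qed.

Lemma bounded_on_Omega (b : Omega -> R) : continuous b ->
  exists2 B, 0 < B & forall w, `|b w| <= B.
Proof.
move=> cb.
have : compact (b @` [set: Omega]).
  by apply: continuous_compact => //; exact: continuous_subspaceT.
move=> /compact_bounded [M [Mr HM]].
exists (`|M| + 1); first by rewrite ltr_wpDl.
move=> w; apply: HM; last by exists w.
by rewrite (le_lt_trans (ler_norm _))// ltrDl.
Qed.

Lemma positive_below (b : Omega -> R) : continuous b -> (forall w, 0 < b w) ->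
  exists2 c, 0 < c & forall w, c <= b w.
Proof.
move=> cb b0.
have cb' : continuous (fun w => (b w)^-1).
  by move=> w; apply: cvgV; [rewrite gt_eqF|exact: cb].
have [B B0 HB] := bounded_on_Omega cb'.
exists B^-1; first by rewrite invr_gt0.
move=> w; rewrite -[leRHS]invrK lef_pV2 ?posrE ?invr_gt0//.
by apply: le_trans (HB w); exact: ler_norm.
Qed.

End base.

(** * The truncated cubic equation *)

Section clamp.
Context {R : realType}.
Implicit Types (r x y : R).

(** Cutting at [|r|] makes the bound and the Lipschitz constant valid for every real [r]. *)
Definition clamp r x : R :=
  if x < - `|r| then - `|r| else if `|r| < x then `|r| else x.

Lemma clamp_le r x : `|clamp r x| <= `|r|.
Proof.
rewrite /clamp; move: (normr_ge0 r); move: (`|r|) => a a0; rewrite ler_norml.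
by case: (ltP x (- a)) => ?; case: (ltP a x) => ?; apply/andP; split; lra.
Qed.

Lemma clamp_id r x : `|x| <= r -> clamp r x = x.
Proof.
move=> xr; have r0 : 0 <= r by exact: le_trans xr.
move: xr; rewrite /clamp (ger0_norm r0) ler_norml => /andP[? ?].
by case: (ltP x (- r)) => ?; case: (ltP r x) => ?; lra.
Qed.

Lemma clamp_lip r x y : `|clamp r x - clamp r y| <= `|x - y|.
Proof.
rewrite /clamp; move: (normr_ge0 r); move: (`|r|) => a a0.
have := ler_norm (x - y); have := ler_norm (- (x - y)); rewrite normrN.
move: (`|x - y|) => d d1 d2; rewrite ler_norml.
by case: (ltP x (- a)) => ?; case: (ltP a x) => ?; case: (ltP y (- a)) => ?;
  case: (ltP a y) => ?; apply/andP; split; lra.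
Qed.

Lemma clamp_continuous r : continuous (clamp r).
Proof.
move=> x; apply/cvgrPdist_lt => e e0; near=> y.
apply: le_lt_trans (clamp_lip r x y) _.
by near: y; exact: (@nbhsx_ballx R R x e).
Unshelve. all: by end_near. Qed.

End clamp.

Section cubic.
Context {R : realType} {Omega : pmetricType R}.
Variable sigma : R -> Omega -> Omega.
Hypothesis cptOmega : compact [set: Omega].
Hypothesis flow_sigma : continuous_flow sigma.
Variables p1 p2 p3 : Omega -> R.
Hypothesis c1 : continuous p1.
Hypothesis c2 : continuous p2.
Hypothesis c3 : continuous p3.

Definition cub w (x : R) : R := - p3 w * x ^+ 3 + p2 w * x ^+ 2 + p1 w * x.

(** The divided difference of the cubic; on the diagonal it is the coefficient of the linearised
    equation. *)
Definition quot w (x y : R) : R :=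
  - p3 w * (x ^+ 2 + x * y + y ^+ 2) + p2 w * (x + y) + p1 w.

Lemma cubB w x y : cub w x - cub w y = quot w x y * (x - y).
Proof. by rewrite /cub /quot; ring. Qed.

Lemma cub0 w : cub w 0 = 0.
Proof. by rewrite /cub; ring. Qed.

Lemma coef_bound : exists2 B : R, 1 <= B &
  forall w, [/\ `|p1 w| <= B, `|p2 w| <= B & `|p3 w| <= B].
Proof.
have [B1 B10 H1] := bounded_on_Omega cptOmega c1.
have [B2 B20 H2] := bounded_on_Omega cptOmega c2.
have [B3 B30 H3] := bounded_on_Omega cptOmega c3.
exists (1 + B1 + B2 + B3); first lra.
by move=> w; move: (H1 w) (H2 w) (H3 w); split; lra.
Qed.

Lemma quot_bound (r : R) : exists2 L : R, 0 < L &
  forall w x y, `|x| <= r -> `|y| <= r -> `|quot w x y| <= L.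
Proof.
have [B B1 HB] := coef_bound.
exists (B * (3 * r ^+ 2 + 2 * `|r| + 1)).
  by rewrite mulr_gt0//; [lra|have := sqr_ge0 r; have := normr_ge0 r; lra].
move=> w x y xr yr; have [b1 b2 b3] := HB w.
have r0 : 0 <= r by exact: le_trans xr.
rewrite (ger0_norm r0) /quot.
have q1 : `|x ^+ 2 + x * y + y ^+ 2| <= 3 * r ^+ 2.
  apply: le_trans (ler_normD _ _) _; apply: le_trans (lerD (ler_normD _ _) (lexx _)) _.
  rewrite !normrX normrM.
  have : `|x| ^+ 2 <= r ^+ 2 by rewrite lerXn2r ?nnegrE.
  have : `|y| ^+ 2 <= r ^+ 2 by rewrite lerXn2r ?nnegrE.
  have : `|x| * `|y| <= r * r by rewrite ler_pM.
  rewrite -expr2; lra.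
have q2 : `|x + y| <= 2 * r by apply: le_trans (ler_normD _ _) _; lra.
apply: le_trans (ler_normD _ _) _; apply: le_trans (lerD (ler_normD _ _) (lexx _)) _.
rewrite !normrM normrN !mulrDr mulr1.
have : `|p3 w| * `|x ^+ 2 + x * y + y ^+ 2| <= B * (3 * r ^+ 2) by rewrite ler_pM.
have : `|p2 w| * `|x + y| <= B * (2 * r) by rewrite ler_pM.
lra.
Qed.

Lemma cub_lip (r : R) : exists2 L : R, 0 < L &
  forall w x y, `|x| <= r -> `|y| <= r -> `|cub w x - cub w y| <= L * `|x - y|.
Proof.
have [L L0 HL] := quot_bound r.
by exists L => // w x y xr yr; rewrite cubB normrM ler_wpM2r// HL.
Qed.

Lemma cub_orbit_continuous w (u : R -> R) : continuous u ->
  continuous (fun t => cub (sigma t w) (u t)).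
Proof.
move=> cu t; rewrite /cub.
have o (b : Omega -> R) : continuous b -> {for t, continuous (fun t => b (sigma t w))}.
  by move=> cb; exact: (orbit_continuous flow_sigma cb).
apply: cvgD; first apply: cvgD.
- apply: cvgM; first by apply: cvgN; exact: o.
  exact: (@continuous_comp _ _ _ u (fun x => x ^+ 3) t (cu t) (@exprn_continuous R 3 _)).
- apply: cvgM; first exact: o.
  exact: (@continuous_comp _ _ _ u (fun x => x ^+ 2) t (cu t) (@exprn_continuous R 2 _)).
- by apply: cvgM; [exact: o|exact: cu].
Qed.

Definition sol w (v : R -> R) :=
  forall t : R, is_derive t 1 v (cub (sigma t w) (v t)).

Definition trunc_sol r w (v : R -> R) :=
  forall t : R, is_derive t 1 v (cub (sigma t w) (clamp r (v t))).

Lemma trunc_lip r : exists2 L : R, 0 < L &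
  forall w x y, `|cub w (clamp r x) - cub w (clamp r y)| <= L * `|x - y|.
Proof.
have [L L0 HL] := cub_lip `|r|.
exists L => // w x y; apply: le_trans (HL _ _ _ (clamp_le _ _) (clamp_le _ _)) _.
by rewrite ler_wpM2l ?clamp_lip// ltW.
Qed.

Lemma trunc_exists r w (x : R) : exists v, v 0 = x /\ trunc_sol r w v.
Proof.
have [L L0 HL] := trunc_lip r; have [L' L'0 HL'] := cub_lip `|r|.
apply: (@picard_existence _ (fun t y => cub (sigma t w) (clamp r y)) L (L' * `|r|) x) => //.
- move=> v cv; apply: cub_orbit_continuous => t.
  by apply: continuous_comp; [exact: cv|exact: clamp_continuous].
- move=> t; have := HL' (sigma t w) (clamp r x) 0 (clamp_le _ _).
  rewrite normr0 cub0 !subr0 => /(_ (normr_ge0 _))/le_trans; apply.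
  by rewrite ler_wpM2l ?clamp_le// ltW.
Qed.

Lemma trunc_sol_order r w v v' : trunc_sol r w v -> trunc_sol r w v' ->
  v 0 <= v' 0 -> forall t, v t <= v' t.
Proof.
move=> sv sv' le0 t; have [L L0 HL] := trunc_lip r.
case: (leP 0 t) => t0.
  by apply: (@comparison _ (fun t y => cub (sigma t w) (clamp r y)) v' v
    (fun t => cub (sigma t w) (clamp r (v' t))) (fun t => cub (sigma t w) (clamp r (v t))) L _ _ _ _ _ _ _ t t0)
    => //; exact: ltW.
by apply: (@comparison_backward _ (fun t y => cub (sigma t w) (clamp r y)) v' v L _ _ _ _ _ t (ltW t0))
    => //; exact: ltW.
Qed.

Lemma trunc_sol_unique r w v v' : trunc_sol r w v -> trunc_sol r w v' ->
  v 0 = v' 0 -> forall t, v t = v' t.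
Proof.
move=> sv sv' e t; apply/eqP; rewrite eq_le.
by rewrite (trunc_sol_order sv sv')// ?e// (trunc_sol_order sv' sv)// e.
Qed.

Lemma trunc_sol_shift r w v s : trunc_sol r w v ->
  trunc_sol r (sigma s w) (fun t => v (s + t)).
Proof. by move=> sv t; rewrite -flowD//; exact: drv_shift. Qed.

Lemma sol_shift w v s : sol w v -> sol (sigma s w) (fun t => v (s + t)).
Proof. by move=> sv t; rewrite -flowD//; exact: drv_shift. Qed.

Definition Phi r w x : R -> R := sval (cid (trunc_exists r w x)).

Lemma Phi0 r w x : Phi r w x 0 = x.
Proof. by case: (svalP (cid (trunc_exists r w x))). Qed.

Lemma Phi_sol r w x : trunc_sol r w (Phi r w x).
Proof. by case: (svalP (cid (trunc_exists r w x))). Qed.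

Lemma Phi_unique r w v : trunc_sol r w v -> forall t, v t = Phi r w (v 0) t.
Proof.
by move=> sv; apply: (trunc_sol_unique sv (Phi_sol r w (v 0))); rewrite Phi0.
Qed.

Lemma PhiD r w x s t : Phi r w x (s + t) = Phi r (sigma s w) (Phi r w x s) t.
Proof.
have := Phi_unique (@trunc_sol_shift r w _ s (Phi_sol r w x)) t.
by rewrite addr0.
Qed.

Lemma Phi_order r w x y t : x <= y -> Phi r w x t <= Phi r w y t.
Proof.
move=> xy; apply: (trunc_sol_order (Phi_sol r w x) (Phi_sol r w y)).
by rewrite !Phi0.
Qed.

Lemma sol_trunc r w v : sol w v -> (forall t, `|v t| <= r) -> trunc_sol r w v.
Proof. by move=> sv vr t; rewrite clamp_id. Qed.

Lemma trunc_sol_sol r w v : trunc_sol r w v -> (forall t, `|v t| <= r) -> sol w v.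
Proof. by move=> sv vr t; have := sv t; rewrite clamp_id. Qed.

Lemma cub_near r w (T e : R) : 0 < e -> \forall w' \near w,
  forall s x, `|s| <= T -> `|cub (sigma s w') (clamp r x) - cub (sigma s w) (clamp r x)| <= e.
Proof.
move=> e0.
pose K := `|r| ^+ 3 + `|r| ^+ 2 + `|r| + 1.
have K0 : 0 < K.
  have : 0 <= `|r| ^+ 3 by rewrite exprn_ge0.
  have : 0 <= `|r| ^+ 2 by rewrite exprn_ge0.
  by rewrite /K; have := normr_ge0 r; lra.
have eK : 0 < e / K by rewrite divr_gt0.
have n1 := uniform_near w T (flow_along flow_sigma c1) eK.
have n2 := uniform_near w T (flow_along flow_sigma c2) eK.
have n3 := uniform_near w T (flow_along flow_sigma c3) eK.
near=> w'.
move=> s x sT.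
have h1 : `|p1 (sigma s w') - p1 (sigma s w)| < e / K by apply: (near n1 w').
have h2 : `|p2 (sigma s w') - p2 (sigma s w)| < e / K by apply: (near n2 w').
have h3 : `|p3 (sigma s w') - p3 (sigma s w)| < e / K by apply: (near n3 w').
have xr := clamp_le r x; move: (clamp r x) xr => y yr.
rewrite /cub.
have -> : - p3 (sigma s w') * y ^+ 3 + p2 (sigma s w') * y ^+ 2 + p1 (sigma s w') * y -
  (- p3 (sigma s w) * y ^+ 3 + p2 (sigma s w) * y ^+ 2 + p1 (sigma s w) * y) =
  - ((p3 (sigma s w') - p3 (sigma s w)) * y ^+ 3) + (p2 (sigma s w') - p2 (sigma s w)) * y ^+ 2 +
  (p1 (sigma s w') - p1 (sigma s w)) * y by ring.
apply: le_trans (ler_normD _ _) _; apply: le_trans (lerD (ler_normD _ _) (lexx _)) _.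
rewrite normrN.
have d1 : `|(p3 (sigma s w') - p3 (sigma s w)) * y ^+ 3| <= e / K * `|r| ^+ 3.
  by rewrite normrM ler_pM ?(ltW h3)// normrX lerXn2r ?nnegrE.
have d2 : `|(p2 (sigma s w') - p2 (sigma s w)) * y ^+ 2| <= e / K * `|r| ^+ 2.
  by rewrite normrM ler_pM ?(ltW h2)// normrX lerXn2r ?nnegrE.
have d3 : `|(p1 (sigma s w') - p1 (sigma s w)) * y| <= e / K * `|r|.
  by rewrite normrM ler_pM ?(ltW h1).
have -> : e = e / K * K by rewrite divfK// gt_eqF.
rewrite /K !mulrDr mulr1; lra.
Unshelve. all: by end_near. Qed.

Lemma Phi_continuous r t : continuous (fun p : Omega * R => Phi r p.1 p.2 t).
Proof.
move=> [w x]; apply/cvgrPdist_lt => e e0.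
have [L L0 HL] := trunc_lip r.
pose T : R := `|t|; have T0 : 0 <= T by exact: normr_ge0.
(* With [eps = e / (2 C)], Gronwall bounds the squared difference by
   [eps^2 C <= (eps C)^2 = (e / 2)^2]. *)
pose C : R := (1 + T) * expR ((2 * L + 1) * T).
have C1 : 1 <= C.
  rewrite -[leLHS]mulr1 /C ler_pM//; first by rewrite lerDl.
  by rewrite -[leLHS]expR0 ler_expR mulr_ge0//; lra.
pose eps : R := e / (2 * C).
have eps0 : 0 < eps by rewrite divr_gt0// mulr_gt0//; lra.
have nb := cub_near r w T eps0.
have np : \forall p \near (w, x), (forall s y, `|s| <= T ->
    `|cub (sigma s p.1) (clamp r y) - cub (sigma s w) (clamp r y)| <= eps) /\ `|p.2 - x| < eps.
  exists ([set w' | (forall s y, `|s| <= T ->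
    `|cub (sigma s w') (clamp r y) - cub (sigma s w) (clamp r y)| <= eps)], ball x eps) => //=.
    by split => //; exact: nbhsx_ballx.
  by move=> [w' x'] [/= h1 h2]; split => //; rewrite distrC.
apply: filterS np => -[w' x'] /= [hw hx].
(* Following [sg * s] for [s] from [0] to [|t|] treats both time directions with the forward
   estimate. *)
pose sg := Num.sg t.
have sgt : sg * T = t by rewrite /sg /T -numEsg.
have sg1 : `|sg| <= 1 by rewrite /sg normr_sg; case: (t != 0).
pose v := Phi r w x; pose v' := Phi r w' x'.
pose F w s y := cub (sigma s w) (clamp r y).
pose d s := v' (sg * s) - v (sg * s).
pose dd s := sg * (F w' (sg * s) (v' (sg * s)) - F w (sg * s) (v (sg * s))).
have gr := @gronwall_sq _ d dd L eps T (ltW L0) (ltW eps0).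
have sT (s : R) : 0 <= s <= T -> `|sg * s| <= T.
  by move=> /andP[s0 sT]; rewrite normrM (ger0_norm s0) -[leRHS]mul1r ler_pM.
have := gr _ _ T; rewrite T0 lexx => /(_ _ _ isT).
have -> : d 0 = x' - x by rewrite /d mulr0 /v /v' !Phi0.
have -> : d T = Phi r w' x' t - Phi r w x t by rewrite /d sgt.
move=> H; have {}H := H _ _.
have : (Phi r w' x' t - Phi r w x t) ^+ 2 <=
    ((x' - x) ^+ 2 + eps ^+ 2 * T) * expR ((2 * L + 1) * T).
  apply: H => [s _|s sT'].
    have sd : is_derive s 1 (fun s => sg * s) sg.
      by have := drvM (drvc sg s) (drvid s); rewrite mul0r add0r mulr1.
    have := drvB (drv_comp (Phi_sol r w' x' (sg * s)) sd) (drv_comp (Phi_sol r w x (sg * s)) sd).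
    by rewrite -mulrBl mulrC; apply.
  rewrite /dd normrM -[leRHS]mul1r ler_pM//.
  have -> : F w' (sg * s) (v' (sg * s)) - F w (sg * s) (v (sg * s)) =
    (F w' (sg * s) (v' (sg * s)) - F w' (sg * s) (v (sg * s))) +
    (F w' (sg * s) (v (sg * s)) - F w (sg * s) (v (sg * s))) by ring.
  apply: le_trans (ler_normD _ _) _; apply: lerD; first exact: HL.
  by apply: hw; exact: sT.
move=> {}H.
rewrite distrC -ltr_sqr ?nnegrE ?(ltW e0)// real_normK ?num_real//.
apply: le_lt_trans H _.
have : (x' - x) ^+ 2 <= eps ^+ 2.
  by rewrite -[X in X <= _]real_normK ?num_real// lerXn2r ?nnegrE// ltW.
move=> hx2.
have : ((x' - x) ^+ 2 + eps ^+ 2 * T) * expR ((2 * L + 1) * T) <= eps ^+ 2 * C.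
  rewrite /C mulrA ler_wpM2r ?expR_ge0// mulrDr mulr1; lra.
move=> /le_lt_trans; apply.
have sqC (a b : R) : 1 <= b -> a ^+ 2 * b <= (a * b) ^+ 2.
  by move=> b1; rewrite exprMn ler_wpM2l ?sqr_ge0// [leRHS]expr2 ler_peMr//; lra.
have := sqC eps C C1.
move=> /le_lt_trans; apply; rewrite ltr_sqr ?nnegrE ?(ltW e0)//; last first.
  by rewrite mulr_ge0 ?(ltW eps0)//; lra.
suff -> : eps * C = e / 2 by lra.
by rewrite /eps; move: (C) C1 => b b1; field; rewrite gt_eqF//; lra.
Qed.

End cubic.

(** * Maximal solutions and dissipativity *)

Lemma segment_bounded (R : realType) (v : R -> R) (a b : R) :
  (forall t, a <= t <= b -> {for t, continuous v}) ->
  exists K, forall t, a <= t <= b -> `|v t| <= K.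
Proof.
move=> cv.
have : compact (v @` `[a, b]).
  apply: continuous_compact; last exact: segment_compact.
  by apply: continuous_in_subspaceT => t; rewrite inE/= in_itv/=; exact: cv.
move=> /compact_bounded [M [Mr HM]].
exists (`|M| + 1) => t tab; apply: HM; last by exists t => //=; rewrite in_itv.
by rewrite (le_lt_trans (ler_norm _))// ltrDl.
Qed.

Lemma pair_cst_continuous (T U V : topologicalType) (f : T -> U) (c : V) :
  continuous f -> continuous (fun x => (f x, c)).
Proof. by move=> cf x; apply: cvg_pair; [exact: cf|exact: cvg_cst]. Qed.

Section dissipative.
Context {R : realType} {Omega : pmetricType R}.
Variable sigma : R -> Omega -> Omega.
Hypothesis cptOmega : compact [set: Omega].
Hypothesis flow_sigma : continuous_flow sigma.
Variables p1 p2 p3 : Omega -> R.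
Hypothesis c1 : continuous p1.
Hypothesis c2 : continuous p2.
Hypothesis c3 : continuous p3.
Hypothesis p3_gt0 : forall w, 0 < p3 w.

Local Notation cub := (cub p1 p2 p3).
Local Notation sol := (sol sigma p1 p2 p3).
Local Notation Phi := (Phi cptOmega flow_sigma c1 c2 c3).

(** Both curves are bounded on the compact interval, where the cubic is Lipschitz, so Gronwall
    applies with [eps = 0]. The factor [sg] selects the time direction. *)
Lemma forward_unique (sg T : R) w v v' : 0 <= T ->
  (forall s : R, 0 <= s <= T -> is_derive (sg * s) 1 v (cub (sigma (sg * s) w) (v (sg * s)))) ->
  (forall s : R, 0 <= s <= T -> is_derive (sg * s) 1 v' (cub (sigma (sg * s) w) (v' (sg * s)))) ->
  v 0 = v' 0 -> v (sg * T) = v' (sg * T).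
Proof.
move=> T0 dv dv' e.
have sd (s : R) : is_derive s 1 (fun s => sg * s) sg.
  by have := drvM (drvc sg s) (drvid s); rewrite mul0r add0r mulr1.
pose u s := v (sg * s); pose u' s := v' (sg * s).
have du (s : R) : 0 <= s <= T -> is_derive s 1 u (cub (sigma (sg * s) w) (u s) * sg).
  by move=> sT; exact: drv_comp (dv s sT) (sd s).
have du' (s : R) : 0 <= s <= T -> is_derive s 1 u' (cub (sigma (sg * s) w) (u' s) * sg).
  by move=> sT; exact: drv_comp (dv' s sT) (sd s).
have [K HK] : exists K, forall t, 0 <= t <= T -> `|u t| <= K.
  by apply: segment_bounded => t tT; exact: drv_continuous (du t tT).
have [K' HK'] : exists K, forall t, 0 <= t <= T -> `|u' t| <= K.
  by apply: segment_bounded => t tT; exact: drv_continuous (du' t tT).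
have [L L0 HL] := cub_lip cptOmega c1 c2 c3 (Num.max K K').
have H := @gronwall_sq _ (fun s => u s - u' s)
  (fun s => cub (sigma (sg * s) w) (u s) * sg - cub (sigma (sg * s) w) (u' s) * sg) (L * `|sg|) 0 T.
have e0 : u 0 - u' 0 = 0 by rewrite /u /u' mulr0 e subrr.
have E x : (((u 0 - u' 0) ^+ 2 + 0 ^+ 2 * T) * x) = 0 by rewrite e0; ring.
apply/eqP; rewrite -subr_eq0 -sqrf_eq0 eq_le sqr_ge0 andbT.
rewrite -(E (expR ((2 * (L * `|sg|) + 1) * T))).
apply: H => //; last by rewrite T0 lexx.
- by rewrite mulr_ge0// ltW.
- by move=> s sT; exact: drvB (du s sT) (du' s sT).
- move=> s sT; rewrite -mulrBl normrM addr0 mulrAC ler_wpM2r//.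
  by apply: HL; rewrite le_max ?HK// HK'// orbT.
Qed.

Lemma ivp_unique w x J J' (v v' : R -> R) t :
  ivp_solution sigma cub w x J v -> ivp_solution sigma cub w x J' v' ->
  J t -> J' t -> v t = v' t.
Proof.
move=> [_ iJ J0 v0 dv] [_ iJ' J'0 v'0 dv'] Jt J't.
have m (t' : R) : 0 <= t' <= `|t| -> 0 <= Num.sg t * t' <= t \/ t <= Num.sg t * t' <= 0.
  case: (sgrP t) => [->|t0|t0]; rewrite ?normr0 => /andP[h1 h2]; first by left; lra.
    by left; lra.
  by right; lra.
have [Jm J'm] : (forall s, 0 <= s <= `|t| -> J (Num.sg t * s)) /\ (forall s, 0 <= s <= `|t| -> J' (Num.sg t * s)).
  split=> s /m [] h.
  - exact: iJ J0 Jt _ h.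
  - exact: iJ Jt J0 _ h.
  - exact: iJ' J'0 J't _ h.
  - exact: iJ' J't J'0 _ h.
rewrite [t]numEsg; apply: (forward_unique (w := w)) => // [s st|s st|].
- exact: dv (Jm s st).
- exact: dv' (J'm s st).
- by rewrite v0 v'0.
Qed.

(* The maximal solution is the union of all solutions of the initial value problem. *)
Lemma ivp_sol_at w x J v t : ivp_solution sigma cub w x J v -> J t ->
  sol_at sigma cub t w x (v t).
Proof.
move=> iv Jt.
pose P s y := exists J' v', [/\ ivp_solution sigma cub w x J' v', J' s & v' s = y].
pose V s := if pselect (exists y, P s y) is left h then sval (cid h) else 0.
have PV J' v' s : ivp_solution sigma cub w x J' v' -> J' s -> V s = v' s.
  move=> iv' J's; rewrite /V; case: pselect => [h|]; last by case; exists (v' s), J', v'.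
  case: cid => y /= [J'' [v'' [iv'' J''s <-]]].
  exact: ivp_unique iv'' iv' J''s J's.
pose JJ : set R := [set s | exists J' v', ivp_solution sigma cub w x J' v' /\ J' s].
exists JJ, V; split; last 2 first.
- by exists J, v.
- exact: PV iv Jt.
split; last by move=> J' v' iv' s J's; exists J', v'.
have [oJ iJ J0 v0 dv] := iv.
split.
- rewrite openE => s [J' [v' [iv' J's]]].
  have [oJ' _ _ _ _] := iv'.
  have : nbhs s J' by exact: open_nbhs_nbhs.
  by apply: filterS => s' J's'; exists J', v'.
- move=> a b [J1 [v1 [i1 J1a]]] [J2 [v2 [i2 J2b]]] c /andP[ac cb].
  have [_ itv1 J10 _ _] := i1; have [_ itv2 J20 _ _] := i2.
  case: (leP c 0) => c0.
    by exists J1, v1; split => //; apply: itv1 J1a J10 _ _; rewrite ac.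
  by exists J2, v2; split => //; apply: itv2 J20 J2b _ _; rewrite (ltW c0).
- by exists J, v.
- by rewrite (PV _ _ _ iv J0).
- move=> s [J' [v' [iv' J's]]].
  have [oJ' _ _ _ dv'] := iv'.
  rewrite (PV _ _ _ iv' J's).
  apply: (@near_eq_is_derive _ _ _ v'); last exact: dv'.
  have : nbhs s J' by exact: open_nbhs_nbhs.
  by apply: filterS => s' J's'; rewrite (PV _ _ _ iv' J's').
Qed.

Lemma sol_at_unique t w x y y' : sol_at sigma cub t w x y ->
  sol_at sigma cub t w x y' -> y = y'.
Proof.
move=> [J [v [[iv _] Jt <-]]] [J' [v' [[iv' _] J't <-]]].
exact: ivp_unique iv iv' Jt J't.
Qed.

Lemma interval_sol_at (a b t : R) w v : a < 0 < b -> a < t < b ->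
  (forall s : R, a < s < b -> is_derive s 1 v (cub (sigma s w) (v s))) ->
  sol_at sigma cub t w (v 0) (v t).
Proof.
move=> ab0 abt dv; apply: (@ivp_sol_at _ _ `]a, b[); last by rewrite /= in_itv.
split => //.
exact: interval_is_interval.
Qed.

Lemma sol_sol_at t w v : sol w v -> sol_at sigma cub t w (v 0) (v t).
Proof.
move=> sv; have := normr_ge0 t; have := ler_norm t; have := ler_norm (- t); rewrite normrN => h1 h2 h3.
by apply: (@interval_sol_at (- `|t| - 1) (`|t| + 1)) => [||s _]; [lra|lra|exact: sv].
Qed.

Lemma dissipation : exists2 r0 : R, 1 <= r0 & forall w x,
  (r0 <= x -> cub w x <= -1) /\ (x <= - r0 -> 1 <= cub w x).
Proof.
have [B B1 HB] := coef_bound cptOmega c1 c2 c3.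
have [c c0 Hc] := positive_below cptOmega c3 p3_gt0.
(* Beyond this radius [p3 |x|^3 >= (2 B + 1) x^2], while the other terms are at most
   [B x^2 + B |x| <= 2 B x^2]; at least [x^2 >= 1] remains. *)
exists ((2 * B + 1) / c + 1).
  by rewrite lerDr divr_ge0// ?ltW//; lra.
have main w y : (2 * B + 1) / c + 1 <= y -> 1 <= y /\ (2 * B + 1) * y ^+ 2 <= p3 w * y ^+ 3.
  move=> hy; have y1 : 1 <= y.
    have : 0 <= (2 * B + 1) / c by rewrite divr_ge0// ?ltW//; lra.
    lra.
  split => //; have -> : p3 w * y ^+ 3 = p3 w * y * y ^+ 2 by ring.
  rewrite ler_wpM2r ?sqr_ge0//.
  have : (2 * B + 1) / c <= y by lra.
  rewrite ler_pdivrMr// mulrC => /le_trans; apply.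
  by rewrite mulrC ler_wpM2r//; lra.
move=> w x; have [b1 b2 _] := HB w.
move: b1 b2; rewrite !ler_norml => /andP[b1l b1u] /andP[b2l b2u].
split=> hx; rewrite /cub.
  have [x1 h] := main w x hx.
  have h2 : p2 w * x ^+ 2 <= B * x ^+ 2 by rewrite ler_wpM2r ?sqr_ge0.
  have h1 : p1 w * x <= B * x by rewrite ler_wpM2r//; lra.
  have : B * x <= B * x ^+ 2 by rewrite ler_wpM2l ?expr2 ?ler_peMr//; lra.
  have : 1 <= x ^+ 2 by rewrite expr_ge1//; lra.
  lra.
have hx' : (2 * B + 1) / c + 1 <= - x by lra.
have [x1 h] := main w (- x) hx'.
have e3 : (- x) ^+ 3 = - x ^+ 3 by ring.
have e2 : (- x) ^+ 2 = x ^+ 2 by ring.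
rewrite e3 e2 in h.
have h2 : - B * x ^+ 2 <= p2 w * x ^+ 2 by rewrite ler_wpM2r ?sqr_ge0//; lra.
have h1 : p1 w * (- x) <= B * (- x) by rewrite ler_wpM2r//; lra.
have : B * (- x) <= B * x ^+ 2 by rewrite ler_wpM2l -?e2 ?expr2 ?ler_peMr//; lra.
have : 1 <= x ^+ 2 by rewrite -e2 expr_ge1//; lra.
lra.
Qed.

Lemma trunc_le_barrier r r0 w v : (forall w, cub w r0 <= 0) -> 0 <= r0 <= r ->
  trunc_sol sigma p1 p2 p3 r w v -> v 0 <= r0 -> forall t, 0 <= t -> v t <= r0.
Proof.
move=> hr0 r0r sv v0 t t0; have [L L0 HL] := trunc_lip cptOmega c1 c2 c3 r.
apply: (@comparison _ (fun t y => cub (sigma t w) (clamp r y)) (fun=> r0) v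
  (fun=> 0) (fun t => cub (sigma t w) (clamp r (v t))) L) => //; first exact: ltW.
by move=> s _; rewrite clamp_id ?ger0_norm//; lra.
Qed.

Lemma trunc_ge_barrier r r0 w v : (forall w, 0 <= cub w (- r0)) -> 0 <= r0 <= r ->
  trunc_sol sigma p1 p2 p3 r w v -> - r0 <= v 0 -> forall t, 0 <= t -> - r0 <= v t.
Proof.
move=> hr0 r0r sv v0 t t0; have [L L0 HL] := trunc_lip cptOmega c1 c2 c3 r.
apply: (@comparison _ (fun t y => cub (sigma t w) (clamp r y)) v (fun=> - r0)
  (fun t => cub (sigma t w) (clamp r (v t))) (fun=> 0) L) => //; first exact: ltW.
by move=> s _; rewrite clamp_id ?normrN ?ger0_norm//; lra.
Qed.

(** The margin [1], rather than a mere sign, yields an explicit absorption time. *)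
Definition dissip r0 := 1 <= r0 /\ forall w x,
  (r0 <= x -> cub w x <= -1) /\ (x <= - r0 -> 1 <= cub w x).

Lemma forward_exists r0 K w x : dissip r0 -> r0 <= K -> `|x| <= K ->
  exists v, [/\ v 0 = x, forall t, 0 <= t -> `|v t| <= K &
    exists2 e : R, 0 < e & forall t : R, - e < t -> is_derive t 1 v (cub (sigma t w) (v t))].
Proof.
move=> [r01 hr0] r0K xK; pose v := Phi (K + 1) w x.
have sv : trunc_sol sigma p1 p2 p3 (K + 1) w v by exact: Phi_sol.
have v0 : v 0 = x by exact: Phi0.
have vK t : 0 <= t -> `|v t| <= K.
  move: xK; rewrite -v0 ler_norml => /andP[vl vu] t0; rewrite ler_norml; apply/andP; split.
    apply: (trunc_ge_barrier _ _ sv) => // [w'|]; last lra.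
    by apply: le_trans (ler01) _; apply: (hr0 w' (- K)).2; lra.
  apply: (trunc_le_barrier _ _ sv) => // [w'|]; last lra.
  by apply: (@le_trans _ _ (-1)); [apply: (hr0 w' K).1|]; lra.
exists v; split => //.
(* The domain of a solution must be open around [0], so a short negative time is required; the
   cut-off [K + 1] leaves room for it. *)
have [e /= e0 He] : \forall t \near (0 : R), `|v t| < K + 1.
  have cv : {for 0, continuous (fun t => `|v t|)}.
    apply: (@continuous_comp _ _ _ v (fun x => `|x|)); last exact: norm_continuous.
    exact: drv_continuous (sv 0).
  by apply: (cv _ (lt_nbhsl _)); rewrite v0; lra.
exists e => // t te.
suff vt : `|v t| <= K + 1 by have := sv t; rewrite clamp_id.
case: (leP 0 t) => t0; first by have := vK t t0; lra.
by apply/ltW; apply: He; rewrite /ball/= sub0r normrN ltr0_norm//; lra.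
Qed.

Lemma sub_le_barrier r0 K w (v dv : R -> R) : dissip r0 ->
  (forall t, 0 <= t -> `|v t| <= K) ->
  (forall t : R, 0 <= t -> is_derive t 1 v (dv t)) ->
  (forall t : R, 0 <= t -> dv t <= cub (sigma t w) (v t)) ->
  v 0 <= r0 -> forall t, 0 <= t -> v t <= r0.
Proof.
move=> [r01 hr0] vK vd dvle vr0 t t0.
have [L L0 HL] := cub_lip cptOmega c1 c2 c3 (Num.max K r0).
apply: (@comparison _ (fun t => cub (sigma t w)) (fun=> r0) v (fun=> 0) dv L) => //.
- exact: ltW.
- by move=> s _; apply: (@le_trans _ _ (-1)); [apply: (hr0 _ r0).1|]; lra.
- move=> s s0; apply: HL; rewrite le_max ?vK// ger0_norm ?lexx ?orbT//; lra.
Qed.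

(** Above [r0] a subsolution falls at speed at least [1], so the excess [K - r0] is spent within
    that time; once below [r0], it stays there by [sub_le_barrier]. *)
Lemma absorb_le r0 K w (v dv : R -> R) : dissip r0 -> (forall t, 0 <= t -> `|v t| <= K) ->
  (forall t : R, 0 <= t -> is_derive t 1 v (dv t)) ->
  (forall t : R, 0 <= t -> dv t <= cub (sigma t w) (v t)) ->
  r0 <= K -> forall t, K - r0 <= t -> v t <= r0.
Proof.
move=> dr vK vd dvle r0K t tT.
have t0 : 0 <= t by lra.
rewrite leNgt; apply/negP => vT.
have vgt s : 0 <= s <= t -> r0 < v s.
  move=> /andP[s0 sT]; rewrite ltNge; apply/negP => vs.
  suff : v (s + (t - s)) <= r0 by rewrite addrC subrK leNgt vT.
  apply: (@sub_le_barrier r0 K (sigma s w) (fun t => v (s + t)) (fun t => dv (s + t)) dr); last lra.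
  - by move=> u u0; apply: vK; lra.
  - by move=> u u0; apply: drv_shift; apply: vd; lra.
  - by move=> u u0; rewrite -flowD//; apply: dvle; lra.
  - by rewrite addr0.
have : - v 0 - 0 <= - v t - t.
  apply: (@drv_nondecreasing _ (fun t => - v t - t) (fun t => - dv t - 1)) => // s /andP[s0 st].
    exact: drvB (drvN (vd s s0)) (drvid s).
  have := dvle s s0; have := vgt s; rewrite s0 st => /(_ isT) h.
  have := (dr.2 (sigma s w) (v s)).1 (ltW h); lra.
have := vK 0 (lexx _); rewrite ler_norml; lra.
Qed.

(** A bounded curve defined for all past times has already been absorbed: start it at time
    [t - T]. *)
Lemma subsolution_le_r0 r0 K w (v dv : R -> R) : dissip r0 -> (forall t, `|v t| <= K) ->
  (forall t : R, is_derive t 1 v (dv t)) ->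
  (forall t : R, dv t <= cub (sigma t w) (v t)) -> forall t, v t <= r0.
Proof.
move=> dr vK vd dvle t.
pose K' := Num.max K r0; pose T := K' - r0.
have r0K' : r0 <= K' by rewrite le_max lexx orbT.
have := @absorb_le r0 K' (sigma (t - T) w) (fun u => v (t - T + u)) (fun u => dv (t - T + u)) dr.
move=> /(_ _ _ _ r0K' T); rewrite subrK; apply => //.
- by move=> u _; rewrite le_max vK.
- by move=> u _; apply: drv_shift.
- by move=> u _; rewrite -flowD.
Qed.

(** * The largest bounded solution, by pullback from a constant supersolution *)

Section upper_bound.
Variable r0 : R.
Hypothesis dr : dissip r0.

Let r := r0 + 1.

(** The pullback: start at level [r0] a time [s] before reaching the fibre of [w]. Since [r0] is a
    supersolution, the value decreases with [s], and [upper] is its limit. *)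
Definition pull w s := Phi r (sigma (- s) w) r0 s.

Definition upper w : R := inf [set pull w s | s in [set s | 0 <= s]].

Lemma Phi_le_r0 w t : 0 <= t -> Phi r w r0 t <= r0.
Proof.
have [r01 hr0] := dr; move=> t0; apply: (trunc_le_barrier _ _ (Phi_sol _ _ _ _ _ r w r0)) => // [w'||].
- by apply: (@le_trans _ _ (-1)); [apply: (hr0 w' r0).1|]; lra.
- rewrite /r; lra.
- by rewrite Phi0.
Qed.

Lemma Phi_ge_r0 w x t : - r0 <= x -> 0 <= t -> - r0 <= Phi r w x t.
Proof.
have [r01 hr0] := dr; move=> hx t0; apply: (trunc_ge_barrier _ _ (Phi_sol _ _ _ _ _ r w x)) => // [w'||].
- by apply: (@le_trans _ _ 1); [lra|apply: (hr0 w' (- r0)).2]; lra.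
- rewrite /r; lra.
- by rewrite Phi0.
Qed.

Lemma Phi_r0_bound w t : 0 <= t -> `|Phi r w r0 t| <= r0.
Proof.
move=> t0; rewrite ler_norml Phi_le_r0// Phi_ge_r0//.
by have := dr.1; lra.
Qed.

Lemma pull_bound w s : 0 <= s -> - r0 <= pull w s <= r0.
Proof. by move=> s0; rewrite -ler_norml; exact: Phi_r0_bound. Qed.

Lemma pull_nonincreasing w s s' : 0 <= s -> s <= s' -> pull w s' <= pull w s.
Proof.
move=> s0 ss'; rewrite /pull -{2}(subrK s s') PhiD -flowD//.
rewrite (_ : - s' + (s' - s) = - s); last by ring.
by apply: Phi_order; apply: Phi_le_r0; rewrite subr_ge0.
Qed.

Lemma pull_flow w s t : pull (sigma t w) (s + t) = Phi r w (pull w s) t.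
Proof.
have e1 : t - (s + t) = - s by ring.
have e2 : t + (- (s + t) + s) = 0 by ring.
by rewrite /pull PhiD -!flowD// e1 e2 flow0.
Qed.

Lemma upper_le_pull w s : 0 <= s -> upper w <= pull w s.
Proof.
move=> s0; apply: ge_inf; last by exists s.
by exists (- r0) => _ [s' s'0 <-]; have /andP[] := pull_bound w s'0.
Qed.

Lemma upper_ge w y : (forall s, 0 <= s -> y <= pull w s) -> y <= upper w.
Proof.
move=> h; apply: lb_le_inf; first by exists (pull w 0), 0 => /=.
by move=> _ [s s0 <-]; exact: h.
Qed.

Lemma upper_bounds w : - r0 <= upper w <= r0.
Proof.
apply/andP; split; first by apply: upper_ge => s /(pull_bound w) /andP[].
by have /andP[_] := pull_bound w (lexx 0); apply: le_trans; exact: upper_le_pull.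
Qed.

Lemma upper_flow w t : Phi r w (upper w) t = upper (sigma t w).
Proof.
have le1 w' t' : Phi r w' (upper w') t' <= upper (sigma t' w').
  apply: upper_ge => s' s'0.
  pose s'' := Num.max s' (Num.max t' 0).
  have h1 : s' <= s'' by rewrite le_max lexx.
  have h2 : t' <= s'' by rewrite !le_max lexx orbT.
  apply: le_trans (pull_nonincreasing (sigma t' w') s'0 h1).
  rewrite -(subrK t' s'') pull_flow; apply: Phi_order; apply: upper_le_pull.
  by rewrite subr_ge0.
apply/eqP; rewrite eq_le le1/=.
(* The reverse inequality: apply the first one backward from [sigma t w], then transport it by time
   [t]. *)
have := Phi_order cptOmega flow_sigma c1 c2 c3 r w t (le1 (sigma t w) (- t)).
by rewrite flowK// -{1}(flowK flow_sigma t w) -PhiD addNr Phi0.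
Qed.

Lemma upper_sol w : sol w (fun t => upper (sigma t w)).
Proof.
have e : (fun t => upper (sigma t w)) = Phi r w (upper w).
  by apply/funext => t; rewrite upper_flow.
rewrite e; apply: trunc_sol_sol (Phi_sol _ _ _ _ _ _ _ _) _ => t.
rewrite upper_flow; have := upper_bounds (sigma t w).
by rewrite -ler_norml => /le_trans; apply; rewrite /r; lra.
Qed.

(** Maximality of [upper]: a bounded complete subsolution lies under [r0] at all times, hence under
    every pullback by comparison. *)
Lemma subsolution_le_upper K w (v dv : R -> R) : (forall t, `|v t| <= K) ->
  (forall t : R, is_derive t 1 v (dv t)) ->
  (forall t : R, dv t <= cub (sigma t w) (v t)) -> v 0 <= upper w.
Proof.
move=> vK vd dvle; apply: upper_ge => s s0.
have vr0 := subsolution_le_r0 dr vK vd dvle.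
have [L L0 HL] := cub_lip cptOmega c1 c2 c3 (Num.max K r0).
have sP := Phi_sol cptOmega flow_sigma c1 c2 c3 r (sigma (- s) w) r0.
have := @comparison _ (fun t => cub (sigma t (sigma (- s) w))) (Phi r (sigma (- s) w) r0)
  (fun t => v (- s + t)) (fun t => cub (sigma t (sigma (- s) w)) (clamp r (Phi r (sigma (- s) w) r0 t)))
  (fun t => dv (- s + t)) L (ltW L0).
move=> /(_ _ _ _ _ _ _ s s0); rewrite addNr; apply.
- by move=> t _; exact: sP.
- by move=> t _; exact: drv_shift.
- move=> t t0; rewrite clamp_id//; apply: le_trans (Phi_r0_bound _ t0) _; rewrite /r; lra.
- by move=> t _; rewrite -flowD.
- by move=> t t0; apply: HL; rewrite le_max ?vK// (Phi_r0_bound _ t0) orbT.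
- by rewrite Phi0 addr0.
Qed.

(** [upper] is an infimum of functions continuous in [w] and decreasing in [s]: a time [T] good at
    [w] is good at nearby [w'] and at all later times. Upper semicontinuity and locally uniform
    attraction both come from this. *)
Lemma upper_attracts w (e : R) : 0 < e -> exists2 T : R, 0 <= T & \forall w' \near w,
  forall s v, T <= s ->
  (forall t : R, 0 <= t -> is_derive t 1 v (cub (sigma t (sigma (- s) w')) (v t))) ->
  `|v 0| <= r0 -> v s <= upper w + e.
Proof.
move=> e0.
have hi : has_inf [set pull w s | s in [set s | 0 <= s]].
  split; first by exists (pull w 0), 0 => /=.
  by exists (- r0) => _ [s' s'0 <-]; have /andP[] := pull_bound w s'0.
have [_ [T /= T0 <-] pT] := inf_adherent e0 hi.
exists T => //.
have cp : {for w, continuous (fun w' => pull w' T)}.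
  apply: (@continuous_comp _ _ _ (fun w' => (sigma (- T) w', r0) : Omega * R) (fun p => Phi r p.1 p.2 T)).
    by apply: pair_cst_continuous; exact: flow_continuous.
  exact: Phi_continuous.
have {}cp : \forall w' \near w, pull w' T < upper w + e by exact: cp _ (lt_nbhsl pT).
apply: filterS cp => w' /= pw' s v Ts vd v0.
have s0 : 0 <= s by lra.
apply: le_trans (ltW pw').
apply: le_trans (pull_nonincreasing w' T0 Ts).
have sP := Phi_sol cptOmega flow_sigma c1 c2 c3 r (sigma (- s) w') (v 0).
have Pb t : 0 <= t -> `|Phi r (sigma (- s) w') (v 0) t| <= r.
  move=> t0; move: v0; rewrite ler_norml => /andP[vl vu].
  rewrite ler_norml (le_trans _ (Phi_ge_r0 (sigma (- s) w') vl t0)) ?(le_trans (Phi_order _ _ _ _ _ _ _ _ vu))//.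
    by apply: le_trans (Phi_le_r0 _ t0) _; rewrite /r; lra.
  by rewrite /r; lra.
have -> : v s = Phi r (sigma (- s) w') (v 0) s.
  have := @forward_unique 1 s (sigma (- s) w') v (Phi r (sigma (- s) w') (v 0)) s0.
  rewrite mul1r; apply.
  - by move=> u /andP[u0 _]; rewrite mul1r; exact: vd.
  - by move=> u /andP[u0 _]; rewrite mul1r; have := sP u; rewrite clamp_id// Pb.
  - by rewrite Phi0.
by apply: Phi_order; exact: le_trans (ler_norm _) v0.
Qed.

End upper_bound.

(** The set is an intersection over [t] of preimages of [[lo, hi]] under the continuous truncated
    flow. *)
Lemma band_closed (lo hi : R) :
  closed [set p : Omega * R | exists v, [/\ v 0 = p.2, sol p.1 v & forall t, lo <= v t <= hi]].
Proof.
pose r := Num.max `|lo| `|hi|.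
have hr x : lo <= x <= hi -> `|x| <= r.
  move=> /andP[lx xh]; rewrite ler_norml; apply/andP; split.
    by rewrite lerNl le_max; apply/orP; left; apply: (@le_trans _ _ (- lo)); [lra|rewrite -normrN ler_norm].
  by rewrite le_max; apply/orP; right; apply: le_trans xh (ler_norm _).
have -> : [set p : Omega * R | exists v, [/\ v 0 = p.2, sol p.1 v & forall t, lo <= v t <= hi]] =
    \bigcap_t ((fun p : Omega * R => Phi r p.1 p.2 t) @^-1` [set` `[lo, hi]]).
  apply/seteqP; split=> [p [v [v0 sv vb]] t _|p hp].
    rewrite /= in_itv/= -v0 -(Phi_unique _ _ _ _ _ (sol_trunc sv _))// => s; exact: hr.
  have hb t : lo <= Phi r p.1 p.2 t <= hi by have := hp t I; rewrite /= in_itv.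
  exists (Phi r p.1 p.2); split => //; first exact: Phi0.
  by apply: trunc_sol_sol (Phi_sol _ _ _ _ _ _ _ _) _ => t; exact: hr.
apply: closed_bigI => t _; apply: preimage_closed; last exact: interval_closed.
by move=> p _; exact: Phi_continuous.
Qed.

End dissipative.

(** * Minimality, averages and exponential dichotomy *)

Section minimality.
Context {R : realType} {Omega : pmetricType R}.
Variable sigma : R -> Omega -> Omega.
Hypothesis cptOmega : compact [set: Omega].
Hypothesis flow_sigma : continuous_flow sigma.
Hypothesis min_sigma : minimal_flow sigma.

Lemma closed_orbit_full (S : set Omega) w : closed S ->
  (forall t, S (sigma t w)) -> forall w', S w'.
Proof.
move=> cS Sw w'; apply: cS => U; rewrite nbhsE => -[V [oV Vw'] VU].
have [x [Vx [t _ xE]]] : V `&` range (fun t => sigma t w) !=set0.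
  by apply: min_sigma => //; exists w'.
by exists x; split; [rewrite -xE|exact: VU].
Qed.

(** Let [w1] be a cluster point of [sigma (- n) w]. Its whole orbit lies in [S], because for fixed
    [t] the times [t - n] are eventually negative; minimality concludes. *)
Lemma half_orbit_full (S : set Omega) w : closed S ->
  (forall t, t <= 0 -> S (sigma t w)) -> forall w', S w'.
Proof.
move=> cS Sw.
have [w1 [_ cl]] : [set: Omega] `&` cluster ((fun n : nat => sigma (- n%:R) w) @ \oo) !=set0.
  by apply: cptOmega; exact: filterT.
apply: (@closed_orbit_full S w1) => // t.
apply: cS => U Ut.
have V1 : nbhs w1 (sigma t @^-1` U) by exact: (flow_continuous flow_sigma Ut).
have V2 : ((fun n : nat => sigma (- n%:R) w) @ \oo) [set z | S (sigma t z)].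
  exists (Num.bound `|t|) => //= n tn.
  change (S (sigma t (sigma (- n%:R) w))); rewrite -(flowD flow_sigma); apply: Sw.
  have : `|t| < n%:R by apply: lt_le_trans (archi_boundP _) _; rewrite ?ler_nat.
  by move/(le_lt_trans (ler_norm _)); lra.
by have [z [/= z1 z2]] := cl _ _ V2 V1; exists (sigma t z).
Qed.

(** Every orbit meets [U], and nearby orbits meet it at the same time; compactness bounds the
    times. *)
Lemma syndetic (U : set Omega) : open U -> U !=set0 ->
  exists T, forall w, exists2 s, `|s| <= T & U (sigma s w).
Proof.
move=> oU U0.
have := cptOmega; move/compact_near_coveringP.
move=> /(_ nat \oo (fun n w => exists2 s, `|s| <= n%:R & U (sigma s w)) _) [].
  move=> w _.
  have [x [Ux [t _ xE]]] : (U `&` range (fun t => sigma t w)) !=set0 by exact: min_sigma.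
  have V1 : nbhs w (sigma t @^-1` U).
    by apply: (flow_continuous flow_sigma); apply: open_nbhs_nbhs; split => //; rewrite xE.
  exists (sigma t @^-1` U, [set n | (Num.bound `|t| <= n)%N]) => /=.
    by split => //; exists (Num.bound `|t|).
  move=> [w' n] [/= Uw' tn]; exists t => //; apply/ltW.
  by apply: lt_le_trans (archi_boundP _) _; rewrite ?ler_nat.
move=> N _ HN; exists N%:R => w; apply: (HN N) => //=.
Qed.

End minimality.

Section orbit_integral.
Context {R : realType} {Omega : pmetricType R}.
Variable sigma : R -> Omega -> Omega.
Hypothesis cptOmega : compact [set: Omega].
Hypothesis flow_sigma : continuous_flow sigma.

Lemma int0_continuous (c : R * Omega -> R) (T : R) : 0 <= T -> continuous c ->
  continuous (fun w => int0 (fun s => c (s, w)) T).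
Proof.
move=> T0 cc w; apply/cvgrPdist_le => e e0.
have e' : 0 < e / (T + 1) by rewrite divr_gt0//; lra.
have cw w' : continuous (fun s => c (s, w')).
  move=> s; apply: (@continuous_comp _ _ _ (fun s => (s, w')) c); last exact: cc.
  by apply: pair_cst_continuous => x; exact: cvg_id.
have := uniform_near w T cc e'.
apply: filterS => w' hw'.
have main (sg : R) : `|sg| = 1 ->
    sg * (int0 (fun s => c (s, w)) T - int0 (fun s => c (s, w')) T) <= e / (T + 1) * T.
  move=> sg1.
  pose u s := e / (T + 1) * s - sg * (int0 (fun s => c (s, w)) s - int0 (fun s => c (s, w')) s).
  have : u 0 <= u T.
    apply: (@drv_nondecreasing _ u (fun s => e / (T + 1) - sg * (c (s, w) - c (s, w')))) => [//|s /andP[s0 sT]|s /andP[s0 sT]].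
      have := drvB (drvM (drvc (e / (T + 1)) s) (drvid s)) (drvM (drvc sg s) (drvB (drv_int0 s (cw w)) (drv_int0 s (cw w')))).
      by move/drv_eq; apply; ring.
    have := hw' s; rewrite ger0_norm// => /(_ sT) h.
    have : sg * (c (s, w) - c (s, w')) <= `|c (s, w') - c (s, w)|.
      by apply: le_trans (ler_norm _) _; rewrite normrM sg1 mul1r distrC.
    by lra.
  by rewrite /u !int0_at0; lra.
have h1 := main 1 (normr1 _).
have h2 := main (-1) (normrN1 _).
have : e / (T + 1) * T <= e.
  by rewrite -[leRHS](divfK (x := T + 1)) ?gt_eqF ?ler_wpM2l ?(ltW e')//; lra.
by move=> h3; rewrite ler_norml; lra.
Qed.

Variable a : Omega -> R.
Hypothesis ca : continuous a.

Definition orbint w t := int0 (fun s => a (sigma s w)) t.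

Lemma drv_orbint w (t : R) : is_derive t 1 (orbint w) (a (sigma t w)).
Proof. exact: (drv_int0 t (orbit_continuous flow_sigma (w := w) ca)). Qed.

Lemma orbint0 w : orbint w 0 = 0.
Proof. exact: int0_at0. Qed.

Lemma orbintD w s t : orbint w (s + t) = orbint w s + orbint (sigma s w) t.
Proof.
apply: (@primitive_unique _ (fun t => orbint w (s + t))
   (fun t => orbint w s + orbint (sigma s w) t) (fun t => a (sigma (s + t) w))) => [x|x|].
- exact: drv_shift (drv_orbint w (s + x)).
- have := drvD (drvc (orbint w s) x) (drv_orbint (sigma s w) x).
  by rewrite add0r flowD.
- by rewrite addr0 orbint0 addr0.
Qed.

Lemma orbint_continuous (t : R) : 0 <= t -> continuous (orbint ^~ t).
Proof.
move=> t0; apply: (@int0_continuous (fun p => a (sigma p.1 p.2))) => //.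
exact: (flow_along flow_sigma ca).
Qed.

(** Take [g w = - (1/T) int_0^T (T - s) a (sigma s w) ds]. Integration by parts turns [g] along an
    orbit into [G(t) - (1/T) int_t^(t+T) G], with [G] the running integral of [a], so its derivative
    is [a] minus the moving average. *)
Lemma averaging (T : R) : 0 < T -> exists g : Omega -> R, continuous g /\
  forall w (t : R), is_derive t 1 (fun t => g (sigma t w))
    (a (sigma t w) - orbint (sigma t w) T / T).
Proof.
move=> T0.
pose c (p : R * Omega) := (T - p.1) * a (sigma p.1 p.2).
have cc : continuous c.
  move=> p; apply: cvgM; last exact: (flow_along flow_sigma ca).
  by apply: cvgB; [exact: cvg_cst|exact: cvg_fst].
exists (fun w => - (int0 (fun s => c (s, w)) T / T)); split.
  move=> w; apply: cvgN; apply: cvgM; last exact: cvg_cst.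
  exact: (int0_continuous (ltW T0) cc).
move=> w t.
pose G := orbint w; have cG : continuous G by move=> s; exact: drv_continuous (drv_orbint w s).
pose H := int0 G.
have dH (s : R) : is_derive s 1 H (G s) by exact: drv_int0.
(* Integration by parts, checked by differentiating in the upper limit [r] and evaluating at [T]. *)
have e (s : R) : int0 (fun r => c (r, sigma s w)) T = H (s + T) - T * G s - H s.
  pose K r := (T - r) * G (s + r) + H (s + r) - T * G s - H s.
  have -> : H (s + T) - T * G s - H s = K T by rewrite /K subrr mul0r add0r.
  apply: (@primitive_unique _ (int0 (fun r => c (r, sigma s w))) K (fun r => (T - r) * a (sigma (s + r) w))) => [r|r|].
  - have ccs : continuous (fun r => c (r, sigma s w)).
      move=> r'; apply: (@continuous_comp _ _ _ (fun s' => (s', sigma s w)) c); last exact: cc.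
      by apply: pair_cst_continuous => x; exact: cvg_id.
    by have := drv_int0 r ccs; rewrite /c/= -flowD.
  - have := drvB (drvB (drvD (drvM (drvB (drvc T r) (drvid r)) (drv_shift (drv_orbint w (s + r)))) (drv_shift (dH (s + r)))) (drvc (T * G s) r)) (drvc (H s) r).
    by move/drv_eq; apply; rewrite /G; ring.
  - by rewrite int0_at0 /K addr0; ring.
have -> : (fun s => - (int0 (fun r => c (r, sigma s w)) T / T)) =
    (fun s => G s - (H (T + s) - H s) * T^-1).
  apply/funext => s; rewrite e [s + T]addrC.
  by field; rewrite gt_eqF.
have := drvB (drv_orbint w t) (drvM (drvB (drv_shift (dH (T + t))) (dH t)) (drvc T^-1 t)).
move/drv_eq; apply.
by rewrite /G [T + t]addrC orbintD; ring.
Qed.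

Variables lm lq : R.
Hypothesis lmq : lm < lq.
Hypothesis sp_a : sacker_sell_spectrum sigma a = [set` `[- lq, - lm]].

(** The two alternatives of exponential dichotomy in logarithmic form; the second, a backward
    estimate, is rewritten in forward time by moving the base point. *)
Definition decaying l := exists C d, 0 < d /\
  forall w t, 0 <= t -> orbint w t + l * t <= C - d * t.

Definition growing l := exists C d, 0 < d /\
  forall w t, 0 <= t -> d * t - C <= orbint w t + l * t.

Lemma int0_shift l w t : int0 (fun s => a (sigma s w) - - l) t = orbint w t + l * t.
Proof.
apply: (@primitive_unique _ _ (fun t => orbint w t + l * t) (fun s => a (sigma s w) - - l)) => [x|x|].
- apply: (@drv_int0 _ (fun s => a (sigma s w) - - l)) => s; apply: cvgB; last exact: cvg_cst.
  exact: (orbit_continuous flow_sigma ca).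
- have := drvD (drv_orbint w x) (drvM (drvc l x) (drvid x)).
  by move/drv_eq; apply; ring.
- by rewrite int0_at0 orbint0 mulr0 addr0.
Qed.

Lemma exp_dichotomyP l :
  exp_dichotomy sigma (fun w => a w - - l) <-> decaying l \/ growing l.
Proof.
split.
  move=> [k [d [k1 d0 [h|h]]]]; [left|right]; exists (ln k), d; split => // w t t0.
    have := h w t t0; rewrite int0_shift -{1}(lnK (x := k)) ?posrE; last lra.
    by rewrite -expRD ler_expR; lra.
  have := h (sigma t w) (- t); rewrite oppr_le0 => /(_ t0).
  rewrite int0_shift -{1}(lnK (x := k)) ?posrE; last lra.
  rewrite -expRD ler_expR.
  have := orbintD w t (- t); rewrite subrr orbint0; lra.
move=> [] [C [d [d0 h]]]; exists (expR `|C|), d; split => //.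
- by rewrite -[leLHS]expR0 ler_expR.
- left=> w t t0; rewrite int0_shift -expRD ler_expR.
  by have := h w t t0; have := ler_norm C; lra.
- by rewrite -[leLHS]expR0 ler_expR.
- right=> w t t0; rewrite int0_shift -expRD ler_expR.
  have t0' : 0 <= - t by lra.
  have := h (sigma t w) (- t) t0'; have := ler_norm C.
  have := orbintD w t (- t); rewrite subrr orbint0; lra.
Qed.

Lemma spectrumP l : (decaying l \/ growing l) <-> ~ (lm <= l <= lq).
Proof.
have E : ~ exp_dichotomy sigma (fun w => a w - - l) <-> lm <= l <= lq.
  have : sacker_sell_spectrum sigma a (- l) <-> [set` `[- lq, - lm]] (- l) by rewrite sp_a.
  by rewrite /sacker_sell_spectrum /= in_itv/= !lerN2 andbC.
rewrite -exp_dichotomyP; split; first by move=> h /E.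
by move=> h; apply: contrapT => /E.
Qed.

Lemma growing_mono l l' : l <= l' -> growing l -> growing l'.
Proof.
move=> ll' [C [d [d0 h]]]; exists C, d; split => // w t t0.
apply: le_trans (h w t t0) _; rewrite lerD2l ler_wpM2r//.
Qed.

Lemma decaying_mono l l' : l' <= l -> decaying l -> decaying l'.
Proof.
move=> ll' [C [d [d0 h]]]; exists C, d; split => // w t t0.
apply: le_trans (h w t t0); rewrite lerD2l ler_wpM2r//.
Qed.

(** Off the spectrum one alternative holds, but not yet which one. If [growing] held below [lm], it
    would hold at [lm] by monotonicity, although [lm] is in the spectrum. *)
Lemma decayingP l : decaying l <-> l < lm.
Proof.
split=> [dl|ll].
  rewrite ltNge; apply/negP => lml.
  have /spectrumP : decaying lm \/ growing lm by left; exact: decaying_mono lml dl.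
  by apply; rewrite lexx ltW.
have : decaying l \/ growing l by apply/spectrumP => /andP[]; rewrite leNgt ll.
case=> // gl; have /spectrumP : decaying lm \/ growing lm by right; exact: growing_mono (ltW ll) gl.
by case; rewrite lexx ltW.
Qed.

Lemma growingP l : growing l <-> lq < l.
Proof.
split=> [gl|ll].
  rewrite ltNge; apply/negP => lql.
  have /spectrumP : decaying lq \/ growing lq by right; exact: growing_mono lql gl.
  by apply; rewrite lexx ltW.
have : decaying l \/ growing l by apply/spectrumP => /andP[_]; rewrite leNgt ll.
case=> // dl; have /spectrumP : decaying lq \/ growing lq by left; exact: decaying_mono (ltW ll) dl.
by case; rewrite lexx ltW.
Qed.

(** Raising the parameter from [l] to [lq] would add the linear gain [(lq - l) t], putting [lq]
    outside the spectrum. *)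
Lemma bounded_below_ge l C : (forall w t, 0 <= t -> - C <= orbint w t + l * t) -> lq <= l.
Proof.
move=> h; rewrite leNgt; apply/negP => ll.
have : growing lq.
  exists C, (lq - l); split; first by rewrite subr_gt0.
  by move=> w t t0; have := h w t t0; lra.
by move/growingP; rewrite ltxx.
Qed.

Lemma averaged_lower_bound l : lq < l -> exists2 T : R, 0 < T &
  exists2 d : R, 0 < d & forall w, d <= orbint w T / T + l.
Proof.
move=> /growingP [C [d [d0 h]]].
(* Then [d T / 2 = |C| + 1] absorbs the constant [C]. *)
pose T := 2 * (`|C| + 1) / d.
have T0 : 0 < T by rewrite divr_gt0// mulr_gt0// ltr_wpDl.
exists T => //; exists (d / 2); first by rewrite divr_gt0.
move=> w; have := h w T (ltW T0).
have -> : d * T = 2 * (`|C| + 1) by rewrite /T mulrC divfK// gt_eqF.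
move=> hT; rewrite -lerBlDr ler_pdivlMr//.
have : d / 2 * T = `|C| + 1 by rewrite /T; field; rewrite gt_eqF.
by have := ler_norm C; lra.
Qed.

End orbit_integral.

(** * Hyperbolic contraction *)

Section contraction.
Context {R : realType}.

(* [d^2 exp (- 2 N + c t)] is nonincreasing as long as [d] is small. *)
Lemma contraction (d q N dN : R -> R) (eta k c : R) : 0 < c -> 0 < eta -> 1 <= k ->
  (forall t, 0 <= t -> {for t, continuous d}) ->
  (forall t : R, 0 <= t -> `|d t| < eta -> is_derive t 1 d (q t * d t)) ->
  (forall t, 0 <= t -> `|d t| < eta -> q t + c / 2 <= dN t) ->
  (forall t : R, 0 <= t -> is_derive t 1 N (dN t)) ->
  (forall t, 0 <= t -> expR (N t - N 0) <= k) ->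
  `|d 0| < eta / k ->
  forall t, 0 <= t -> `|d t| < eta /\ `|d t| <= k * expR (- (c / 2) * t) * `|d 0|.
Proof.
move=> c0 eta0 k1 cd dd qN dN' Nk d0.
have k0 : 0 < k by lra.
have key t : 0 <= t -> (forall s, 0 <= s < t -> `|d s| < eta) ->
    `|d t| <= k * expR (- (c / 2) * t) * `|d 0|.
  move=> t0 Hs.
  pose u s := - (d s * d s * expR (- 2 * N s + c * s)).
  pose du s := d s * d s * (2 * (dN s - q s) - c) * expR (- 2 * N s + c * s).
  have : u 0 <= u t.
    apply: (@drv_le _ u du) => [//|s /andP[s0 st]|s /andP[s0 st]].
      have ds : `|d s| < eta by apply: Hs; rewrite (ltW s0).
      have d1 := dd s (ltW s0) ds.
      split.
        have := drvN (drvM (drvM d1 d1) (drv_expR (drvD (drvM (drvc (- 2) s) (dN' s (ltW s0))) (drvM (drvc c s) (drvid s))))).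
        by move/drv_eq; apply; rewrite /du; ring.
      rewrite /du; apply: mulr_ge0; last exact: expR_ge0.
      apply: mulr_ge0; first by rewrite -expr2 sqr_ge0.
      by have := qN s (ltW s0) ds; lra.
    have cE : {for s, continuous (fun s => expR (- 2 * N s + c * s))}.
      exact: drv_continuous (drv_expR (drvD (drvM (drvc (- 2) s) (dN' s s0)) (drvM (drvc c s) (drvid s)))).
    apply: cvgN; apply: cvgM cE; apply: cvgM; exact: cd.
  rewrite /u mulr0 addr0 lerN2 => H.
  have E0 := expR_gt0 (- 2 * N t + c * t).
  have {}H : d t * d t <= (d 0 * d 0) * (expR (N t - N 0) * expR (- (c / 2) * t)) ^+ 2.
    rewrite -(ler_pM2r E0); apply: le_trans H _.
    rewrite -[leRHS]mulrA -expRD -expRM_natl -expRD.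
    by rewrite le_eqVlt; apply/orP; left; apply/eqP; congr (_ * expR _); lra.
  have e0 := expR_gt0 (- (c / 2) * t).
  rewrite -ler_sqr ?nnegrE ?mulr_ge0 ?expR_ge0 ?(ltW k0)//.
  rewrite real_normK ?num_real// [leLHS]expr2; apply: le_trans H _.
  have -> : (k * expR (- (c / 2) * t) * `|d 0|) ^+ 2 = d 0 * d 0 * (k * expR (- (c / 2) * t)) ^+ 2.
    by rewrite [LHS]exprMn real_normK ?num_real// mulrC [d 0 ^+ 2]expr2.
  rewrite ler_wpM2l -?[d 0 * d 0]expr2 ?sqr_ge0//.
  rewrite ler_sqr ?nnegrE ?mulr_ge0 ?expR_ge0 ?(ltW k0)//.
  by rewrite ler_pM2r// Nk.
have small t : 0 <= t -> k * expR (- (c / 2) * t) * `|d 0| < eta.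
  move=> t0; apply: (@le_lt_trans _ _ (k * `|d 0|)).
    rewrite ler_wpM2r// -[leRHS]mulr1 ler_wpM2l ?(ltW k0)//.
    by rewrite -[leRHS]expR0 ler_expR mulNr oppr_le0 mulr_ge0//; lra.
  by rewrite mulrC -ltr_pdivlMr.
have bound t : 0 <= t -> 0 < eta - `|d t|.
  move: t; apply: bootstrap => [t t0|t t0 Hs].
    apply: cvgB; first exact: cvg_cst.
    exact: (@continuous_comp _ _ _ d (fun x => `|x|) t (cd t t0) (@norm_continuous _ R _)).
  rewrite subr_gt0; apply: le_lt_trans (small t t0).
  by apply: key => // s st; have := Hs s st; rewrite subr_gt0.
move=> t t0; split; first by have := bound t t0; rewrite subr_gt0.
by apply: key => // s /andP[s0 _]; have := bound s s0; rewrite subr_gt0.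
Qed.

(** If [d] were below [rho] at a very early time, contraction up to time [0] would bring it under
    [d 0]. The [- 1] in the choice of [s0] makes this strict. *)
Lemma contraction_away (d : R -> R) (rho k c : R) : 0 < c -> 1 <= k -> 0 < rho ->
  (forall s t, 0 <= t -> d s < rho -> d (s + t) <= k * expR (- c * t) * rho) ->
  0 < d 0 -> exists2 s0, s0 <= 0 & forall s, s <= s0 -> rho <= d s.
Proof.
move=> c0 k1 rho0 hd d0.
pose s0 := Num.min 0 (ln (d 0 / (k * rho)) / c - 1).
have kr : 0 < k * rho by rewrite mulr_gt0//; lra.
exists s0; first by rewrite ge_min lexx.
move=> s ss0; rewrite leNgt; apply/negP => ds.
have s0' : s <= 0 by apply: le_trans ss0 _; rewrite ge_min lexx.
have := hd s (- s); rewrite subrr oppr_ge0 => /(_ s0' ds).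
apply/negP; rewrite -ltNge mulrAC -ltr_pdivlMl// mulrC [_ * d 0]mulrC.
rewrite -[ltRHS]lnK ?posrE ?divr_gt0// ltr_expR mulrNN mulrC -ltr_pdivlMr//.
have : s0 <= ln (d 0 / (k * rho)) / c - 1 by rewrite ge_min lexx orbT.
by rewrite [_^-1 * _]mulrC; lra.
Qed.

End contraction.

Section near_contraction.
Context {R : realType} {Omega : pmetricType R}.
Hypothesis cptOmega : compact [set: Omega].
Variables p1 p2 p3 : Omega -> R.
Hypothesis c1 : continuous p1.
Hypothesis c2 : continuous p2.
Hypothesis c3 : continuous p3.

Lemma quot_near (K : R) : exists2 C : R, 0 < C & forall w x y,
  `|y| <= K -> `|x - y| < 1 -> `|quot p1 p2 p3 w x y - quot p1 p2 p3 w y y| <= C * `|x - y|.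
Proof.
have [B B1 HB] := coef_bound cptOmega c1 c2 c3.
exists (B * (3 * `|K| + 2)); first by apply: mulr_gt0; [lra|have := normr_ge0 K; lra].
move=> w x y yK xy; have [_ b2 b3] := HB w.
have -> : quot p1 p2 p3 w x y - quot p1 p2 p3 w y y = (- p3 w * (x - y + 3 * y) + p2 w) * (x - y).
  by rewrite /quot; ring.
rewrite normrM ler_wpM2r//.
apply: le_trans (ler_normD _ _) _; rewrite normrM normrN.
have : `|x - y + 3 * y| <= 1 + 3 * `|K|.
  apply: le_trans (ler_normD _ _) _; rewrite normrM (ger0_norm (ler0n _ 3)).
  by have := ler_norm K; lra.
have B0 : 0 <= `|p3 w| by [].
move=> h; have : `|p3 w| * `|x - y + 3 * y| <= B * (1 + 3 * `|K|) by rewrite ler_pM.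
lra.
Qed.

(** The linearised coefficient along [y] may be positive at times, but it is at most [N' - c] for a
    correction [N] whose growth is bounded through [k]. Half of [c] absorbs the nonlinear error. The
    flow is quantified inside so that reversed time is covered, and [v] need solve the equation only
    while close to [y], as a truncated solution does. *)
Lemma near_contraction (K c k : R) : 0 < c -> 1 <= k -> exists2 rho : R, 0 < rho &
  forall (sigma : R -> Omega -> Omega) w (y v N dN : R -> R),
  (forall t : R, 0 <= t -> is_derive t 1 y (cub p1 p2 p3 (sigma t w) (y t))) ->
  (forall t, 0 <= t -> `|y t| <= K) ->
  (forall t, 0 <= t -> {for t, continuous v}) ->
  (forall t : R, 0 <= t -> `|v t - y t| < 1 -> is_derive t 1 v (cub p1 p2 p3 (sigma t w) (v t))) ->
  (forall t : R, 0 <= t -> is_derive t 1 N (dN t)) ->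
  (forall t, 0 <= t -> quot p1 p2 p3 (sigma t w) (y t) (y t) + c <= dN t) ->
  (forall t, 0 <= t -> expR (N t - N 0) <= k) ->
  `|v 0 - y 0| < rho -> forall t, 0 <= t ->
  `|v t - y t| < 1 /\ `|v t - y t| <= k * expR (- (c / 2) * t) * `|v 0 - y 0|.
Proof.
move=> c0 k1; have [C C0 HC] := quot_near K.
pose eta := Num.min 1 (c / (2 * C)).
have eta0 : 0 < eta by rewrite lt_min ltr01 divr_gt0// mulr_gt0.
have eta1 : eta <= 1 by rewrite ge_min lexx.
have etaC : C * eta <= c / 2.
  apply: (@le_trans _ _ (C * (c / (2 * C)))).
    by rewrite ler_wpM2l ?(ltW C0)// ge_min lexx orbT.
  by rewrite le_eqVlt; apply/orP; left; apply/eqP; field; rewrite gt_eqF.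
exists (eta / k); first by rewrite divr_gt0//; lra.
move=> sigma w y v N dN yd yK cv vd dN' hN Nk d0 t t0.
have [] := @contraction R (fun t => v t - y t) (fun t => quot p1 p2 p3 (sigma t w) (v t) (y t)) N dN
  eta k c c0 eta0 k1 _ _ _ dN' Nk d0 t t0.
- move=> s s0; apply: cvgB; first exact: cv.
  exact: drv_continuous (yd s s0).
- move=> s s0 ds; rewrite -cubB; apply: drvB (yd s s0); apply: vd => //; lra.
- move=> s s0 ds; have := hN s s0.
  have ds1 : `|v s - y s| < 1 by lra.
  have := HC (sigma s w) (v s) (y s) (yK s s0) ds1.
  have : C * `|v s - y s| <= C * eta by rewrite ler_wpM2l ?ltW.
  move=> h1 h2; have := le_trans (ler_norm _) h2; lra.
by move=> h1 h2; split => //; lra.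
Qed.

End near_contraction.

(** * The upper bounded equilibrium *)

(* The growth rate along [y] expressed by logarithmic derivatives of two positive solutions;
   concavity of the divided difference enters through [c * y * (y - x)]. *)
Lemma variational_rate (K : fieldType) (A A1 b c x y : K) : x != 0 -> y != 0 -> y - x != 0 ->
  y * (A + b * y - c * y ^+ 2) / y +
  (y * (A + b * y - c * y ^+ 2) - x * (A1 + b * x - c * x ^+ 2)) / (y - x) -
  x * (A1 + b * x - c * x ^+ 2) / x =
  - c * (y ^+ 2 + y * y + y ^+ 2) + b * (y + y) + A + (A - A1) * (y / (y - x)) + c * y * (y - x).
Proof. by move=> x0 y0 yx0; field; rewrite x0 y0 yx0. Qed.

(** This is the logarithmic derivative of [(y - x) / (x y) = 1/x - 1/y]: the coefficient [b]
    cancels, leaving the linear rate and, for positive data, a term of definite sign. *)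
Lemma linear_rate (K : fieldType) (A b c x y : K) : x != 0 -> y != 0 -> y - x != 0 ->
  (y * (A + b * y - c * y ^+ 2) - x * (A + b * x - c * x ^+ 2)) / (y - x) -
  x * (A + b * x - c * x ^+ 2) / x - y * (A + b * y - c * y ^+ 2) / y =
  - A - c * x * y.
Proof. by move=> x0 y0 yx0; field; rewrite x0 y0 yx0. Qed.

Section upper_theory.
Context {R : realType} {Omega : pmetricType R}.
Variable sigma : R -> Omega -> Omega.
Hypothesis cptOmega : compact [set: Omega].
Hypothesis flow_sigma : continuous_flow sigma.
Hypothesis min_sigma : minimal_flow sigma.
Variables a1 a2 a3 : Omega -> R.
Hypothesis ca1 : continuous a1.
Hypothesis ca2 : continuous a2.
Hypothesis ca3 : continuous a3.
Hypothesis a3_gt0 : forall w, 0 < a3 w.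
Variables lm lq : R.
Hypothesis lmq : lm < lq.
Hypothesis sp_a1 : sacker_sell_spectrum sigma a1 = [set` `[- lq, - lm]].

Let p1 (l : R) w := a1 w + l.

Lemma shifted_continuous l : continuous (p1 l).
Proof. by move=> w; apply: cvgD; [exact: ca1|exact: cvg_cst]. Qed.

Variable rad : R -> R.
Hypothesis rad_dissip : forall l, dissip (p1 l) a2 a3 (rad l).

Local Notation fld l := (cub (p1 l) a2 a3).
Local Notation sol l := (sol sigma (p1 l) a2 a3).
Local Notation J := (orbint sigma a1).

Definition beta l : Omega -> R :=
  upper cptOmega flow_sigma (@shifted_continuous l) ca2 ca3 (rad l).

Lemma beta_sol l w : sol l w (fun t => beta l (sigma t w)).
Proof. exact: upper_sol. Qed.

Lemma beta_max l w K (v dv : R -> R) : (forall t, `|v t| <= K) ->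
  (forall t : R, is_derive t 1 v (dv t)) ->
  (forall t : R, dv t <= fld l (sigma t w) (v t)) -> v 0 <= beta l w.
Proof. exact: subsolution_le_upper. Qed.

Lemma sol_le_beta l w K (v : R -> R) : sol l w v -> (forall t, `|v t| <= K) ->
  forall t, v t <= beta l (sigma t w).
Proof.
move=> sv vK t; rewrite -[t in v t]addr0.
apply: (@beta_max l (sigma t w) K (fun s => v (t + s)) (fun s => fld l (sigma (t + s) w) (v (t + s)))) => //.
- by move=> s; apply: drv_shift; exact: sv.
- by move=> s; rewrite -flowD.
Qed.

Lemma beta_ge0 l w : 0 <= beta l w.
Proof.
by apply: (@beta_max l w 0 (fun=> 0) (fun=> 0)) => t; rewrite ?normr0 ?cub0.
Qed.

Lemma beta_le_rad l w : beta l w <= rad l.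
Proof.
have := upper_bounds cptOmega flow_sigma (@shifted_continuous l) ca2 ca3 (rad_dissip l) w.
by case/andP.
Qed.

Lemma beta_norm l w : `|beta l w| <= rad l.
Proof. by rewrite ger0_norm ?beta_ge0// beta_le_rad. Qed.

(** Upper semicontinuity, obtained by feeding [beta] itself into [upper_attracts]. *)
Lemma beta_near l w (e : R) : 0 < e -> \forall w' \near w, beta l w' <= beta l w + e.
Proof.
move=> e0.
have [T T0] := upper_attracts cptOmega flow_sigma (@shifted_continuous l) ca2 ca3 (rad_dissip l) w e0.
apply: filterS => w' /(_ T (fun t => beta l (sigma t (sigma (- T) w')))).
rewrite flowNK//; apply => //; last exact: beta_norm.
by move=> t _; exact: beta_sol.
Qed.

Lemma beta_superlevel_closed l c : closed [set w | c <= beta l w].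
Proof.
rewrite -[X in closed X]setCK; apply: open_closedC; rewrite openE => w /= /negP.
rewrite -ltNge => cw.
have e0 : 0 < (c - beta l w) / 2 by lra.
have := beta_near l w e0; apply: filterS => w' h /= cw'.
lra.
Qed.

(** Being nonnegative, [beta l] is a subsolution for every larger parameter, and [beta l'] dominates
    bounded subsolutions. *)
Lemma beta_mono l l' w : l <= l' -> beta l w <= beta l' w.
Proof.
move=> ll'; have := @beta_max l' w (rad l) (fun t => beta l (sigma t w)) (fun t => fld l (sigma t w) (beta l (sigma t w))).
rewrite flow0//; apply.
- by move=> t; exact: beta_norm.
- by move=> t; exact: beta_sol.
- move=> t; rewrite /cub /p1 lerD2l ler_wpM2r ?beta_ge0//; lra.
Qed.

Definition persistent l := exists2 d, 0 < d & forall w, d <= beta l w.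

(** By maximality [beta l >= d] on one backward half-orbit; the superlevel set is closed, so the
    bound spreads to all of [Omega]. *)
Lemma half_orbit_persistent l w (v : R -> R) K d : sol l w v -> (forall t, `|v t| <= K) ->
  0 < d -> (forall t, t <= 0 -> d <= v t) -> persistent l.
Proof.
move=> sv vK d0 dv; exists d => //.
apply: (half_orbit_full cptOmega flow_sigma min_sigma (w := w) (@beta_superlevel_closed l d)) => t t0 /=.
by apply: le_trans (sol_le_beta sv vK t); exact: dv.
Qed.

Lemma persistent_mono l l' : l <= l' -> persistent l -> persistent l'.
Proof.
by move=> ll' [d d0 h]; exists d => // w; apply: le_trans (h w) _; exact: beta_mono.
Qed.

Lemma cub_factor l w x : fld l w x = x * (a1 w + l + a2 w * x - a3 w * x ^+ 2).
Proof. by rewrite /cub /p1; ring. Qed.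

Lemma subsolution_persistent l (g g1 : Omega -> R) (e G : R) : 0 < e ->
  (forall w, `|g w| <= G) ->
  (forall w (t : R), is_derive t 1 (fun t => g (sigma t w)) (g1 (sigma t w))) ->
  (forall w, g1 w <= a1 w + l + a2 w * (e * expR (g w)) - a3 w * (e * expR (g w)) ^+ 2) ->
  persistent l.
Proof.
move=> e0 gG dg hg.
have lb w : e * expR (- G) <= e * expR (g w).
  by rewrite ler_pM2l// ler_expR; have := gG w; rewrite ler_norml => /andP[].
have p0 : 0 < e * expR (- G) by rewrite mulr_gt0// expR_gt0.
exists (e * expR (- G)) => // w.
apply: le_trans (lb w) _.
rewrite -{1}(flow0 flow_sigma w).
apply: (@beta_max l w (e * expR G) (fun t => e * expR (g (sigma t w)))
  (fun t => e * expR (g (sigma t w)) * g1 (sigma t w))).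
- move=> t; rewrite ger0_norm; last by apply: le_trans (ltW p0) (lb _).
  by rewrite ler_pM2l// ler_expR; have := gG (sigma t w); rewrite ler_norml => /andP[].
- move=> t; have := drvM (drvc e t) (drv_expR (dg w t)).
  by move/drv_eq; apply; ring.
- move=> t; rewrite cub_factor ler_wpM2l//.
  exact: le_trans (ltW p0) (lb _).
Qed.

(** [ln (beta l)] is bounded, and its derivative along orbits is at most [a1 + l + h]; integrate. *)
Lemma persistent_lower_bound l d h : 0 < d -> (forall w, d <= beta l w) ->
  (forall w x, d <= x -> a2 w * x - a3 w * x ^+ 2 <= h) ->
  exists C, forall w t, 0 <= t -> - C <= J w t + (l + h) * t.
Proof.
move=> d0 hd hh.
exists (ln (rad l) - ln d) => w t t0.
have b0 s : 0 < beta l (sigma s w) by apply: lt_le_trans d0 (hd _).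
pose u s := J w s + (l + h) * s - ln (beta l (sigma s w)).
have : u 0 <= u t.
  pose du s := a1 (sigma s w) + (l + h) - fld l (sigma s w) (beta l (sigma s w)) / beta l (sigma s w).
  apply: (@drv_nondecreasing _ u du) => [//|s _|s _].
    have := drvB (drvD (drv_orbint flow_sigma ca1 w s) (drvM (drvc (l + h) s) (drvid s))) (@drv_ln _ (fun s => beta l (sigma s w)) s _ (b0 s) (beta_sol l w s)).
    by move/drv_eq; apply; rewrite /du; ring.
  rewrite /du cub_factor mulrC mulKf ?gt_eqF//.
  by have := hh (sigma s w) _ (hd (sigma s w)); lra.
rewrite /u orbint0 mulr0 addr0 add0r.
have : ln (beta l (sigma 0 w)) <= ln (rad l).
  by rewrite ler_ln ?posrE ?beta_le_rad//; apply: lt_le_trans (beta_le_rad l w); rewrite -(flow0 flow_sigma w).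
have : ln d <= ln (beta l (sigma t w)) by rewrite ler_ln ?posrE.
lra.
Qed.

Lemma separation l1 l2 : l1 < l2 -> persistent l1 -> exists2 m, 0 < m &
  forall w, beta l1 w + m <= beta l2 w.
Proof.
move=> l12 [d d0 hd].
have [L L0 HL] := quot_bound cptOmega (@shifted_continuous l2) ca2 ca3 (Num.max (rad l1) (rad l2)).
(* The gap satisfies [z' >= - L z + (l2 - l1) d]; integrating over the unit of time before [0]
   yields this [m]. *)
pose m := (l2 - l1) * d * expR (- L).
have m0 : 0 < m by rewrite !mulr_gt0 ?expR_gt0//; lra.
exists m => // w.
pose z s := beta l2 (sigma s w) - beta l1 (sigma s w).
pose dz s := fld l2 (sigma s w) (beta l2 (sigma s w)) - fld l1 (sigma s w) (beta l1 (sigma s w)).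
have zd (s : R) : is_derive s 1 z (dz s) by exact: drvB (beta_sol l2 w s) (beta_sol l1 w s).
have z0 s : 0 <= z s by rewrite subr_ge0 beta_mono// ltW.
pose u s := z s * expR (L * s) - m * s.
have : u (-1) <= u 0.
  apply: (@drv_nondecreasing _ u (fun s => (dz s + L * z s) * expR (L * s) - m)) => [|s _|s /andP[s1 s0]].
  - lra.
  - by have := drvB (weight_drv L (zd s)) (drvM (drvc m s) (drvid s)); move/drv_eq; apply; ring.
  - rewrite subr_ge0 /m ler_pM ?expR_ge0// ?mulr_ge0 ?(ltW d0)//; [lra| |].
      have -> : dz s = quot (p1 l2) a2 a3 (sigma s w) (beta l2 (sigma s w)) (beta l1 (sigma s w)) * z s
          + (l2 - l1) * beta l1 (sigma s w).
        by rewrite /dz /z -cubB /cub /p1; ring.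
      have := HL (sigma s w) (beta l2 (sigma s w)) (beta l1 (sigma s w)).
      rewrite !le_max !beta_norm orbT => /(_ isT isT); rewrite ler_norml => /andP[hq _].
      have : - L * z s <= quot (p1 l2) a2 a3 (sigma s w) (beta l2 (sigma s w)) (beta l1 (sigma s w)) * z s.
        by rewrite ler_wpM2r.
      have : (l2 - l1) * d <= (l2 - l1) * beta l1 (sigma s w) by rewrite ler_wpM2l//; lra.
      lra.
    by rewrite ler_expR; nra.
have -> : u (-1) = z (-1) * expR (- L) + m by rewrite /u !mulrN1 opprK.
have -> : u 0 = beta l2 w - beta l1 w by rewrite /u /z !mulr0 expR0 mulr1 subr0 flow0.
have : 0 <= z (-1) * expR (- L) by rewrite mulr_ge0 ?expR_ge0.
lra.
Qed.

(** With [x = beta l1] and [y = beta l], the correction is [N = ln y + ln (y - x) - ln x]. By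
    [variational_rate], [N'] exceeds the linearised coefficient by at least [a3 y (y - x) >= c];
    persistence and separation keep [N] bounded. *)
Lemma beta_attracts l1 l : l1 < l -> persistent l1 -> exists rho k c : R,
  [/\ 0 < rho, 1 <= k, 0 < c & forall w (v : R -> R),
  (forall t : R, 0 <= t -> is_derive t 1 v (fld l (sigma t w) (v t))) ->
  `|v 0 - beta l w| < rho -> forall t, 0 <= t ->
  `|v t - beta l (sigma t w)| <= k * expR (- c * t) * `|v 0 - beta l w|].
Proof.
move=> l1l hp; have [m m0 hm] := separation l1l hp; have [d d0 hd] := hp.
have [c3 c30 hc3] := positive_below cptOmega ca3 a3_gt0.
pose K := rad l.
have K1 : 1 <= K by have [] := rad_dissip l.
pose c := c3 * d * m.
have c0 : 0 < c by rewrite !mulr_gt0.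
pose k := expR (`|2 * ln K - ln d - (ln d + ln m - ln K)|).
have k1 : 1 <= k by rewrite -[leLHS]expR0 ler_expR.
have [rho rho0 hrho] := near_contraction cptOmega (@shifted_continuous l) ca2 ca3 K c0 k1.
exists rho, k, (c / 2); split => //; first by rewrite divr_gt0.
move=> w v vd v0 t t0.
pose x s := beta l1 (sigma s w); pose y s := beta l (sigma s w).
have xd s : d <= x s by exact: hd.
have xy s : x s + m <= y s by exact: hm.
have yK s : y s <= K by exact: beta_le_rad.
have x0 s : 0 < x s by have := xd s; lra.
have y0 s : 0 < y s by have := xy s; have := x0 s; lra.
have yx0 s : 0 < y s - x s by have := xy s; lra.
pose N s := ln (y s) + ln (y s - x s) - ln (x s).
pose dN s := fld l (sigma s w) (y s) / y s +
  (fld l (sigma s w) (y s) - fld l1 (sigma s w) (x s)) / (y s - x s) -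
  fld l1 (sigma s w) (x s) / x s.
have Nd (s : R) : is_derive s 1 N (dN s).
  have hy : is_derive s 1 y (fld l (sigma s w) (y s)) by exact: beta_sol.
  have hx : is_derive s 1 x (fld l1 (sigma s w) (x s)) by exact: beta_sol.
  exact: (drvB (drvD (@drv_ln _ y s _ (y0 s) hy) (@drv_ln _ (fun s => y s - x s) s _ (yx0 s) (drvB hy hx))) (@drv_ln _ x s _ (x0 s) hx)).
have Nu s : N s <= 2 * ln K - ln d.
  have h1 : ln (y s) <= ln K by rewrite ler_ln ?posrE//; lra.
  have h2 : ln (y s - x s) <= ln K.
    by rewrite ler_ln ?posrE//; [have := yK s; have := x0 s; lra|lra].
  have h3 : ln d <= ln (x s) by rewrite ler_ln ?posrE.
  by rewrite /N; lra.
have Nl s : ln d + ln m - ln K <= N s.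
  have h1 : ln d <= ln (y s) by rewrite ler_ln ?posrE//; have := xy s; have := xd s; lra.
  have h2 : ln m <= ln (y s - x s) by rewrite ler_ln ?posrE//; have := xy s; lra.
  have h3 : ln (x s) <= ln K.
    by rewrite ler_ln ?posrE//; [have := yK s; have := xy s; lra|lra].
  by rewrite /N; lra.
have yE : y 0 = beta l w by rewrite /y flow0.
have h1 (s : R) : 0 <= s -> is_derive s 1 y (fld l (sigma s w) (y s)) by move=> _; exact: beta_sol.
have h2 (s : R) : 0 <= s -> `|y s| <= K by move=> _; exact: beta_norm.
have h3 (s : R) : 0 <= s -> {for s, continuous v} by move=> s0; exact: drv_continuous (vd s s0).
have h4 (s : R) : 0 <= s -> `|v s - y s| < 1 -> is_derive s 1 v (fld l (sigma s w) (v s)).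
  by move=> s0 _; exact: vd.
have h5 (s : R) : 0 <= s -> is_derive s 1 N (dN s) by [].
have h6 (s : R) : 0 <= s -> quot (p1 l) a2 a3 (sigma s w) (y s) (y s) + c <= dN s.
  move=> _; have -> : dN s = quot (p1 l) a2 a3 (sigma s w) (y s) (y s) + (l - l1) * (y s / (y s - x s)) +
      a3 (sigma s w) * y s * (y s - x s).
    rewrite /dN !cub_factor variational_rate ?gt_eqF// /quot /p1.
    by congr (_ + _ * _ + _); ring.
  have g1 : 0 <= (l - l1) * (y s / (y s - x s)).
    by rewrite mulr_ge0 ?divr_ge0 ?ltW//; lra.
  have g2 : c <= a3 (sigma s w) * y s * (y s - x s).
    rewrite /c ler_pM ?mulr_ge0 ?(ltW c30) ?(ltW d0) ?(ltW m0)//; last by have := xy s; lra.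
    rewrite ler_pM ?(ltW c30) ?(ltW d0)//.
    by have := xd s; have := xy s; lra.
  lra.
have h7 (s : R) : 0 <= s -> expR (N s - N 0) <= k.
  move=> _; rewrite ler_expR; apply: le_trans (ler_norm _).
  by have := Nu s; have := Nl 0; lra.
have := hrho sigma w y v N dN h1 h2 h3 h4 h5 h6 h7.
by rewrite yE => /(_ v0 t t0) [].
Qed.

(** If [v 0 < beta l w], attraction keeps the gap at least [rho] in the remote past. There
    [1/v - 1/beta] lies between positive constants, and [linear_rate] shows that the integrals of
    [a1 + l] decay linearly. By minimality this decay holds over all of [Omega], so [l < lm]. *)
Lemma positive_sol_unique l1 l w (v : R -> R) d K : l1 < l -> persistent l1 -> lm <= l ->
  sol l w v -> 0 < d -> (forall t, d <= v t) -> (forall t, `|v t| <= K) -> v 0 = beta l w.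
Proof.
move=> l1l hp lml sv d0 dv vK.
have [rho [k [c [rho0 k1 c0 attr]]]] := beta_attracts l1l hp.
have vb t : v t <= beta l (sigma t w) by exact: sol_le_beta sv vK t.
pose y s := beta l (sigma s w); pose gap s := y s - v s.
have gap0 s : 0 <= gap s by rewrite subr_ge0 vb.
have vE s : `|v s - y s| = gap s by rewrite distrC (ger0_norm (gap0 s)).
have y0E : y 0 = beta l w by rewrite /y flow0.
apply/eqP; rewrite eq_le -{1}y0E vb/= leNgt; apply/negP => v0.
have [] := @contraction_away _ gap rho k c c0 k1 rho0.
- move=> s t t0 gs.
  have := attr (sigma s w) (fun t => v (s + t)).
  rewrite addr0 vE => /(_ _ gs t t0); rewrite -flowD// vE => h.
  apply: le_trans (h _) _.
    by move=> u _; rewrite -flowD//; apply: drv_shift; exact: sv.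
  by rewrite ler_wpM2l ?(ltW gs)// mulr_ge0 ?expR_ge0//; lra.
- by rewrite /gap y0E subr_gt0.
move=> s0 s00 hs0.
have [c3 c30 hc3] := positive_below cptOmega ca3 a3_gt0.
pose M := rad l; pose C := (ln M - 2 * ln d) - (ln rho - 2 * ln M).
have v0' s : 0 < v s by have := dv s; lra.
have yM s : y s <= M by exact: beta_le_rad.
have y0 s : 0 < y s by have := gap0 s; have := v0' s; rewrite /gap; lra.
pose H s := ln (gap s) - ln (v s) - ln (y s).
have key s t : 0 <= t -> s + t <= s0 -> J (sigma s w) t + l * t <= C - (c3 * d * d) * t.
  move=> t0 sts0.
  pose u r := - (J (sigma s w) r + l * r + H (s + r) + (c3 * d * d) * r).
  pose du r := a3 (sigma (s + r) w) * v (s + r) * y (s + r) - c3 * d * d.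
  have : u 0 <= u t.
    apply: (@drv_nondecreasing _ u du) => [//|r /andP[r0 rt]|r _]; last first.
      rewrite subr_ge0 ler_pM ?mulr_ge0 ?(ltW c30) ?(ltW d0)//; last first.
        by have := dv (s + r); have := gap0 (s + r); rewrite /gap; lra.
      by rewrite ler_pM ?(ltW c30) ?(ltW d0).
    have g0 : 0 < gap (s + r) by apply: lt_le_trans rho0 (hs0 _ _); lra.
    have hv : is_derive (s + r) 1 v (fld l (sigma (s + r) w) (v (s + r))) by exact: sv.
    have hy : is_derive (s + r) 1 y (fld l (sigma (s + r) w) (y (s + r))) by exact: beta_sol.
    have hH := drv_shift (drvB (drvB (@drv_ln _ gap _ _ g0 (drvB hy hv)) (@drv_ln _ v _ _ (v0' _) hv)) (@drv_ln _ y _ _ (y0 _) hy)).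
    have := drvN (drvD (drvD (drvD (drv_orbint flow_sigma ca1 (sigma s w) r) (drvM (drvc l r) (drvid r))) hH) (drvM (drvc (c3 * d * d) r) (drvid r))).
    move/drv_eq; apply; rewrite -flowD// /du !cub_factor {1}/gap linear_rate ?gt_eqF//.
    by ring.
  rewrite /u orbint0 !mulr0 !addr0 add0r => hu.
  have lgt : ln rho <= ln (gap (s + t)).
    by rewrite ler_ln ?posrE//; [exact: hs0|apply: lt_le_trans rho0 (hs0 _ _)].
  have lgs : ln (gap s) <= ln M.
    rewrite ler_ln ?posrE//; first by have := yM s; have := v0' s; rewrite /gap; lra.
      by apply: lt_le_trans rho0 (hs0 _ _); lra.
    by have := yM s; have := y0 s; lra.
  have lvt : ln (v (s + t)) <= ln M.
    rewrite ler_ln ?posrE//; first by have := yM (s + t); have := gap0 (s + t); rewrite /gap; lra.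
    by have := yM s; have := y0 s; lra.
  have lyt : ln (y (s + t)) <= ln M.
    by rewrite ler_ln ?posrE//; have := yM s; have := y0 s; lra.
  have lvs : ln d <= ln (v s) by rewrite ler_ln ?posrE.
  have lys : ln d <= ln (y s).
    by rewrite ler_ln ?posrE//; have := gap0 s; have := dv s; rewrite /gap; lra.
  by move: hu; rewrite /H /C; lra.
suff : decaying sigma a1 l.
  by move/(decayingP flow_sigma ca1 lmq sp_a1); rewrite ltNge lml.
exists C, (c3 * d * d); split; first by rewrite !mulr_gt0.
move=> w' t t0; move: w'.
(* For fixed [t] the estimate is a closed condition on the base point, known on the half-orbit
   ending at [sigma (s0 - t) w]. *)
apply: (half_orbit_full cptOmega flow_sigma min_sigma (w := sigma (s0 - t) w)
  (S := [set w' | J w' t + l * t <= C - c3 * d * d * t])).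
  rewrite (_ : [set _ | _] = (fun w' => J w' t) @^-1` [set x | x <= C - c3 * d * d * t - l * t]).
    apply: preimage_closed; last exact: closed_le.
    by move=> w' _; exact: orbint_continuous.
  by apply/seteqP; split=> w' /=; lra.
by move=> s s_le0 /=; rewrite -flowD//; apply: key => //; lra.
Qed.

(** At zero the linearised coefficient is [a1 + l], so its own integral plus [d t] serves as the
    correction [N]. *)
Lemma zero_attracts l : l < lm -> exists rho k c : R,
  [/\ 0 < rho, 1 <= k, 0 < c & forall w (v : R -> R),
  (forall t, 0 <= t -> {for t, continuous v}) ->
  (forall t : R, 0 <= t -> `|v t| < 1 -> is_derive t 1 v (fld l (sigma t w) (v t))) ->
  `|v 0| < rho -> forall t, 0 <= t ->
  `|v t| < 1 /\ `|v t| <= k * expR (- c * t) * `|v 0|].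
Proof.
move/(decayingP flow_sigma ca1 lmq sp_a1) => [C [d [d0 hJ]]].
have k1 : 1 <= expR `|C| by rewrite -[leLHS]expR0 ler_expR.
have [rho rho0 hrho] := near_contraction cptOmega (@shifted_continuous l) ca2 ca3 0 d0 k1.
exists rho, (expR `|C|), (d / 2); split => //; first by rewrite divr_gt0.
move=> w v cv vd v0 t t0.
pose N s := J w s + (l + d) * s; pose dN s := a1 (sigma s w) + (l + d).
have h1 (s : R) : 0 <= s -> is_derive s 1 (fun=> 0 : R) (fld l (sigma s w) 0).
  by move=> _; rewrite cub0; exact: drvc.
have h2 (s : R) : 0 <= s -> `|0 : R| <= 0 by rewrite normr0.
have h4 (s : R) : 0 <= s -> `|v s - 0| < 1 -> is_derive s 1 v (fld l (sigma s w) (v s)).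
  by rewrite subr0; exact: vd.
have h5 (s : R) : 0 <= s -> is_derive s 1 N (dN s).
  move=> _; have := drvD (drv_orbint flow_sigma ca1 w s) (drvM (drvc (l + d) s) (drvid s)).
  by move/drv_eq; apply; rewrite /dN; ring.
have h6 (s : R) : 0 <= s -> quot (p1 l) a2 a3 (sigma s w) 0 0 + d <= dN s.
  by move=> _; rewrite /dN /quot /p1; lra.
have h7 (s : R) : 0 <= s -> expR (N s - N 0) <= expR `|C|.
  by move=> s0; rewrite ler_expR /N orbint0; have := hJ w s s0; have := ler_norm C; lra.
have := hrho sigma w (fun=> 0) v N dN h1 h2 cv h4 h5 h6 h7.
by rewrite subr0 => /(_ v0 t t0); rewrite !subr0.
Qed.

(** A positive value cannot come from near zero: attraction of zero forces [beta l >= rho]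
    throughout the remote past, and [half_orbit_persistent] applies. *)
Lemma beta_eq0 l : l < lm -> ~ persistent l -> forall w, beta l w = 0.
Proof.
move=> llm np w; apply/eqP; rewrite eq_le beta_ge0 andbT leNgt; apply/negP => b0.
have [rho [k [c [rho0 k1 c0 attr]]]] := zero_attracts llm.
have [] := @contraction_away _ (fun s => beta l (sigma s w)) rho k c c0 k1 rho0.
- move=> s t t0 bs.
  have bE s' : `|beta l (sigma s' w)| = beta l (sigma s' w) by rewrite ger0_norm// beta_ge0.
  have := attr (sigma s w) (fun t => beta l (sigma (s + t) w)).
  rewrite addr0 !bE => h.
  have sd (u : R) : is_derive u 1 (fun t => beta l (sigma (s + t) w)) (fld l (sigma u (sigma s w)) (beta l (sigma (s + u) w))).
    by rewrite -flowD//; apply: (@drv_shift _ (fun t => beta l (sigma t w))); exact: beta_sol.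
  have g1 (u : R) : 0 <= u -> {for u, continuous (fun t => beta l (sigma (s + t) w))}.
    by move=> _; exact: drv_continuous (sd u).
  have [_] := h g1 (fun u _ _ => sd u) bs t t0; rewrite bE => {}h.
  apply: le_trans h _.
  by rewrite ler_wpM2l ?(ltW bs)// mulr_ge0 ?expR_ge0//; lra.
- by rewrite flow0.
move=> s0 s00 hs0; apply: np.
apply: (@half_orbit_persistent l (sigma s0 w) (fun t => beta l (sigma (s0 + t) w)) (rad l) rho) => //.
- by move=> t; rewrite -flowD//; apply: (@drv_shift _ (fun t => beta l (sigma t w))); exact: beta_sol.
- by move=> t; exact: beta_norm.
- by move=> t t0; apply: hs0; lra.
Qed.

End upper_theory.

(** * Invariant and minimal sets *)

Lemma prod_hausdorff (T U : topologicalType) : hausdorff_space T ->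
  hausdorff_space U -> hausdorff_space (T * U)%type.
Proof.
move=> hT hU [p1 p2] [q1 q2] cl; congr (_, _).
  apply: hT => A B pA qB.
  have [||[x y] [[/= Ax _] [/= Bx _]]] := cl (A `*` setT) (B `*` setT).
  - by exists (A, setT) => //=; split => //; exact: filterT.
  - by exists (B, setT) => //=; split => //; exact: filterT.
  by exists x.
apply: hU => A B pA qB.
have [||[x y] [[/= _ Ay] [/= _ By]]] := cl (setT `*` A) (setT `*` B).
- by exists (setT, A) => //=; split => //; exact: filterT.
- by exists (setT, B) => //=; split => //; exact: filterT.
by exists y.
Qed.

Section invariant_sets.
Context {R : realType} {Omega : pmetricType R}.
Variable sigma : R -> Omega -> Omega.
Hypothesis cptOmega : compact [set: Omega].
Hypothesis flow_sigma : continuous_flow sigma.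
Hypothesis min_sigma : minimal_flow sigma.
Variables p1 p2 p3 : Omega -> R.
Hypothesis c1 : continuous p1.
Hypothesis c2 : continuous p2.
Hypothesis c3 : continuous p3.

Local Notation cub := (cub p1 p2 p3).
Local Notation sol := (sol sigma p1 p2 p3).
Local Notation sol_at := (sol_at sigma cub).
Local Notation tau := (tau sigma cub).

Lemma sol_at0 w x y : sol_at 0 w x y -> y = x.
Proof. by move=> [J [v [[[_ _ _ v0 _] _] _ <-]]]. Qed.

Lemma sol_at_sol w x (v : R -> R) : (forall t, sol_at t w x (v t)) -> sol w v.
Proof.
move=> h t; have [J [u [mu Jt ut]]] := h t.
have [[oJ _ _ _ du] _] := mu.
rewrite -ut; apply: (@near_eq_is_derive _ _ _ u); last exact: du.
have : nbhs t J by exact: open_nbhs_nbhs.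
apply: filterS => s Js; apply: (sol_at_unique cptOmega c1 c2 c3 (t := s) (w := w) (x := x)) (h s).
by exists J, u.
Qed.

Lemma tau_invariant_sol (K : set (Omega * R)) p : tau_invariant sigma cub K -> K p ->
  exists v, [/\ v 0 = p.2, sol p.1 v & forall t, K (sigma t p.1, v t)].
Proof.
move=> [ex im] Kp.
have /(_ _)/cid h t : exists y, sol_at t p.1 p.2 y.
  by have [q [_ sq]] := ex t p Kp; exists q.2.
pose v t := sval (h t).
have hv t : sol_at t p.1 p.2 (v t) by exact: svalP (h t).
exists v; split.
- exact: sol_at0 (hv 0).
- exact: sol_at_sol hv.
- by move=> t; rewrite -(im t); exists p => //; split => //=; exact: hv.
Qed.

(** With [tau_invariant_sol], this trades maximal solutions for complete ones inside [K]. *)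
Lemma invariant_of_sol (K : set (Omega * R)) :
  (forall p, K p -> exists v, [/\ v 0 = p.2, sol p.1 v & forall t, K (sigma t p.1, v t)]) ->
  tau_invariant sigma cub K.
Proof.
move=> h; split.
  move=> t p /h [v [v0 sv Kv]]; exists (sigma t p.1, v t); split => //=.
  by rewrite -v0; exact: sol_sol_at.
move=> t; apply/seteqP; split.
  move=> [q1 q2] [p /h [v [v0 sv Kv]] [/= -> sq]].
  rewrite -v0 in sq.
  by rewrite (sol_at_unique cptOmega c1 c2 c3 sq (sol_sol_at cptOmega c1 c2 c3 t sv)).
move=> q /h [v [v0 sv Kv]]; exists (sigma (- t) q.1, v (- t)) => //; split => /=.
  by rewrite flowNK.
rewrite -v0; have := sol_sol_at cptOmega c1 c2 c3 t (@sol_shift _ _ _ flow_sigma _ _ _ _ _ (- t) sv).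
by rewrite addr0 addNr.
Qed.

Lemma compact_snd_bounded (K : set (Omega * R)) : compact K ->
  exists B, forall p, K p -> `|p.2| <= B.
Proof.
move=> cK.
have : compact (snd @` K).
  by apply: continuous_compact => //; apply: continuous_subspaceT => p; exact: cvg_snd.
move=> /compact_bounded [M [Mr HM]].
exists (`|M| + 1) => p Kp; apply: HM; last by exists p.
by rewrite (le_lt_trans (ler_norm _))// ltrDl.
Qed.

Lemma compact_positive_below (K : set (Omega * R)) : compact K ->
  (forall p, K p -> 0 < p.2) -> exists2 d : R, 0 < d & forall p, K p -> d <= p.2.
Proof.
move=> cK hK.
have cI : compact (snd @` K).
  by apply: continuous_compact => //; apply: continuous_subspaceT => p; exact: cvg_snd.
have cl := compact_closed (@Rhausdorff R) cI.
have : nbhs (0 : R) (~` (snd @` K)).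
  apply: open_nbhs_nbhs; split; first exact: closed_openC.
  by move=> [p Kp /= p0]; have := hK p Kp; rewrite p0 ltxx.
move=> [d /= d0 hd]; exists d => // p Kp; rewrite leNgt; apply/negP => pd.
apply: (hd p.2); last by exists p.
by rewrite /ball/= sub0r normrN gtr0_norm// hK.
Qed.

(** A compact invariant subset projects to a closed set containing an orbit, hence onto [Omega], and
    the graph has a single point in each fibre. *)
Lemma graph_minimal (kappa : Omega -> R) : compact (graph_of kappa) ->
  (forall w, sol w (fun t => kappa (sigma t w))) -> minimal_set sigma cub (graph_of kappa).
Proof.
move=> cG sk; split => //.
- by exists (point, kappa point).
- apply: invariant_of_sol => -[w x]; rewrite {1}/graph_of /= => ->; exists (fun t => kappa (sigma t w)); split => //.
  by rewrite flow0.
move=> K [p Kp] cK iK KG; apply/seteqP; split => // -[w x]; rewrite {1}/graph_of /= => ->.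
have cF : compact (fst @` K).
  by apply: continuous_compact => //; apply: continuous_subspaceT => q; exact: cvg_fst.
have clF : closed (fst @` K) by apply: compact_closed => //; exact: metric_hausdorff.
have [q Kq qw] : (fst @` K) w.
  apply: (closed_orbit_full min_sigma (w := p.1)) clF _ w => t.
  have [v [_ _ Kv]] := tau_invariant_sol iK Kp.
  by exists (sigma t p.1, v t).
by have := KG q Kq; rewrite /graph_of /= -qw => <-; case: q Kq {qw}.
Qed.

Lemma zero_sol w : sol w (fun=> 0).
Proof. by move=> t; rewrite cub0; exact: drvc. Qed.

Lemma zero_minimal : minimal_set sigma cub zero_section.
Proof.
apply: graph_minimal; last by move=> w; exact: zero_sol.
have -> : graph_of (fun=> 0) = (fun w : Omega => (w, 0 : R)) @` [set: Omega].
  apply/seteqP; split => [[w x]|_ [w _ <-]//].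
  by rewrite /graph_of /= => ->; exists w.
apply: continuous_compact => //; apply: continuous_subspaceT.
by apply: pair_cst_continuous => w; exact: cvg_id.
Qed.

Lemma sol_order w (v v' : R -> R) K : sol w v -> sol w v' -> (forall t, `|v t| <= K) ->
  (forall t, `|v' t| <= K) -> v 0 <= v' 0 -> forall t, v t <= v' t.
Proof.
move=> sv sv' vK v'K.
exact: (trunc_sol_order cptOmega c1 c2 c3 (sol_trunc sv vK) (sol_trunc sv' v'K)).
Qed.

(** No bounded solution crosses the zero solution, so the part of [M] in a closed half is invariant
    and equals [M]. The sign [sg] serves both halves. *)
Lemma minimal_half (M : set (Omega * R)) (sg : R) : minimal_set sigma cub M ->
  (forall w, ~ M (w, 0)) -> `|sg| = 1 -> (exists2 p, M p & 0 <= sg * p.2) ->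
  forall p, M p -> 0 < sg * p.2.
Proof.
move=> [M0 cM iM minM] Mn0 sg1 [p Mp hp] q Mq.
pose K := M `&` [set p | 0 <= sg * p.2].
have KM : K = M.
  have [B HB] := compact_snd_bounded cM.
  have B0 : 0 <= B by exact: le_trans (normr_ge0 _) (HB p Mp).
  apply: minM => //; last by move=> ? [].
  - by exists p.
  - apply: (subclosed_compact _ cM); last by move=> ? [].
    apply: closedI; first by apply: compact_closed => //; apply: prod_hausdorff; [exact: metric_hausdorff|exact: Rhausdorff].
    apply: (preimage_closed (f := fun p : Omega * R => sg * p.2) (D := [set x | 0 <= x])); last exact: closed_ge.
    by move=> z _; apply: cvgM; [exact: cvg_cst|exact: cvg_snd].
  - apply: invariant_of_sol => z [Mz hz].
    have [v [v0 sv Mv]] := tau_invariant_sol iM Mz.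
    exists v; split => // t; split => //=.
    have vB s : `|v s| <= B by exact: HB (Mv s).
    have zB (s : R) : `|0 : R| <= B by rewrite normr0.
    move: hz; rewrite /= -v0.
    have [->|->] : sg = 1 \/ sg = -1.
      by move: sg1; case: (ger0P sg) => _ <-; [left|right; rewrite opprK].
      rewrite !mul1r => hz; exact: (sol_order (zero_sol z.1) sv zB vB hz).
    rewrite !mulN1r !oppr_ge0 => hz; exact: (sol_order sv (zero_sol z.1) vB zB hz).
move: (Mq); rewrite -KM => -[_ /= hq].
rewrite lt_neqAle hq andbT; apply/eqP => /esym/eqP; rewrite mulf_eq0 => /orP[/eqP sg0|/eqP q0].
  by move: sg1; rewrite sg0 normr0 => /eqP; rewrite eq_sym oner_eq0.
by apply: (Mn0 q.1); rewrite -q0; case: q Mq {hq q0}.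
Qed.

(** One point of [M] on the zero section brings its orbit, and by closedness the whole section, into
    [M]. *)
Lemma minimal_trichotomy (M : set (Omega * R)) : minimal_set sigma cub M ->
  [\/ M = zero_section, (forall p, M p -> 0 < p.2) | (forall p, M p -> p.2 < 0)].
Proof.
move=> mM; have [M0 cM iM minM] := mM.
have [[w Mw]|Mn0] := pselect (exists w, M (w, 0)).
  apply: Or31.
  have clF : forall w, M (w, 0).
    move=> w'.
    have cN : closed [set w | M (w, 0)].
      apply: (preimage_closed (f := fun w : Omega => (w, 0 : R)) (D := M)).
        by move=> z _; apply: pair_cst_continuous => x; exact: cvg_id.
      by apply: compact_closed => //; apply: prod_hausdorff; [exact: metric_hausdorff|exact: Rhausdorff].
    apply: (closed_orbit_full min_sigma (w := w)) cN _ w' => t /=.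
    have [v [v0 sv Mv]] := tau_invariant_sol iM Mw.
    have [B HB] := compact_snd_bounded cM.
    have B0 : 0 <= B by exact: le_trans (normr_ge0 _) (HB _ Mw).
    have vB s : `|v s| <= B by exact: HB (Mv s).
    have zB (s : R) : `|0 : R| <= B by rewrite normr0.
    have -> : 0 = v t; last exact: Mv.
    apply/eqP; rewrite eq_le; apply/andP; split.
      by apply: (sol_order (zero_sol w) sv zB vB); rewrite v0.
    by apply: (sol_order sv (zero_sol w) vB zB); rewrite v0.
  have [_ cZ iZ _] := zero_minimal.
  apply/esym; apply: minM => //; first by exists (point, 0).
  by move=> [z x]; rewrite /zero_section /graph_of /= => ->.
have {}Mn0 w : ~ M (w, 0) by move=> Mw; apply: Mn0; exists w.
have [[p Mp p0]|np] := pselect (exists2 p, M p & 0 <= p.2).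
  apply: Or32 => q Mq; rewrite -[q.2]mul1r; apply: (minimal_half mM Mn0 (normr1 _)) => //.
  by exists p => //; rewrite mul1r.
apply: Or33 => q Mq; rewrite ltNge; apply/negP => q0; apply: np; by exists q.
Qed.

End invariant_sets.

(** * Hyperbolicity of the upper equilibrium and of zero *)

Section minimal_and_hyperbolic.
Context {R : realType} {Omega : pmetricType R}.
Variable sigma : R -> Omega -> Omega.
Hypothesis cptOmega : compact [set: Omega].
Hypothesis flow_sigma : continuous_flow sigma.
Hypothesis min_sigma : minimal_flow sigma.
Variables a1 a2 a3 : Omega -> R.
Hypothesis ca1 : continuous a1.
Hypothesis ca2 : continuous a2.
Hypothesis ca3 : continuous a3.
Hypothesis a3_gt0 : forall w, 0 < a3 w.
Variables lm lq : R.
Hypothesis lmq : lm < lq.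
Hypothesis sp_a1 : sacker_sell_spectrum sigma a1 = [set` `[- lq, - lm]].
Variable rad : R -> R.
Hypothesis rad_dissip : forall l, dissip (fun w => a1 w + l) a2 a3 (rad l).

Let cp1 l : continuous (fun w => a1 w + l).
Proof. exact: shifted_continuous. Qed.
Local Notation fld l := (cub (fun w => a1 w + l) a2 a3).
Local Notation sol l := (sol sigma (fun w => a1 w + l) a2 a3).
Local Notation J := (orbint sigma a1).
Local Notation beta := (beta cptOmega flow_sigma ca1 ca2 ca3 rad).
Local Notation persistent := (persistent cptOmega flow_sigma ca1 ca2 ca3 rad).

(** Stated for an arbitrary set of complete solutions in [[d, B]], so that it serves minimal sets as
    well as the compactness of the graph of [beta]. *)
Lemma positive_sols (S : set (Omega * R)) l (d B : R) : S !=set0 -> 0 < d ->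
  (forall p, S p -> exists v, [/\ v 0 = p.2, sol l p.1 v & forall t, d <= v t <= B]) ->
  persistent l /\ forall l1, l1 < l -> persistent l1 -> lm <= l -> S `<=` graph_of (beta l).
Proof.
move=> [p Sp] d0 hS.
have vB (v : R -> R) t : d <= v t <= B -> `|v t| <= B.
  by move=> /andP[h1 h2]; rewrite ger0_norm//; lra.
split.
  have [v [v0 sv hv]] := hS p Sp.
  apply: (half_orbit_persistent cptOmega flow_sigma min_sigma ca1 ca2 ca3 rad_dissip sv (fun t => vB v t (hv t)) d0) => t _.
  by have /andP[] := hv t.
move=> l1 l1l hp lml q Sq; have [v [v0 sv hv]] := hS q Sq.
rewrite /graph_of /= -v0; apply: (positive_sol_unique min_sigma a3_gt0 lmq sp_a1 rad_dissip l1l hp lml sv d0 _ (fun t => vB v t (hv t))) => t.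
by have /andP[] := hv t.
Qed.

Section above_persistent.
Variables l1 l : R.
Hypothesis l1l : l1 < l.
Hypothesis pers : persistent l1.

Lemma persistent_above : persistent l.
Proof. exact: persistent_mono (ltW l1l) pers. Qed.

(** Semicontinuity alone does not close the graph. By uniqueness, the graph is the set [E] of all
    complete solutions with values in [[d, rad l]], which is closed. *)
Lemma graph_beta_compact : lm <= l -> compact (graph_of (beta l)).
Proof.
move=> lml; have [d d0 hd] := persistent_above.
pose E := [set p : Omega * R | exists v, [/\ v 0 = p.2, sol l p.1 v & forall t, d <= v t <= rad l]].
have -> : graph_of (beta l) = E.
  apply/seteqP; split.
    move=> [w x]; rewrite /graph_of /= => ->; exists (fun t => beta l (sigma t w)); split => /=.
    - by rewrite flow0.
    - exact: beta_sol.
    - by move=> t; rewrite hd beta_le_rad.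
  have [->//|/set0P E0] := eqVneq E set0.
  by have [_ /(_ l1 l1l pers lml)] := @positive_sols E l d (rad l) E0 d0 (fun p h => h).
apply: (@subclosed_compact _ _ ([set: Omega] `*` `[d, rad l])).
- exact: (band_closed cptOmega flow_sigma (@cp1 l) ca2 ca3).
- by apply: compact_setX => //; exact: segment_compact.
- move=> p [v [v0 _ hv]]; split => //=; rewrite in_itv/= -v0; exact: hv.
Qed.

Lemma graph_beta_minimal : lm <= l -> minimal_set sigma (fld l) (graph_of (beta l)).
Proof.
move=> lml; apply: (graph_minimal cptOmega flow_sigma min_sigma (@cp1 l) ca2 ca3).
  exact: graph_beta_compact.
by move=> w; exact: beta_sol.
Qed.

Lemma graph_beta_attractive : hyperbolic_attractive sigma (fld l) (graph_of (beta l)).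
Proof.
have [rho [k [c [rho0 k1 c0 attr]]]] := beta_attracts a3_gt0 rad_dissip l1l pers.
exists rho, k, c; split => // w x0 x; rewrite /graph_of /= => -> hx t t0.
have [||v [v0 _ [e e0 vd]]] := @forward_exists _ _ _ cptOmega flow_sigma _ _ _ (@cp1 l) ca2 ca3 (rad l) (Num.max (rad l) `|x|) w x (rad_dissip l) _ _.
- by rewrite le_max lexx.
- by rewrite le_max lexx orbT.
exists (v t), (beta l (sigma t w)); split.
- rewrite -v0; apply: (interval_sol_at cptOmega (@cp1 l) ca2 ca3 (a := - e) (b := t + 1)) => [||s /andP[s1 s2]].
  + lra.
  + lra.
  + exact: vd.
- have := sol_sol_at cptOmega (@cp1 l) ca2 ca3 t (beta_sol cptOmega flow_sigma ca1 ca2 ca3 rad_dissip l w).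
  by rewrite flow0.
- rewrite -v0; apply: attr => //; last by rewrite v0.
  by move=> s s0; apply: vd; lra.
Qed.

End above_persistent.

Lemma zero_attractive l : l < lm -> hyperbolic_attractive sigma (fld l) zero_section.
Proof.
move=> llm.
have [rho [k [c [rho0 k1 c0 attr]]]] := zero_attracts cptOmega flow_sigma ca1 ca2 ca3 lmq sp_a1 llm.
exists rho, k, c; split => // w x0 x; rewrite /zero_section /graph_of /= => -> hx t t0.
have [||v [v0 _ [e e0 vd]]] := @forward_exists _ _ _ cptOmega flow_sigma _ _ _ (@cp1 l) ca2 ca3 (rad l) (Num.max (rad l) `|x|) w x (rad_dissip l) _ _.
- by rewrite le_max lexx.
- by rewrite le_max lexx orbT.
have vd0 (s : R) : 0 <= s -> is_derive s 1 v (fld l (sigma s w) (v s)).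
  by move=> s0; apply: vd; lra.
exists (v t), 0; split.
- rewrite -v0; apply: (interval_sol_at cptOmega (@cp1 l) ca2 ca3 (a := - e) (b := t + 1)) => [||s /andP[s1 s2]].
  + lra.
  + lra.
  + exact: vd.
- exact: (sol_sol_at cptOmega (@cp1 l) ca2 ca3 t (zero_sol _ _ _ _ w)).
- rewrite !subr0 -v0; apply: (attr w v _ _ _ t t0).2.
  + by move=> s s0; exact: drv_continuous (vd0 s s0).
  + by move=> s s0 _; exact: vd0.
  + by rewrite v0 -[x]subr0.
Qed.

(** Time reversal: [v (- s)] solves the equation with negated coefficients over [sigma (- s)], and
    there zero attracts. *)
Lemma zero_repulsive l : lq < l -> hyperbolic_repulsive sigma (fld l) zero_section.
Proof.
move/(growingP flow_sigma ca1 lmq sp_a1) => [C [d [d0 hJ]]].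
have k1 : 1 <= expR `|C| by rewrite -[leLHS]expR0 ler_expR.
have cN (b : Omega -> R) : continuous b -> continuous (fun w => - b w).
  by move=> cb w; apply: cvgN; exact: cb.
have [rho rho0 hrho] := near_contraction cptOmega (cN _ (@cp1 l)) (cN _ ca2) (cN _ ca3) 0 d0 k1.
exists rho, (expR `|C|), (d / 2); split => //; first by rewrite divr_gt0.
move=> w x0 x; rewrite /zero_section /graph_of /= => -> hx t t0.
(* The truncated solution exists for all times; once the estimate keeps it below [1], the truncation
   is inactive. *)
pose v := Phi cptOmega flow_sigma (@cp1 l) ca2 ca3 1 w x.
have v0 : v 0 = x by exact: Phi0.
have sv : trunc_sol sigma (fun w => a1 w + l) a2 a3 1 w v by exact: Phi_sol.
pose u s := v (- s).
pose N s := J w (- s) - (l - d) * s; pose dN s := - a1 (sigma (- s) w) - (l - d).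
have E w' y : cub (fun w => - (a1 w + l)) (fun w => - a2 w) (fun w => - a3 w) w' y = - fld l w' y.
  by rewrite /cub; ring.
have h1 (s : R) : 0 <= s -> is_derive s 1 (fun=> 0 : R) (cub (fun w => - (a1 w + l)) (fun w => - a2 w) (fun w => - a3 w) (sigma (- s) w) 0).
  by move=> _; rewrite cub0; exact: drvc.
have h2 (s : R) : 0 <= s -> `|0 : R| <= 0 by rewrite normr0.
have ud (s : R) : is_derive s 1 u (- fld l (sigma (- s) w) (clamp 1 (u s))).
  by apply: drv_opp; exact: sv.
have h3 (s : R) : 0 <= s -> {for s, continuous u} by move=> _; exact: drv_continuous (ud s).
have h4 (s : R) : 0 <= s -> `|u s - 0| < 1 -> is_derive s 1 u (cub (fun w => - (a1 w + l)) (fun w => - a2 w) (fun w => - a3 w) (sigma (- s) w) (u s)).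
  by move=> _; rewrite subr0 E => us; have := ud s; rewrite clamp_id// ltW.
have h5 (s : R) : 0 <= s -> is_derive s 1 N (dN s).
  move=> _; have := drvB (drv_opp (drv_orbint flow_sigma ca1 w (- s))) (drvM (drvc (l - d) s) (drvid s)).
  by move/drv_eq; apply; rewrite /dN; ring.
have h6 (s : R) : 0 <= s -> quot (fun w => - (a1 w + l)) (fun w => - a2 w) (fun w => - a3 w) (sigma (- s) w) 0 0 + d <= dN s.
  by move=> _; rewrite /dN /quot; lra.
have h7 (s : R) : 0 <= s -> expR (N s - N 0) <= expR `|C|.
  move=> s0; rewrite ler_expR /N !oppr0 orbint0 mulr0 !subr0.
  have := hJ (sigma (- s) w) s s0; have := ler_norm C.
  by have := orbintD flow_sigma ca1 w (- s) s; rewrite addNr orbint0; lra.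
have H := hrho (fun s => sigma (- s)) w (fun=> 0) u N dN h1 h2 h3 h4 h5 h6 h7.
have u0 : u 0 = x by rewrite /u oppr0.
rewrite u0 in H.
have {}H s : s <= 0 -> `|v s| < 1 /\ `|v s| <= expR `|C| * expR (d / 2 * s) * `|x|.
  move=> s0; have := H hx (- s); rewrite oppr_ge0 => /(_ s0).
  by rewrite /u opprK !subr0 mulrNN.
have [e /= e0 He] : \forall s \near (0 : R), `|v s| < 1.
  have cv : {for 0, continuous (fun t => `|v t|)}.
    apply: (@continuous_comp _ _ _ v (fun x => `|x|)); last exact: norm_continuous.
    exact: drv_continuous (sv 0).
  by apply: (cv _ (lt_nbhsl _)); exact: (H 0 (lexx _)).1.
exists (v t), 0; split.
- rewrite -v0; apply: (interval_sol_at cptOmega (@cp1 l) ca2 ca3 (a := t - 1) (b := e)) => [||s /andP[s1 s2]].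
  + lra.
  + lra.
  + have := sv s; rewrite clamp_id//; apply/ltW.
    case: (leP s 0) => s0; first by have [] := H s s0.
    by apply: He; rewrite /ball/= sub0r normrN gtr0_norm.
- exact: (sol_sol_at cptOmega (@cp1 l) ca2 ca3 t (zero_sol _ _ _ _ w)).
- by rewrite !subr0; exact: (H t t0).2.
Qed.

(** A solution of size at most [eta] grows at the linear rate [a1 + l] up to an error of order
    [eta]. Working with squares avoids dividing by a solution that might vanish. *)
Lemma linear_rate_bound l : exists2 B : R, 0 < B & forall w (v : R -> R) (sg T eta : R),
  `|sg| = 1 -> 0 <= T -> 0 <= eta <= 1 ->
  (forall s : R, 0 <= s <= T -> is_derive (sg * s) 1 v (fld l (sigma (sg * s) w) (v (sg * s)))) ->
  (forall s, 0 <= s <= T -> `|v (sg * s)| <= eta) ->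
  `|v 0| * expR (J w (sg * T) + l * (sg * T)) <= expR (B * eta * T) * `|v (sg * T)|.
Proof.
have [B B1 HB] := coef_bound cptOmega (@cp1 l) ca2 ca3.
exists (2 * B); first lra.
move=> w v sg T eta sg1 T0 /andP[eta0 eta1] vd veta.
pose M := 2 * B * eta.
have sgd (s : R) : is_derive s 1 (fun s => sg * s) sg.
  by have := drvM (drvc sg s) (drvid s); rewrite mul0r add0r mulr1.
pose F s := -2 * (J w (sg * s) + l * (sg * s)) + 2 * M * s.
pose u s := v (sg * s) * v (sg * s) * expR (F s).
pose q s := a2 (sigma (sg * s) w) * v (sg * s) - a3 (sigma (sg * s) w) * v (sg * s) ^+ 2.
pose du s := 2 * (v (sg * s) * v (sg * s)) * (sg * q s + M) * expR (F s).
have : u 0 <= u T.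
  apply: (@drv_nondecreasing _ u du) => [//|s sT|s sT].
    have hv := drv_comp (vd s sT) (sgd s).
    have hJ := drvD (drv_comp (drv_orbint flow_sigma ca1 w (sg * s)) (sgd s)) (drvM (drvc l s) (sgd s)).
    have := drvM (drvM hv hv) (drv_expR (drvD (drvM (drvc (-2) s) hJ) (drvM (drvc (2 * M) s) (drvid s)))).
    by move/drv_eq; apply; rewrite /du /q /F /cub; ring.
  rewrite /du; apply: mulr_ge0; last exact: expR_ge0.
  apply: mulr_ge0; first by rewrite mulr_ge0// -expr2 sqr_ge0.
  have [_ b2 b3] := HB (sigma (sg * s) w); have hs := veta s sT.
  have : `|q s| <= M.
    have g1 : `|a2 (sigma (sg * s) w) * v (sg * s)| <= B * eta by rewrite normrM ler_pM.
    have g2 : `|v (sg * s) ^+ 2| <= eta.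
      by rewrite normrX expr2 -[leRHS]mulr1 ler_pM//; lra.
    have g3 : `|a3 (sigma (sg * s) w) * v (sg * s) ^+ 2| <= B * eta by rewrite normrM ler_pM.
    rewrite /q; apply: le_trans (ler_normB _ _) _.
    by rewrite /M; lra.
  rewrite -[`|q s|]mul1r -sg1 -normrM ler_norml; lra.
rewrite /u /F !mulr0 orbint0 !addr0 mulr0 expR0 mulr1 => h.
rewrite -ler_sqr ?nnegrE ?mulr_ge0 ?expR_ge0// !exprMn !real_normK ?num_real// !expr2 -!expRD.
set A := J w (sg * T) + l * (sg * T) in h *.
have := ler_wpM2r (expR_ge0 (A + A)) h => /le_trans; apply.
have E (y p0 q0 : R) : y * expR p0 * expR q0 = y * expR (p0 + q0) by rewrite expRD mulrA.
rewrite E [leRHS]mulrC le_eqVlt; apply/orP; left; apply/eqP; congr (_ * expR _).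
by rewrite /M; ring.
Qed.

(** Shrinking the initial value removes the nonlinear error, so a rate shared by all small solutions
    passes to the linear equation. *)
Lemma rate_limit l w (sg T k0 rho k : R) : `|sg| = 1 -> 0 <= T -> 0 < rho -> 1 <= k ->
  (forall x, 0 < x < rho -> exists v : R -> R, [/\ v 0 = x,
    forall s : R, 0 <= s <= T -> is_derive (sg * s) 1 v (fld l (sigma (sg * s) w) (v (sg * s))),
    forall s, 0 <= s <= T -> `|v (sg * s)| <= k * x & `|v (sg * T)| <= expR k0 * x]) ->
  J w (sg * T) + l * (sg * T) <= k0.
Proof.
move=> sg1 T0 rho0 k1 hv; have [B B0 HB] := linear_rate_bound l.
apply/ler_addgt0Pr => e e0.
(* Small enough for [x < rho], for the size [k x <= 1], and for the error [B k x T <= e]. *)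
pose x := Num.min (rho / 2) (Num.min (1 / k) (e / (B * k * (T + 1)))).
have kp : 0 < k by lra.
have D0 : 0 < B * k * (T + 1) by rewrite !mulr_gt0//; lra.
have x0 : 0 < x by rewrite !lt_min !divr_gt0.
have x1 : x <= rho / 2 by rewrite ge_min lexx.
have x2 : x <= 1 / k by rewrite !ge_min lexx orbT.
have x3 : x <= e / (B * k * (T + 1)) by rewrite !ge_min lexx !orbT.
have xr : 0 < x < rho by lra.
have [v [v0 vd vk vT]] := hv x xr.
have kx : 0 <= k * x <= 1.
  by rewrite mulr_ge0 ?(ltW kp) ?(ltW x0)//= mulrC -ler_pdivlMr.
have := HB w v sg T (k * x) sg1 T0 kx vd vk.
rewrite v0 (gtr0_norm x0) mulrC => h.
have : expR (J w (sg * T) + l * (sg * T)) <= expR (B * (k * x) * T + k0).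
  rewrite -(ler_pM2r x0); apply: le_trans h _.
  by rewrite expRD -[leRHS]mulrA ler_wpM2l ?expR_ge0.
rewrite ler_expR => /le_trans; apply; rewrite addrC lerD2l.
have : x * (B * k * (T + 1)) <= e by rewrite -ler_pdivlMr.
have : 0 <= x * (B * k) by rewrite !mulr_ge0 ?ltW.
nra.
Qed.

(** Attraction would pass to the linear equation through [rate_limit], giving [decaying] with
    constants [ln k] and [c], which means [l < lm]. *)
Lemma zero_not_attractive l : lm <= l -> ~ hyperbolic_attractive sigma (fld l) zero_section.
Proof.
move=> lml [rho [k [c [rho0 k1 c0 h]]]].
suff /(decayingP flow_sigma ca1 lmq sp_a1) : decaying sigma a1 l by rewrite ltNge lml.
exists (ln k), c; split => // w t t0.
have := @rate_limit l w 1 t (ln k - c * t) rho k (normr1 _) t0 rho0 k1; rewrite mul1r; apply.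
move=> x /andP[x0 xr].
have hz (y t' : R) : sol_at sigma (fld l) t' w 0 y -> y = 0.
  move=> sy; have s0 := sol_sol_at cptOmega (@cp1 l) ca2 ca3 t' (zero_sol sigma _ _ _ w).
  exact: (@sol_at_unique _ _ _ cptOmega _ _ _ (@cp1 l) ca2 ca3 t' w 0 y 0 sy s0).
have hx t' : 0 <= t' -> exists2 y, sol_at sigma (fld l) t' w x y & `|y| <= k * expR (- c * t') * x.
  move=> t'0; have [|y [y0 [sy sy0]]] := h w 0 x (erefl _) _ t' t'0.
    by rewrite subr0 gtr0_norm.
  rewrite (hz _ _ sy0) !subr0 (gtr0_norm x0) => hy; by exists y.
have [_ [J' [v [mv Jt _]]] _] := hx t t0.
have [[oJ iJ J0 v0 dv] _] := mv.
have Js s : 0 <= s <= t -> J' s by exact: iJ J0 Jt s.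
have vs s : 0 <= s <= t -> `|v s| <= k * expR (- c * s) * x.
  move=> st; have [s0 _] := andP st; have [y sy hy] := hx s s0.
  rewrite (sol_at_unique cptOmega (@cp1 l) ca2 ca3 (y' := v s) sy) in hy => //.
  by exists J', v; split => //; exact: Js.
exists v; split => //.
- by move=> s st; rewrite mul1r; apply: dv; exact: Js.
- move=> s st; rewrite mul1r; apply: le_trans (vs s st) _.
  rewrite ler_wpM2r ?(ltW x0)// -[leRHS]mulr1 ler_wpM2l//; first lra.
  by have [s0 _] := andP st; rewrite -[leRHS]expR0 ler_expR mulNr oppr_le0 mulr_ge0// ltW.
- rewrite expRD lnK ?posrE; last lra.
  by rewrite -mulNr; apply: vs; rewrite t0 lexx.
Qed.

Lemma zero_not_repulsive l : l <= lq -> ~ hyperbolic_repulsive sigma (fld l) zero_section.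
Proof.
move=> llq [rho [k [c [rho0 k1 c0 h]]]].
suff /(growingP flow_sigma ca1 lmq sp_a1) : growing sigma a1 l by rewrite ltNge llq.
exists (ln k), c; split => // w0 t t0.
(* Repulsion is a backward estimate, so it is applied at the end point of the orbit segment. *)
pose w := sigma t w0.
suff : J w (- t) + l * (- t) <= ln k - c * t.
  by have := orbintD flow_sigma ca1 w0 t (- t); rewrite subrr orbint0 -/w; lra.
have := @rate_limit l w (-1) t (ln k - c * t) rho k (normrN1 _) t0 rho0 k1; rewrite mulN1r; apply.
move=> x /andP[x0 xr].
have hz (y t' : R) : sol_at sigma (fld l) t' w 0 y -> y = 0.
  move=> sy; have s0 := sol_sol_at cptOmega (@cp1 l) ca2 ca3 t' (zero_sol sigma _ _ _ w).
  exact: (@sol_at_unique _ _ _ cptOmega _ _ _ (@cp1 l) ca2 ca3 t' w 0 y 0 sy s0).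
have hx t' : 0 <= t' -> exists2 y, sol_at sigma (fld l) (- t') w x y & `|y| <= k * expR (- c * t') * x.
  move=> t'0; have [||y [y0 [sy sy0]]] := h w 0 x (erefl _) _ (- t') _.
  - by rewrite subr0 gtr0_norm.
  - by rewrite oppr_le0.
  rewrite (hz _ _ sy0) !subr0 (gtr0_norm x0) mulrN -mulNr => hy; by exists y.
have [_ [J' [v [mv Jt _]]] _] := hx t t0.
have [[oJ iJ J0 v0 dv] _] := mv.
have Js s : 0 <= s <= t -> J' (- s).
  by move=> /andP[s0 st]; apply: (iJ _ _ Jt J0); rewrite lerN2 oppr_le0 st s0.
have vs s : 0 <= s <= t -> `|v (- s)| <= k * expR (- c * s) * x.
  move=> st; have [s0 _] := andP st; have [y sy hy] := hx s s0.
  rewrite (sol_at_unique cptOmega (@cp1 l) ca2 ca3 (y' := v (- s)) sy) in hy => //.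
  by exists J', v; split => //; exact: Js.
exists v; split => //.
- by move=> s st; rewrite mulN1r; apply: dv; exact: Js.
- move=> s st; rewrite mulN1r; apply: le_trans (vs s st) _.
  rewrite ler_wpM2r ?(ltW x0)// -[leRHS]mulr1 ler_wpM2l//; first lra.
  by have [s0 _] := andP st; rewrite -[leRHS]expR0 ler_expR mulNr oppr_le0 mulr_ge0// ltW.
- rewrite expRD lnK ?posrE; last lra.
  by rewrite -mulNr; apply: vs; rewrite t0 lexx.
Qed.

End minimal_and_hyperbolic.

(** * The global attractor *)

Section reflection.
Context {R : realType} {Omega : pmetricType R}.
Variable sigma : R -> Omega -> Omega.
Hypothesis cptOmega : compact [set: Omega].
Variables p1 p2 p3 : Omega -> R.
Hypothesis c1 : continuous p1.
Hypothesis c2 : continuous p2.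
Hypothesis c3 : continuous p3.

Local Notation np2 := (fun w => - p2 w).

Lemma cub_opp w x : cub p1 np2 p3 w x = - cub p1 p2 p3 w (- x).
Proof. by rewrite /cub; ring. Qed.

Lemma dissip_opp r : dissip p1 p2 p3 r -> dissip p1 np2 p3 r.
Proof.
move=> [r1 h]; split => // w x; rewrite cub_opp; split => hx.
  by have := (h w (- x)).2; rewrite lerN2 => /(_ hx); lra.
by have := (h w (- x)).1; rewrite lerNr => /(_ hx); lra.
Qed.

Lemma sol_opp w (v : R -> R) : sol sigma p1 np2 p3 w v ->
  sol sigma p1 p2 p3 w (fun t => - v t).
Proof.
move=> sv t; have := drvN (sv t); rewrite cub_opp opprK; exact.
Qed.

Lemma sol_oppN w (v : R -> R) : sol sigma p1 p2 p3 w v ->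
  sol sigma p1 np2 p3 w (fun t => - v t).
Proof.
move=> sv t; have := drvN (sv t); rewrite -{1}[v t]opprK -cub_opp; exact.
Qed.

Lemma ivp_opp w x J (v : R -> R) : ivp_solution sigma (cub p1 np2 p3) w x J v ->
  ivp_solution sigma (cub p1 p2 p3) w (- x) J (fun t => - v t).
Proof.
move=> [oJ iJ J0 v0 dv]; split => //; first by rewrite v0.
by move=> t Jt; have := drvN (dv t Jt); rewrite cub_opp opprK; exact.
Qed.

Lemma sol_at_opp t w x y : sol_at sigma (cub p1 np2 p3) t w x y ->
  sol_at sigma (cub p1 p2 p3) t w (- x) (- y).
Proof.
move=> [J [v [[iv _] Jt <-]]].
exact: (ivp_sol_at cptOmega c1 c2 c3 (ivp_opp iv) Jt).
Qed.

Lemma hyperbolic_attractive_opp (kappa : Omega -> R) :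
  hyperbolic_attractive sigma (cub p1 np2 p3) (graph_of kappa) ->
  hyperbolic_attractive sigma (cub p1 p2 p3) (graph_of (fun w => - kappa w)).
Proof.
move=> [rho [k [c [rho0 k1 c0 h]]]]; exists rho, k, c; split => // w x0 x.
rewrite /graph_of /= => -> hx t t0.
have [|y [y0 [sy sy0 hy]]] := h w (kappa w) (- x) (erefl _) _ t t0.
  by rewrite -opprD normrN -[kappa w]opprK.
exists (- y), (- y0); split.
- by rewrite -[x]opprK; exact: sol_at_opp.
- exact: sol_at_opp.
- rewrite -opprD normrN; apply: le_trans hy _.
  by rewrite -opprD normrN -[kappa w in leLHS]opprK opprK.
Qed.

End reflection.

Section attractor.
Context {R : realType} {Omega : pmetricType R}.
Variable sigma : R -> Omega -> Omega.
Hypothesis cptOmega : compact [set: Omega].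
Hypothesis flow_sigma : continuous_flow sigma.
Variables a1 a2 a3 : Omega -> R.
Hypothesis ca1 : continuous a1.
Hypothesis ca2 : continuous a2.
Hypothesis cna2 : continuous (fun w => - a2 w).
Hypothesis ca3 : continuous a3.
Variable rad : R -> R.
Hypothesis rad_dissip : forall l, dissip (fun w => a1 w + l) a2 a3 (rad l).

Let cp1 l : continuous (fun w => a1 w + l).
Proof. exact: shifted_continuous. Qed.
Let radN_dissip l : dissip (fun w => a1 w + l) (fun w => - a2 w) a3 (rad l).
Proof. exact: dissip_opp. Qed.

Local Notation fld l := (cub (fun w => a1 w + l) a2 a3).
Local Notation sol l := (sol sigma (fun w => a1 w + l) a2 a3).
Local Notation betaN := (beta cptOmega flow_sigma ca1 cna2 ca3 rad).
Local Notation beta := (beta cptOmega flow_sigma ca1 ca2 ca3 rad).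

(** The continuity proof [cna2] is a parameter because [betaN] depends on it; a single proof keeps
    the reflected objects the same term throughout. *)
Definition alpha l w : R := - betaN l w.

Lemma alphaE l w : alpha l w = - betaN l w. Proof. by []. Qed.

Lemma alpha_sol l w : sol l w (fun t => alpha l (sigma t w)).
Proof. exact: (sol_opp (beta_sol cptOmega flow_sigma ca1 cna2 ca3 radN_dissip l w)). Qed.

Lemma alpha_le0 l w : alpha l w <= 0.
Proof. by rewrite oppr_le0; exact: beta_ge0. Qed.

Lemma alpha_norm l w : `|alpha l w| <= rad l.
Proof. by rewrite normrN; exact: beta_norm. Qed.

Lemma hypograph_closed (kappa : Omega -> R) :
  (forall w e, 0 < e -> \forall w' \near w, kappa w' <= kappa w + e) ->
  closed [set p : Omega * R | p.2 <= kappa p.1].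
Proof.
move=> usc; rewrite -[X in closed X]setCK; apply: open_closedC; rewrite openE => -[w x] /= /negP.
rewrite -ltNge => kx.
have e0 : 0 < (x - kappa w) / 2 by lra.
exists ([set w' | kappa w' <= kappa w + (x - kappa w) / 2], ball x ((x - kappa w) / 2)) => /=.
  by split; [exact: usc|exact: nbhsx_ballx].
move=> [w' x'] /= [h1]; rewrite /ball/= => h2 h3.
by have := ler_norm (x - x'); lra.
Qed.

Lemma flip_continuous : continuous (fun p : Omega * R => (p.1, - p.2)).
Proof.
move=> [w x]; have h1 : p.1 @[p --> (w, x)] --> w by exact: cvg_fst.
have h2 : - p.2 @[p --> (w, x)] --> - x by apply: cvgN; exact: cvg_snd.
exact: (cvg_pair h1 h2).
Qed.

Lemma band_compact l : compact (band (alpha l) (beta l)).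
Proof.
apply: (@subclosed_compact _ _ ([set: Omega] `*` `[- rad l, rad l])).
- have -> : band (alpha l) (beta l) =
      (fun p : Omega * R => (p.1, - p.2)) @^-1` [set p | p.2 <= betaN l p.1] `&`
      [set p | p.2 <= beta l p.1].
    apply/seteqP; split => -[w x]; rewrite /band /alpha /=.
      by move=> /andP[h1 h2]; split => //; lra.
    by move=> [h1 h2]; apply/andP; split => //; lra.
  apply: closedI.
    apply: preimage_closed.
      by move=> p _; exact: flip_continuous.
    by apply: hypograph_closed => w e e0; exact: beta_near.
  by apply: hypograph_closed => w e e0; exact: beta_near.
- by apply: compact_setX => //; exact: segment_compact.
- move=> [w x] /= /andP[h1 h2]; split => //=; rewrite in_itv/=.
  have := beta_le_rad cptOmega flow_sigma ca1 ca2 ca3 rad_dissip l w.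
  by have := beta_le_rad cptOmega flow_sigma ca1 cna2 ca3 radN_dissip l w; rewrite /alpha /= in h1 h2 *; lra.
Qed.

(** Order preservation holds the truncated solution between [alpha] and [beta], so the truncation is
    never active. *)
Lemma band_invariant l : tau_invariant sigma (fld l) (band (alpha l) (beta l)).
Proof.
apply: (invariant_of_sol cptOmega flow_sigma (@cp1 l) ca2 ca3) => -[w x] /= /andP[h1 h2].
pose v := Phi cptOmega flow_sigma (@cp1 l) ca2 ca3 (rad l) w x.
have v0 : v 0 = x by exact: Phi0.
have sv : trunc_sol sigma (fun w => a1 w + l) a2 a3 (rad l) w v by exact: Phi_sol.
have sb := sol_trunc (beta_sol cptOmega flow_sigma ca1 ca2 ca3 rad_dissip l w)
  (fun t => beta_norm cptOmega flow_sigma ca1 ca2 ca3 rad_dissip l (sigma t w)).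
have sa := sol_trunc (alpha_sol l w) (fun t => alpha_norm l (sigma t w)).
have va t : alpha l (sigma t w) <= v t.
  by apply: (trunc_sol_order cptOmega (@cp1 l) ca2 ca3 sa sv); rewrite flow0// v0.
have vb t : v t <= beta l (sigma t w).
  by apply: (trunc_sol_order cptOmega (@cp1 l) ca2 ca3 sv sb); rewrite flow0// v0.
exists v; split => //; last by move=> t; rewrite /band /= va vb.
apply: (trunc_sol_sol sv) => t; rewrite ler_norml; apply/andP; split.
  by apply: le_trans (va t); have := alpha_norm l (sigma t w); rewrite ler_norml => /andP[].
by apply: le_trans (vb t) _; exact: beta_le_rad.
Qed.

(** Time is counted back from the target fibre, so [upper_attracts], used for the equation and for
    its reflection, gives a bound uniform near each [w]; compactness makes it uniform on [Omega]. *)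
Lemma band_uniform_attraction l (e : R) : 0 < e -> \forall t \near +oo, forall w (v : R -> R),
  (forall s : R, 0 <= s -> is_derive s 1 v (fld l (sigma s (sigma (- t) w)) (v s))) ->
  `|v 0| <= rad l -> exists2 z, band (alpha l) (beta l) z & ball z e (w, v t).
Proof.
move=> e0; have e2 : 0 < e / 2 by lra.
pose P (t : R) w := forall v : R -> R,
  (forall s : R, 0 <= s -> is_derive s 1 v (fld l (sigma s (sigma (- t) w)) (v s))) ->
  `|v 0| <= rad l -> exists2 z, band (alpha l) (beta l) z & ball z e (w, v t).
have := cptOmega; move/compact_near_coveringP => /(_ R +oo P _) H.
apply: filterS (H _) => [t h w v|w _]; first exact: h.
have [T T0 hT] := upper_attracts cptOmega flow_sigma (@shifted_continuous _ _ _ ca1 l) ca2 ca3 (rad_dissip l) w e2.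
have [T' T'0 hT'] := upper_attracts cptOmega flow_sigma (@shifted_continuous _ _ _ ca1 l) cna2 ca3 (radN_dissip l) w e2.
exists ([set w' | [/\ (forall s v, T <= s ->
  (forall t : R, 0 <= t -> is_derive t 1 v (fld l (sigma t (sigma (- s) w')) (v t))) ->
  `|v 0| <= rad l -> v s <= beta l w + e / 2),
  (forall s v, T' <= s ->
  (forall t : R, 0 <= t -> is_derive t 1 v (cub (fun w => a1 w + l) (fun w => - a2 w) a3 (sigma t (sigma (- s) w')) (v t))) ->
  `|v 0| <= rad l -> v s <= betaN l w + e / 2) & ball w e w']], [set t | Num.max T T' <= t]) => /=.
  split; last by apply: nbhs_pinfty_ge; exact: num_real.
  have hb := nbhsx_ballx w e e0.
  apply: filterS (filterI (filterI hT hT') hb) => w' [[h1 h2] h3].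
  by split; [exact: h1|exact: h2|].
move=> [w' t] [/= [h1 h2 h3]]; rewrite ge_max => /andP[Tt T't] v vd v0.
have g1 := h1 t v Tt vd v0.
have g2 : - v t <= betaN l w + e / 2.
  apply: (h2 t (fun s => - v s) T't); last by rewrite normrN.
  by move=> s s0; rewrite cub_opp opprK; exact: drvN (vd s s0).
have ab : alpha l w <= beta l w.
  by apply: le_trans (alpha_le0 l w) _; exact: beta_ge0.
(* [v t] is projected to the fibre interval over the centre [w], not over [w']: by semicontinuity
   the estimates are known relative to the interval at [w]. *)
pose x := Num.max (alpha l w) (Num.min (v t) (beta l w)).
exists (w, x).
  rewrite /band /= /x; apply/andP; split; first by rewrite le_max lexx.
  by rewrite ge_max ab ge_min lexx orbT.
split => //=; rewrite /ball /= /x /alpha.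
case: (leP (v t) (beta l w)) => hb; case: (leP (- betaN l w) _) => ha;
  rewrite ltr_norml; apply/andP; split; lra.
Qed.

Lemma band_attractor l : global_attractor sigma (fld l) (band (alpha l) (beta l)).
Proof.
split; [exact: band_compact|exact: band_invariant|].
move=> B [r hr] e e0.
(* [T1] is the time needed to enter the strip of radius [rad l]; uniform attraction takes over from
   there. *)
pose K := Num.max r (rad l); pose T1 := K - rad l.
have rK : rad l <= K by rewrite le_max lexx orbT.
have [M [Mreal hM]] := band_uniform_attraction l e0.
exists (`|M| + T1); split; first exact: num_real.
move=> t Mt [w x] Bp.
have [||v [v0 vK [d d0 vd]]] := @forward_exists _ _ _ cptOmega flow_sigma _ _ _ (@cp1 l) ca2 ca3 (rad l) K w x (rad_dissip l) _ _ => //.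
  by rewrite le_max (hr _ Bp).
have t0 : 0 <= t by have := normr_ge0 M; rewrite /T1 in Mt; lra.
have vd0 (s : R) : 0 <= s -> is_derive s 1 v (fld l (sigma s w) (v s)) by move=> s0; apply: vd; lra.
exists (sigma t w, v t).
  split => //=; rewrite -v0.
  apply: (interval_sol_at cptOmega (@cp1 l) ca2 ca3 (a := - d) (b := t + 1)) => [||s /andP[s1 s2]].
  - lra.
  - lra.
  - exact: vd.
have E : sigma (- (t - T1)) (sigma t w) = sigma T1 w by rewrite -flowD//; congr (sigma _ w); ring.
have := hM (t - T1) _ (sigma t w) (fun s => v (T1 + s)).
rewrite addr0 E addrCA subrr addr0; apply.
- by have := ler_norm M; lra.
- move=> s s0; rewrite -flowD//; apply: drv_shift; apply: vd0; rewrite /T1; lra.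
rewrite ler_norml; apply/andP; split.
  rewrite lerNl; apply: (@absorb_le _ _ _ cptOmega flow_sigma _ _ _ (@cp1 l) cna2 ca3 (rad l) K w
    (fun s => - v s) (fun s => - fld l (sigma s w) (v s)) (radN_dissip l)) => // s s0.
  - by rewrite normrN; exact: vK.
  - exact: drvN (vd0 s s0).
  - by rewrite cub_opp opprK.
exact: (@absorb_le _ _ _ cptOmega flow_sigma _ _ _ (@cp1 l) ca2 ca3 (rad l) K w
  v (fun s => fld l (sigma s w) (v s)) (rad_dissip l) vK vd0).
Qed.

Lemma band_bounds l : attractor_bounds sigma (fld l) (alpha l) (beta l).
Proof.
split.
- exact: band_attractor.
- move=> w t; have := sol_sol_at cptOmega (@cp1 l) ca2 ca3 t (alpha_sol l w).
  by rewrite flow0.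
- move=> w t; have := sol_sol_at cptOmega (@cp1 l) ca2 ca3 t (beta_sol cptOmega flow_sigma ca1 ca2 ca3 rad_dissip l w).
  by rewrite flow0.
- split=> w a; rewrite lte_fin => ha.
    have e0 : 0 < (alpha l w - a) / 2 by lra.
    have := beta_near cptOmega flow_sigma ca1 cna2 ca3 radN_dissip l w e0.
    exists [set w' | betaN l w' <= betaN l w + (alpha l w - a) / 2] => // w' /=.
    by rewrite lte_fin /alpha in ha *; lra.
  have e0 : 0 < (- beta l w - a) / 2 by lra.
  have := beta_near cptOmega flow_sigma ca1 ca2 ca3 rad_dissip l w e0.
  exists [set w' | beta l w' <= beta l w + (- beta l w - a) / 2] => // w' /=.
  by rewrite lte_fin; lra.
- by move=> w; rewrite alpha_le0 beta_ge0.
Qed.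

End attractor.

(** * Classification of the minimal sets *)

Section minimal_sets.
Context {R : realType} {Omega : pmetricType R}.
Variable sigma : R -> Omega -> Omega.
Hypothesis cptOmega : compact [set: Omega].
Hypothesis flow_sigma : continuous_flow sigma.
Hypothesis min_sigma : minimal_flow sigma.
Variables a1 a2 a3 : Omega -> R.
Hypothesis ca1 : continuous a1.
Hypothesis ca2 : continuous a2.
Hypothesis cna2 : continuous (fun w => - a2 w).
Hypothesis ca3 : continuous a3.
Hypothesis a3_gt0 : forall w, 0 < a3 w.
Variables lm lq : R.
Hypothesis lmq : lm < lq.
Hypothesis sp_a1 : sacker_sell_spectrum sigma a1 = [set` `[- lq, - lm]].
Variable rad : R -> R.
Hypothesis rad_dissip : forall l, dissip (fun w => a1 w + l) a2 a3 (rad l).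

Let cp1 l : continuous (fun w => a1 w + l).
Proof. exact: shifted_continuous. Qed.
Let radN_dissip l : dissip (fun w => a1 w + l) (fun w => - a2 w) a3 (rad l).
Proof. exact: dissip_opp. Qed.

Local Notation fld l := (cub (fun w => a1 w + l) a2 a3).
Local Notation solN l := (sol sigma (fun w => a1 w + l) (fun w => - a2 w) a3).
Local Notation sol l := (sol sigma (fun w => a1 w + l) a2 a3).
Local Notation alpha := (alpha cptOmega flow_sigma ca1 cna2 ca3 rad).
Local Notation betaN := (beta cptOmega flow_sigma ca1 cna2 ca3 rad).
Local Notation beta := (beta cptOmega flow_sigma ca1 ca2 ca3 rad).
Local Notation persistentN := (persistent cptOmega flow_sigma ca1 cna2 ca3 rad).
Local Notation persistent := (persistent cptOmega flow_sigma ca1 ca2 ca3 rad).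

Lemma graph_alpha_minimal l1 l : l1 < l -> persistentN l1 -> lm <= l ->
  minimal_set sigma (fld l) (graph_of (alpha l)).
Proof.
move=> l1l pN lml; apply: (graph_minimal cptOmega flow_sigma min_sigma (@cp1 l) ca2 ca3).
  have -> : graph_of (alpha l) = (fun p : Omega * R => (p.1, - p.2)) @` graph_of (betaN l).
    apply/seteqP; split => [[w x]|_ [[w x] + <-]]; rewrite /graph_of /=.
      by move=> ->; exists (w, betaN l w).
    by move=> ->.
  apply: continuous_compact; first by apply: continuous_subspaceT; exact: flip_continuous.
  exact: (graph_beta_compact min_sigma a3_gt0 lmq sp_a1 radN_dissip l1l pN lml).
by move=> w; exact: alpha_sol.
Qed.

Lemma graph_alpha_attractive l1 l : l1 < l -> persistentN l1 ->
  hyperbolic_attractive sigma (fld l) (graph_of (alpha l)).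
Proof.
move=> l1l pN; apply: (hyperbolic_attractive_opp cptOmega (@cp1 l) ca2 ca3).
exact: (graph_beta_attractive a3_gt0 radN_dissip l1l pN).
Qed.

(** Positive minimal sets are handled by [positive_sols], negative ones after reflection.
    Identification with a graph is conditional on a persistent parameter strictly below [l], from
    which attraction is derived. *)
Lemma minimal_classification l M : minimal_set sigma (fld l) M ->
  [\/ M = zero_section,
      persistent l /\ (forall l1, l1 < l -> persistent l1 -> lm <= l -> M = graph_of (beta l)) |
      persistentN l /\ (forall l1, l1 < l -> persistentN l1 -> lm <= l -> M = graph_of (alpha l))].
Proof.
move=> mM; have [M0 cM iM _] := mM.
have [B HB] := compact_snd_bounded cM.
have solM p : M p -> exists v, [/\ v 0 = p.2, sol l p.1 v & forall t, M (sigma t p.1, v t)].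
  exact: (tau_invariant_sol cptOmega (@cp1 l) ca2 ca3 iM).
have [->|pM|nM] := minimal_trichotomy cptOmega flow_sigma min_sigma (@cp1 l) ca2 ca3 mM.
- exact: Or31.
- apply: Or32; have [d d0 hd] := compact_positive_below cM pM.
  have [pl h] := positive_sols cptOmega flow_sigma min_sigma ca1 ca2 ca3 a3_gt0 lmq sp_a1 rad_dissip M0 d0
    (fun p Mp => let: ex_intro v (And3 v0 sv Mv) := solM p Mp in
      ex_intro _ v (And3 v0 sv (fun t => introT andP (conj (hd _ (Mv t)) (le_trans (ler_norm _) (HB _ (Mv t))))))).
  split => // l1 l1l pl1 lml.
  have [_ _ _] := graph_beta_minimal min_sigma a3_gt0 lmq sp_a1 rad_dissip l1l pl1 lml.
  by apply => //; exact: h pl1 lml.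
- apply: Or33; pose flip := (fun p : Omega * R => (p.1, - p.2)).
  have cF : compact (flip @` M).
    apply: continuous_compact => //; apply: continuous_subspaceT; exact: flip_continuous.
  have [d d0 hd] : exists2 d : R, 0 < d & forall p, (flip @` M) p -> d <= p.2.
    by apply: compact_positive_below cF _ => _ [p Mp <-] /=; rewrite oppr_gt0; exact: nM.
  have hN p : (flip @` M) p -> exists v, [/\ v 0 = p.2, solN l p.1 v & forall t, d <= v t <= B].
    move=> [q Mq <-]; have [v [v0 sv Mv]] := solM q Mq.
    exists (fun t => - v t); split => //=; first by rewrite v0.
      exact: sol_oppN.
    move=> t; apply/andP; split; first by apply: (hd (sigma t q.1, - v t)); exists (sigma t q.1, v t).
    by rewrite (le_trans _ (HB _ (Mv t)))//= -normrN ler_norm.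
  have F0 : flip @` M !=set0 by case: M0 => p Mp; exists (flip p), p.
  have [pl h] := positive_sols cptOmega flow_sigma min_sigma ca1 cna2 ca3 a3_gt0 lmq sp_a1 radN_dissip F0 d0 hN.
  split => // l1 l1l pl1 lml.
  have [_ _ _] := graph_alpha_minimal l1l pl1 lml.
  apply => // -[w x] Mwx; have /= := h l1 l1l pl1 lml (w, - x).
  by rewrite /graph_of /= alphaE => <-; [rewrite opprK|exists (w, x)].
Qed.

Lemma only_zero l : ~ persistent l -> ~ persistentN l -> only_zero_minimal sigma (fld l).
Proof.
move=> np nN M; split => [/minimal_classification[//|[]//|[]//]|->].
exact: zero_minimal.
Qed.

Lemma below_graph_beta l : persistent l -> below zero_section (graph_of (beta l)).
Proof.
by move=> [d d0 hd] w x y; rewrite /zero_section /graph_of /= => -> ->; exact: lt_le_trans (hd w).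
Qed.

Lemma graph_alpha_below l : persistentN l -> below (graph_of (alpha l)) zero_section.
Proof.
move=> [d d0 hd] w x y; rewrite /zero_section /graph_of /= => -> ->.
by rewrite oppr_lt0; exact: lt_le_trans (hd w).
Qed.

Lemma two_minimal l1 l : l1 < l -> persistent l1 -> ~ persistentN l -> lm <= l ->
  two_minimal_upper sigma (fld l) (beta l).
Proof.
move=> l1l pl1 nN lml; split.
- move=> M; split => [/minimal_classification[->|[_ h]|[]//]|[|] ->].
  + by left.
  + by right; exact: (h _ l1l _ lml).
  + exact: zero_minimal.
  + exact: (graph_beta_minimal min_sigma a3_gt0 lmq sp_a1 rad_dissip l1l pl1 lml).
- exact: below_graph_beta (persistent_above rad_dissip l1l pl1).
- exact: (graph_beta_attractive a3_gt0 rad_dissip l1l pl1).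
Qed.

Lemma three_minimal_sets l1 l : l1 < l -> persistent l1 -> persistentN l1 -> lm <= l ->
  three_minimal sigma (fld l) (alpha l) (beta l).
Proof.
move=> l1l pl1 pN lml; split.
- move=> M; split => [/minimal_classification[->|[_ h]|[_ h]]|[] ->].
  + exact: Or32.
  + by apply: Or33; exact: (h _ l1l _ lml).
  + by apply: Or31; exact: (h _ l1l _ lml).
  + exact: (graph_alpha_minimal l1l pN lml).
  + exact: zero_minimal.
  + exact: (graph_beta_minimal min_sigma a3_gt0 lmq sp_a1 rad_dissip l1l pl1 lml).
- exact: graph_alpha_below (persistent_above radN_dissip l1l pN).
- exact: below_graph_beta (persistent_above rad_dissip l1l pl1).
- exact: graph_alpha_attractive pN.
- exact: (graph_beta_attractive a3_gt0 rad_dissip l1l pl1).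
Qed.

Lemma zero_nonhyperbolic l : lm <= l <= lq -> nonhyperbolic sigma (fld l) zero_section.
Proof.
move=> /andP[h1 h2]; split.
  exact: (zero_not_attractive cptOmega flow_sigma ca1 ca2 ca3 lmq sp_a1 h1).
exact: (zero_not_repulsive cptOmega flow_sigma ca1 ca2 ca3 lmq sp_a1 h2).
Qed.

Lemma band_eq_zero l : l < lm -> ~ persistent l -> ~ persistentN l ->
  band (alpha l) (beta l) = zero_section.
Proof.
move=> llm np nN; apply/seteqP; split => -[w x]; rewrite /band /zero_section /graph_of /= alphaE.
  rewrite (beta_eq0 min_sigma lmq sp_a1 rad_dissip llm np) (beta_eq0 min_sigma lmq sp_a1 radN_dissip llm nN).
  by rewrite oppr0 => /le_anti.
rewrite (beta_eq0 min_sigma lmq sp_a1 rad_dissip llm np) (beta_eq0 min_sigma lmq sp_a1 radN_dissip llm nN).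
by move=> ->; rewrite oppr0 lexx.
Qed.

End minimal_sets.

(** * Thresholds and collision *)

Section thresholds.
Context {R : realType} {Omega : pmetricType R}.
Variable sigma : R -> Omega -> Omega.
Hypothesis cptOmega : compact [set: Omega].
Hypothesis flow_sigma : continuous_flow sigma.
Hypothesis min_sigma : minimal_flow sigma.
Variables a1 a2 a3 : Omega -> R.
Hypothesis ca1 : continuous a1.
Hypothesis ca2 : continuous a2.
Hypothesis ca3 : continuous a3.
Variables lm lq : R.
Hypothesis lmq : lm < lq.
Hypothesis sp_a1 : sacker_sell_spectrum sigma a1 = [set` `[- lq, - lm]].
Variable rad : R -> R.
Hypothesis rad_dissip : forall l, dissip (fun w => a1 w + l) a2 a3 (rad l).

Local Notation J := (orbint sigma a1).
Local Notation beta := (beta cptOmega flow_sigma ca1 ca2 ca3 rad).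
Local Notation persistent := (persistent cptOmega flow_sigma ca1 ca2 ca3 rad).

(** For small [e] the function [e expR g] is a subsolution: the averaged [a1 + l] is at least [d],
    and the nonlinear terms, whatever their sign, are at most [(B2 + B3) e E <= d / 2]. *)
Lemma persistent_of_growing l : lq < l -> persistent l.
Proof.
move=> lql; have [T T0 [d d0 hd]] := averaged_lower_bound flow_sigma ca1 lmq sp_a1 lql.
have [g [cg dg]] := averaging flow_sigma ca1 T0.
have [G G0 hG] := bounded_on_Omega cptOmega cg.
have [B2 B20 h2] := bounded_on_Omega cptOmega ca2.
have [B3 B30 h3] := bounded_on_Omega cptOmega ca3.
pose E := expR (2 * G); have E0 : 0 < E by exact: expR_gt0.
pose D := 2 * (B2 + B3 + 1) * E.
have D0 : 0 < D by rewrite !mulr_gt0//; lra.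
pose e := Num.min 1 (d / D).
have e0 : 0 < e by rewrite lt_min ltr01 divr_gt0.
have e1 : e <= 1 by rewrite ge_min lexx.
have eD : e * D <= d by rewrite -ler_pdivlMr// ge_min lexx orbT.
apply: (@subsolution_persistent _ _ _ cptOmega flow_sigma _ _ _ ca1 ca2 ca3 _ rad_dissip
  l g (fun w => a1 w - J w T / T) e G e0 hG dg) => w.
have gE : expR (g w) <= E /\ expR (g w) ^+ 2 <= E.
  have := hG w; rewrite ler_norml => /andP[g1 g2].
  by rewrite /E expr2 -expRD !ler_expR; split; lra.
have [gE1 gE2] := gE; have := hd w.
have q2 : `|a2 w * (e * expR (g w))| <= B2 * (e * E).
  rewrite normrM ler_pM// ger0_norm; first by rewrite ler_pM2l.
  by rewrite mulr_ge0 ?expR_ge0// ltW.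
have q3 : `|a3 w * (e * expR (g w)) ^+ 2| <= B3 * (e * E).
  rewrite normrM ler_pM// normrX ger0_norm; last by rewrite mulr_ge0 ?expR_ge0// ltW.
  rewrite exprMn ler_pM ?exprn_ge0 ?expR_ge0 ?(ltW e0)//.
  by rewrite expr2 -[leRHS]mulr1 ler_pM2l.
move: q2 q3; rewrite !ler_norml => /andP[q2 _] /andP[_ q3].
have : 0 <= e * E by rewrite mulr_ge0 ?ltW.
by rewrite /D in eD; lra.
Qed.

Lemma persistent_ge l h : (forall w x, 0 <= x -> a2 w * x - a3 w * x ^+ 2 <= h) ->
  persistent l -> lq <= l + h.
Proof.
move=> hh [d d0 hd].
have [|C HC] := persistent_lower_bound rad_dissip d0 hd (h := h).
  by move=> w x dx; apply: hh; lra.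
exact: (bounded_below_ge flow_sigma ca1 lmq sp_a1 HC).
Qed.

(** * Families damped on the positive half line, such as the reflected one *)

Section damping.
Variable kappa : R.
Hypothesis kappa0 : 0 < kappa.
Hypothesis damped : forall w x, 0 <= x -> a2 w * x - a3 w * x ^+ 2 <= - kappa * x.

(** Staying above [d] costs at least [kappa d] of growth, so [beta l] cannot stay above a fixed
    level as [l] decreases to [lq]. *)
Lemma damped_ge l d : 0 < d -> (forall w, d <= beta l w) -> lq + kappa * d <= l.
Proof.
move=> d0 hd.
have [|C HC] := persistent_lower_bound rad_dissip d0 hd (h := - kappa * d).
  move=> w x dx; apply: le_trans (damped _ _) _; first lra.
  by rewrite ler_nM2l// oppr_lt0.
by have := bounded_below_ge flow_sigma ca1 lmq sp_a1 HC; lra.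
Qed.

Lemma damped_gt l : persistent l -> lq < l.
Proof.
move=> [d d0 hd]; have := damped_ge d0 hd; apply: lt_le_trans.
by rewrite ltrDl mulr_gt0.
Qed.

Lemma beta_small (eta : R) : 0 < eta -> exists2 l, lq < l <= lq + 1 & exists w, beta l w < eta.
Proof.
move=> eta0; have k0 : 0 < kappa * eta / 2 by rewrite divr_gt0 ?mulr_gt0.
pose m := Num.min 1 (kappa * eta / 2).
have m0 : 0 < m by rewrite lt_min ltr01.
exists (lq + m); first by rewrite ltrDl m0 lerD2l ge_min lexx.
apply: contrapT => h.
have : lq + kappa * eta <= lq + m.
  by apply: damped_ge => // w; rewrite leNgt; apply/negP => hw; apply: h; exists w.
apply/negP; rewrite -ltNge ltrD2l gt_min; apply/orP; right; lra.
Qed.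

(** A Harnack-type bound: the relative growth rate of [beta l] is bounded uniformly for these [l],
    since by monotonicity [rad (lq + 1)] bounds them all. *)
Lemma beta_growth : exists2 L : R, 0 <= L & forall l w t, lq < l <= lq + 1 ->
  beta l (sigma t w) <= expR (L * `|t|) * beta l w.
Proof.
have [B1 B10 h1] := bounded_on_Omega cptOmega ca1.
have [B2 B20 h2] := bounded_on_Omega cptOmega ca2.
have [B3 B30 h3] := bounded_on_Omega cptOmega ca3.
pose r := rad (lq + 1).
have r0 : 0 <= r by apply: le_trans (beta_norm cptOmega flow_sigma ca1 ca2 ca3 rad_dissip (lq + 1) point).
pose L := B1 + (`|lq| + 1) + B2 * r + B3 * r ^+ 2.
have L0 : 0 <= L by rewrite !addr_ge0// ?mulr_ge0 ?exprn_ge0 ?(ltW B10) ?(ltW B20) ?(ltW B30).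
exists L => // l w t /andP[ll lL].
pose b s := beta l (sigma s w).
pose q s := a1 (sigma s w) + l + a2 (sigma s w) * b s - a3 (sigma s w) * b s ^+ 2.
have b0 s : 0 <= b s by exact: beta_ge0.
have br s : b s <= r.
  by apply: le_trans (beta_le_rad cptOmega flow_sigma ca1 ca2 ca3 rad_dissip (lq + 1) _); exact: beta_mono.
have db (s : R) : is_derive s 1 b (b s * q s).
  by have := beta_sol cptOmega flow_sigma ca1 ca2 ca3 rad_dissip l w s; rewrite cub_factor.
have qL s : `|q s| <= L.
  have e2 : `|a2 (sigma s w) * b s| <= B2 * r by rewrite normrM ler_pM// ger0_norm.
  have e3 : `|a3 (sigma s w) * b s ^+ 2| <= B3 * r ^+ 2.
    by rewrite normrM ler_pM// ger0_norm ?exprn_ge0// !expr2 ler_pM.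
  have e1 := h1 (sigma s w).
  have el : `|l| <= `|lq| + 1.
    by rewrite ler_norml; have := ler_norm lq; have := ler_norm (- lq); rewrite normrN; lra.
  rewrite /q /L; apply: le_trans (ler_normB _ _) _; apply: lerD => //.
  apply: le_trans (ler_normD _ _) _; apply: lerD => //.
  by apply: le_trans (ler_normD _ _) _; exact: lerD.
have du (sg s : R) : is_derive s 1 (fun s => b s * expR (sg * L * s)) (b s * (q s + sg * L) * expR (sg * L * s)).
  have := drvM (db s) (drv_expR (drvM (drvc (sg * L) s) (drvid s))).
  by move/drv_eq; apply; ring.
have [t0|t0] := leP 0 t.
  have : - (b 0 * expR (-1 * L * 0)) <= - (b t * expR (-1 * L * t)).
    apply: (drv_nondecreasing t0 (fun s _ => drvN (du (-1) s))) => s _.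
    rewrite oppr_ge0 mulr_le0_ge0 ?expR_ge0// mulr_ge0_le0//.
    by have := qL s; rewrite ler_norml; lra.
  rewrite lerN2 mulr0 expR0 mulr1 /b flow0// => h.
  rewrite (ger0_norm t0); have := ler_wpM2l (expR_ge0 (L * t)) h; apply: le_trans.
  rewrite mulrCA -expRD mulN1r mulNr subrr expR0 mulr1//.
have : b t * expR (1 * L * t) <= b 0 * expR (1 * L * 0).
  apply: (drv_nondecreasing (ltW t0) (fun s _ => du 1 s)) => s _.
  rewrite mulr_ge0 ?expR_ge0// mulr_ge0//.
  by have := qL s; rewrite ler_norml; lra.
rewrite mulr0 expR0 mulr1 /b flow0// => h.
rewrite (ltr0_norm t0); have := ler_wpM2l (expR_ge0 (L * - t)) h; apply: le_trans.
by rewrite mulrCA -expRD mul1r mulrN addNr expR0 mulr1.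
Qed.

(** Written with [n.+1%:R^-1] to be a countable intersection whose pieces are open by
    semicontinuity. *)
Definition vanishing : set Omega :=
  [set w | forall n : nat, exists2 l, lq < l <= lq + 1 & beta l w < n.+1%:R^-1].

Lemma vanishing_lt w (e : R) : vanishing w -> 0 < e ->
  exists2 l, lq < l <= lq + 1 & beta l w < e.
Proof.
move=> vw /ltr_add_invr[n]; rewrite add0r => ne.
by have [l hl bl] := vw n; exists l => //; exact: lt_trans ne.
Qed.

(** Density: for a suitable [l] a very small value occurs somewhere; that point reaches a given open
    set within a uniformly bounded time, and [beta l] grows on the way by a bounded factor only. *)
Lemma vanishing_residual : residual vanishing.
Proof.
have [L L0 HL] := beta_growth.
pose F (n : nat) := [set w | exists2 l, lq < l <= lq + 1 & beta l w < n.+1%:R^-1].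
exists vanishing => //; exists F.
  move=> n; split.
    rewrite openE => w [l hl bl] /=.
    have e0 : 0 < (n.+1%:R^-1 - beta l w) / 2 by rewrite divr_gt0 ?subr_gt0.
    have := beta_near cptOmega flow_sigma ca1 ca2 ca3 rad_dissip l w e0.
    apply: filterS => w' h; exists l => //; move: h bl; move: (n.+1%:R^-1) => x; lra.
  move=> U U0 oU; have [T hT] := syndetic cptOmega flow_sigma min_sigma oU U0.
  have n0 : 0 < n.+1%:R^-1 :> R by rewrite invr_gt0.
  have [|l hl [w bw]] := @beta_small (expR (- (L * T)) * n.+1%:R^-1).
    by rewrite mulr_gt0 ?expR_gt0.
  have [s sT Us] := hT w; exists (sigma s w); split => //; exists l => //.
  apply: le_lt_trans (HL l w s hl) _.
  have E : expR (L * `|s|) <= expR (L * T) by rewrite ler_expR ler_wpM2l.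
  have := ler_wpM2r (beta_ge0 cptOmega flow_sigma ca1 ca2 ca3 rad_dissip l w) E; move/le_lt_trans; apply.
  by rewrite mulrC -ltr_pdivlMr ?expR_gt0// -expRN mulrC.
by apply/seteqP; split => w h; [move=> n _; exact: h|move=> n; exact: h].
Qed.

Lemma vanishing_invariant : flow_invariant sigma vanishing.
Proof.
have [L L0 HL] := beta_growth.
have V t w : vanishing w -> vanishing (sigma t w).
  move=> vw n; have n0 : 0 < n.+1%:R^-1 :> R by rewrite invr_gt0.
  have [|l hl bl] := vanishing_lt vw (e := expR (- (L * `|t|)) * n.+1%:R^-1).
    by rewrite mulr_gt0 ?expR_gt0.
  exists l => //; apply: le_lt_trans (HL l w t hl) _.
  by rewrite mulrC -ltr_pdivlMr ?expR_gt0// -expRN mulrC.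
move=> t; apply/seteqP; split => [_ [w vw <-]|w vw]; first exact: V.
by exists (sigma (- t) w); [exact: V|rewrite flowNK].
Qed.

Lemma vanishing_limit w : vanishing w -> beta l w @[l --> lq^'+] --> (0 : R).
Proof.
move=> vw; apply/cvgrPdist_lt => e e0.
have [l /andP[ll _] bl] := vanishing_lt vw e0.
near=> l'; rewrite sub0r normrN ger0_norm ?beta_ge0//.
apply: le_lt_trans bl; apply: beta_mono => //.
near: l'; exact: nbhs_right_le.
Unshelve. all: by end_near. Qed.

End damping.
End thresholds.

(** * The coefficients *)

Section construction.
Context {R : realType} {Omega : pmetricType R}.
Variable sigma : R -> Omega -> Omega.
Hypothesis cptOmega : compact [set: Omega].
Hypothesis flow_sigma : continuous_flow sigma.
Variable a1 : Omega -> R.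
Hypothesis ca1 : continuous a1.
Variables lm lq : R.
Hypothesis lmq : lm < lq.
Hypothesis sp_a1 : sacker_sell_spectrum sigma a1 = [set` `[- lq, - lm]].

(** With [z = expR (- g)], [a2 x - a3 x^2] equals [c - c (z x - 1)^2]: its maximum is [c] over every
    base point, attained at [x = expR g]. Averaging at [lq + c / 2] gives [g' <= a1 + lq + c / 2],
    which is the rate [a1 + (lq - c / 2)] plus the full gain [c]. The factor [1] is the [e] of
    [subsolution_persistent]. *)
Lemma pitchfork_coefficients : exists2 p : (Omega -> R) * (Omega -> R),
  [/\ continuous p.1, continuous p.2, forall w, 0 < p.1 w & forall w, 0 < p.2 w] &
  (forall w x, p.1 w * x - p.2 w * x ^+ 2 <= lq - lm) /\
  exists (g g1 : Omega -> R) (G : R), [/\ forall w, `|g w| <= G,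
    forall w (t : R), is_derive t 1 (fun t => g (sigma t w)) (g1 (sigma t w)) &
    forall w, g1 w <= a1 w + (lq - (lq - lm) / 2) + p.1 w * (1 * expR (g w)) - p.2 w * (1 * expR (g w)) ^+ 2].
Proof.
pose c := lq - lm; have c0 : 0 < c by rewrite subr_gt0.
have lql : lq < lq + c / 2 by rewrite ltrDl divr_gt0.
have [T T0 [d d0 hd]] := averaged_lower_bound flow_sigma ca1 lmq sp_a1 lql.
have [g [cg dg]] := averaging flow_sigma ca1 T0.
have [G _ hG] := bounded_on_Omega cptOmega cg.
have cE (k m : R) : continuous (fun w => k * expR (m * g w)).
  move=> w; apply: cvgM; first exact: cvg_cst.
  apply: continuous_comp; last exact: continuous_expR.
  by apply: cvgM; [exact: cvg_cst|exact: cg].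
have E2 (x : R) : expR (-2 * x) = expR (-1 * x) ^+ 2.
  by rewrite expr2 -expRD; congr expR; ring.
exists (fun w => 2 * c * expR (-1 * g w), fun w => c * expR (-2 * g w)) => /=.
  split; [exact: cE|exact: cE| |].
  - by move=> w; rewrite !mulr_gt0 ?expR_gt0.
  - by move=> w; rewrite !mulr_gt0 ?expR_gt0.
split.
  move=> w x; rewrite E2 -/c; set z := expR _.
  have -> : 2 * c * z * x - c * z ^+ 2 * x ^+ 2 = c - c * (z * x - 1) ^+ 2 by ring.
  by rewrite gerBl mulr_ge0 ?sqr_ge0// ltW.
exists g, (fun w => a1 w - orbint sigma a1 w T / T), G; split => // w.
have z1 : expR (-1 * g w) * expR (g w) = 1 by rewrite -expRD mulN1r addNr expR0.
rewrite -[leRHS]addrA; have -> : 2 * c * expR (-1 * g w) * (1 * expR (g w)) - c * expR (-2 * g w) * (1 * expR (g w)) ^+ 2 = c.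
  rewrite E2; set z := expR _ in z1 *; set y := expR _ in z1 *.
  have -> : 2 * c * z * (1 * y) - c * z ^+ 2 * (1 * y) ^+ 2 = c * (z * y) * (2 - z * y) by ring.
  by rewrite z1; ring.
by have := hd w; rewrite -/c; lra.
Qed.

End construction.

Unset Implicit Arguments.

Theorem theorem4p14 (R : realType) (Omega : pmetricType R)
    (sigma : R -> Omega -> Omega)
    (cptOmega : compact [set: Omega])
    (flow_sigma : continuous_flow sigma)
    (min_sigma : minimal_flow sigma)
    (n : nat) (n_ge2 : (2 <= n)%N)
    (m : 'I_n -> probability (borel Omega) R)
    (erg : ergodic_measures_are sigma m)
    (a1 : Omega -> R) (cont_a1 : continuous a1)
    (lm lp : R) (lm_lt_lp : lm < lp)
    (sp_a1 : sacker_sell_spectrum sigma a1 = [set` `[- lp, - lm]]) :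
  exists a2 a3 : Omega -> R,
    [/\ continuous a2, continuous a3, forall w, 0 < a2 w, forall w, 0 < a3 w &
        generalized_pitchfork sigma (cubic_family a1 a2 a3) lm lp].
Proof.
have [[a2 a3] [/= ca2 ca3 a2_gt0 a3_gt0] [q_le [g [g1 [G [gG dg sub]]]]]] :=
  pitchfork_coefficients cptOmega flow_sigma cont_a1 lm_lt_lp sp_a1.
exists a2, a3; split => //.
have cp1 l : continuous (fun w => a1 w + l) by exact: shifted_continuous.
have cna2 : continuous (fun w => - a2 w) by move=> w; apply: cvgN; exact: ca2.
have [rad hrad] : {rad : R -> R & forall l, dissip (fun w => a1 w + l) a2 a3 (rad l)}.
  apply: (@choice _ _ (fun l r => dissip (fun w => a1 w + l) a2 a3 r)) => l.
  by have [r r1 hr] := dissipation cptOmega (@cp1 l) ca2 ca3 a3_gt0; exists r.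
have hradN l : dissip (fun w => a1 w + l) (fun w => - a2 w) a3 (rad l) by exact: dissip_opp.
pose pers := persistent cptOmega flow_sigma cont_a1 ca2 ca3 rad.
pose persN := persistent cptOmega flow_sigma cont_a1 cna2 ca3 rad.
(* After reflection the quadratic term is at most [- kappa x^2]; positivity of [a2] thus damps the
   negative side and decides which diagram occurs. *)
have [kappa kappa0 hk] := positive_below cptOmega ca2 a2_gt0.
have damped w x : 0 <= x -> - a2 w * x - a3 w * x ^+ 2 <= - kappa * x.
  move=> x0; rewrite -lerBrDr opprK; apply: le_trans (_ : - kappa * x <= _).
    by rewrite ler_wpM2r// lerN2.
  by rewrite lerDl mulr_ge0 ?sqr_ge0// ltW.
have pos l : lp < l -> pers l by exact: (persistent_of_growing cptOmega flow_sigma cont_a1 ca2 ca3 lm_lt_lp sp_a1 hrad).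
have posN l : lp < l -> persN l by exact: (persistent_of_growing cptOmega flow_sigma cont_a1 cna2 ca3 lm_lt_lp sp_a1 hradN).
have negN l : l <= lp -> ~ persN l.
  by move=> llp /(damped_gt lm_lt_lp sp_a1 hradN kappa0 damped); rewrite ltNge llp.
have pmid : pers (lp - (lp - lm) / 2).
  exact: (subsolution_persistent cptOmega flow_sigma cont_a1 ca2 ca3 hrad ltr01 gG dg sub).
have pge l : pers l -> lm <= l.
  by move/(persistent_ge lm_lt_lp sp_a1 hrad (fun w x _ => q_le w x)); lra.
(* The diagram leaves the parameter [l0] itself open, so it does not matter whether the infimum is
   attained. *)
pose l0 := inf pers.
have hl : has_lbound pers by exists lm => l; exact: pge.
have l0_lt l : l < l0 -> ~ pers l by move=> ll0 /(ge_inf hl); rewrite leNgt ll0.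
have l0_gt l : l0 < l -> exists2 l1, l1 < l & pers l1.
  rewrite -subr_gt0 => e0.
  have hi : has_inf pers by split => //; exists (lp - (lp - lm) / 2).
  by have [l1 pl1] := inf_adherent e0 hi; rewrite addrC subrK => l1l; exists l1.
have lm_l0 : lm <= l0 by apply: lb_le_inf; [exists (lp - (lp - lm) / 2)|exact: pge].
have l0_lp : l0 < lp by apply: le_lt_trans (ge_inf hl pmid) _; lra.
exists (alpha cptOmega flow_sigma cont_a1 cna2 ca3 rad), (beta cptOmega flow_sigma cont_a1 ca2 ca3 rad).
split; first by move=> l; exact: (band_bounds cptOmega flow_sigma cont_a1 ca2 cna2 ca3 hrad l).
(* This is [GP_alpha]: the lower equilibrium collides with zero at [lp], where the upper one is
   already bounded away from it. *)
left; split => //.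
- split => l hlt.
  + exact: (zero_attractive cptOmega flow_sigma cont_a1 ca2 ca3 lm_lt_lp sp_a1 hrad hlt).
  + exact: (zero_nonhyperbolic cptOmega flow_sigma cont_a1 ca2 ca3 lm_lt_lp sp_a1 hlt).
  + exact: (zero_repulsive cptOmega flow_sigma cont_a1 ca2 ca3 lm_lt_lp sp_a1 hlt).
  (* The classification asks for a persistent parameter strictly below [l]; the midpoint is still
     above [lp]. *)
  + have m1 : (lp + l) / 2 < l by lra.
    have m2 : lp < (lp + l) / 2 by lra.
    have m3 : lm <= l by lra.
    exact: (three_minimal_sets min_sigma a3_gt0 lm_lt_lp sp_a1 hrad m1 (pos _ m2) (posN _ m2) m3).
- exists (vanishing cptOmega flow_sigma cont_a1 cna2 ca3 lp rad); split.
  + exact: (vanishing_residual cptOmega flow_sigma min_sigma cont_a1 cna2 ca3 lm_lt_lp sp_a1 hradN kappa0 damped).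
  + exact: (vanishing_invariant cptOmega flow_sigma cont_a1 cna2 ca3 lp hradN).
  + move=> w vw; under eq_cvg do rewrite subr0.
    have := cvgN (vanishing_limit hradN vw); rewrite oppr0; exact.
- exists l0; first by rewrite lm_l0.
  split => l hlt.
  + apply: (only_zero min_sigma a3_gt0 lm_lt_lp sp_a1 hrad (l0_lt _ hlt)).
    by apply: negN; lra.
  + apply: (band_eq_zero min_sigma lm_lt_lp sp_a1 hrad hlt); last by apply: negN; lra.
    by apply: l0_lt; lra.
  + have /andP[h1 h2] := hlt; have [l1 l1l pl1] := l0_gt l h1.
    apply: (two_minimal min_sigma a3_gt0 lm_lt_lp sp_a1 hrad l1l pl1 (negN _ h2)); lra.
Qed.
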